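(* Under the setting and notation of the context, suppose Assumption $(\mathcal A^p_1)$ holds for every $p=1,\dots,m$. Then, as $x\to\infty$, $$\mathbb P[X^{(m)}\ge x]=\delta_1(\log x)^{\delta_2}x^{\delta_3}\exp\left\{-\frac{\log^2x}{2\delta_4}\right\}\left(1+O\left((\log x)^{-1/2}\right)\right).$$
   Context: Let $Y=(Y_1,\dots,Y_n)$ be a Gaussian vector with mean $\mu\in\mathbb R^n$ and covariance matrix $\mathfrak B=(b_{ij})$ with $\det\mathfrak B>0$. For $1\le m\le n$ let $X^{(m)}=\sum_{k=1}^me^{Y_k}-\sum_{k=m+1}^ne^{Y_k}$. For $p\in\{1,\dots,m\}$ let $\Delta^p_{m,n}$ be the set of $w\in\mathbb R^n$ with $w_i=0$ for $i\in\{1,\dots,m\}\setminus\{p\}$, $w_p\ge0$, $w_i\le0$ for $i=m+1,\dots,n$, and $\sum_iw_i=1$; let $\bar w_p$ be the unique minimizer of $w^\top\mathfrak Bw$ over $\Delta^p_{m,n}$. Let $\bar I^{(p)}=\{i:(\bar w_p)_i\ne0\}=\{\bar k^{(p)}(1)<\dots<\bar k^{(p)}(\bar n^{(p)})\}$, $\bar\mu^{(p)}_i=\mu_{\bar k^{(p)}(i)}$, $\bar{\mathfrak B}^{(p)}=(b_{\bar k^{(p)}(i),\bar k^{(p)}(j)})_{i,j=1}^{\bar n^{(p)}}$, $\bar a^{(p)}_{ij}$ the entries of its inverse, $\bar A^{(p)}_k=\sum_{j=1}^{\bar n^{(p)}}\bar a^{(p)}_{kj}$, and $\bar S^{(p)}=\sum_{j=1}^{\bar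 n^{(p)}}\bar A^{(p)}_j$. Assumption $(\mathcal A^p_1)$: for every $i\in\{m+1,\dots,n\}\setminus\bar I^{(p)}$, $(e^i-\bar w_p)^\top\mathfrak B\bar w_p\ne0$, where $e^i$ is the $i$-th standard basis vector. Define $C^{(p)}=\frac{1}{\sqrt{2\pi\det\bar{\mathfrak B}^{(p)}}}\sqrt{\frac{\bar S^{(p)}}{\prod_{i}|\bar A^{(p)}_i|}}\exp\{-\frac12\sum_{i,l=1}^{\bar n^{(p)}}\bar a^{(p)}_{il}(\log\frac{\bar S^{(p)}}{|\bar A^{(p)}_i|}+\bar\mu^{(p)}_i)(\log\frac{\bar S^{(p)}}{|\bar A^{(p)}_l|}+\bar\mu^{(p)}_l)\}$, $\delta_{1,p}=C^{(p)}/\bar S^{(p)}$, $\delta_{2,p}=-\frac{1+\bar n^{(p)}}{2}$, $\delta_{3,p}=\sum_{i=1}^{\bar n^{(p)}}\bar A^{(p)}_i(\log\frac{\bar S^{(p)}}{|\bar A^{(p)}_i|}+\bar\mu^{(p)}_i)$, $\delta_{4,p}=(\bar S^{(p)})^{-1}$. Then $\delta_4=\max_{1\le p\le m}\delta_{4,p}$, $\mathcal P_4=\{p:\delta_{4,p}=\delta_4\}$; $\delta_3=\max_{p\in\mathcal P_4}\delta_{3,p}$, $\mathcal P_3=\{p\in\mathcal P_4:\delta_{3,p}=\delta_3\}$; $\delta_2=\max_{p\in\mathcal P_3}\delta_{2,p}$, $\mathcal P_2=\{p\in\mathcal P_3:\delta_{2,p}=\delta_2\}$; $\delta_1=\sum_{p\in\mathcal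 P_2}\delta_{1,p}$. *)

(* Defs.v *)
From HB Require Import structures.
From mathcomp Require Import all_boot all_order all_algebra.
From mathcomp Require Import all_classical all_reals all_analysis.
Unset Printing Implicit Defensive.
Import Order.TTheory GRing.Theory Num.Theory.
Local Open Scope ring_scope.

Section Defs.
Context {R : realType}.

Definition bform {n} (M : 'M[R]_n) (v u : 'cV[R]_n) : R := (v^T *m M *m u) 0 0.

Definition cons_cV {n} (t : R) (v : 'cV[R]_n) : 'cV[R]_n.+1 :=
  \col_(i < n.+1) (if unlift ord0 i is Some j then v j 0 else t).

Fixpoint iint {n : nat} : ('cV[R]_n -> \bar R) -> \bar R :=
  match n return ('cV[R]_n -> \bar R) -> \bar R with
  | 0 => fun F => F 0
  | k.+1 => fun F =>
      (\int[@lebesgue_measure R]_t iint (fun v : 'cV[R]_k => F (cons_cV t v)))%E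
  end.

Definition gauss_density {n} (mu : 'cV[R]_n) (B : 'M[R]_n) (y : 'cV[R]_n) : R :=
  (Num.sqrt ((2 * pi) ^+ n * \det B))^-1
  * expR (- (1/2) * bform (invmx B) (y - mu) (y - mu)).

(* Y = (Y_0,...,Y_{n-1}) is a Gaussian vector with mean mu and covariance B
   (det B > 0): its law has the Gaussian density, i.e. it agrees with the
   Gaussian law on every box  prod_i ]a_i, b_i]  (boxes determine the law). *)
Definition gaussian_vector {d} {T : measurableType d} (P : probability T R)
  {n} (Y : 'I_n -> T -> R) (mu : 'cV[R]_n) (B : 'M[R]_n) : Prop :=
  forall a b : 'I_n -> R,
    P [set t | forall i, a i < Y i t <= b i]%classic
    = iint (fun y : 'cV[R]_n =>
        (if [forall i, (a i < y i 0) && (y i 0 <= b i)]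
         then gauss_density mu B y else 0)%:E).

Definition Xm {d} {T : measurableType d} {n} (m : nat) (Y : 'I_n -> T -> R) (t : T) : R :=
  \sum_(k < n | (k < m)%N) expR (Y k t) - \sum_(k < n | (m <= k)%N) expR (Y k t).

Definition in_Delta {n} (m : nat) (p : 'I_n) (w : 'cV[R]_n) : Prop :=
  [/\ forall i : 'I_n, (i < m)%N -> i != p -> w i 0 = 0,
      0 <= w p 0,
      forall i : 'I_n, (m <= i)%N -> w i 0 <= 0
    & \sum_i w i 0 = 1].

Definition is_minimizer {n} (m : nat) (p : 'I_n) (B : 'M[R]_n) (w : 'cV[R]_n) : Prop :=
  in_Delta m p w /\ forall w', in_Delta m p w' -> bform B w w <= bform B w' w'.

(* Ibar = support of w, enumerated increasingly by enum_val (= kbar) *)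
Definition Ibar {n} (w : 'cV[R]_n) : {set 'I_n} := [set i | w i 0 != 0].
Definition nbar {n} (w : 'cV[R]_n) : nat := #|Ibar w|.
Definition Bbar {n} (B : 'M[R]_n) (w : 'cV[R]_n) : 'M[R]_(#|Ibar w|) :=
  \matrix_(i, j) B (enum_val i) (enum_val j).
Definition mubar {n} (mu : 'cV[R]_n) (w : 'cV[R]_n) (i : 'I_#|Ibar w|) : R :=
  mu (enum_val i) 0.
Definition abar {n} (B : 'M[R]_n) (w : 'cV[R]_n) : 'M[R]_(#|Ibar w|) := invmx (Bbar B w).
Definition Abar {n} (B : 'M[R]_n) (w : 'cV[R]_n) (k : 'I_#|Ibar w|) : R :=
  \sum_j abar B w k j.
Definition Sbar {n} (B : 'M[R]_n) (w : 'cV[R]_n) : R := \sum_j Abar B w j.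
Definition Lbar {n} (mu : 'cV[R]_n) (B : 'M[R]_n) (w : 'cV[R]_n) (i : 'I_#|Ibar w|) : R :=
  ln (Sbar B w / `|Abar B w i|) + mubar mu w i.

Definition Cbar {n} (mu : 'cV[R]_n) (B : 'M[R]_n) (w : 'cV[R]_n) : R :=
  (Num.sqrt (2 * pi * \det (Bbar B w)))^-1
  * Num.sqrt (Sbar B w / \prod_i `|Abar B w i|)
  * expR (- (1/2) * \sum_i \sum_l abar B w i l * Lbar mu B w i * Lbar mu B w l).

Definition delta1p {n} mu B (w : 'cV[R]_n) : R := Cbar mu B w / Sbar B w.
Definition delta2p {n} (w : 'cV[R]_n) : R := - ((1 + (nbar w)%:R) / 2).
Definition delta3p {n} mu B (w : 'cV[R]_n) : R :=
  \sum_i Abar B w i * Lbar mu B w i.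
Definition delta4p {n} B (w : 'cV[R]_n) : R := (Sbar B w)^-1.

Definition assumption_A1 {n} (m : nat) (B : 'M[R]_n) (w : 'cV[R]_n) : Prop :=
  forall i : 'I_n, (m <= i)%N -> i \notin Ibar w ->
    bform B (delta_mx i 0 - w) w != 0.

(* maximum of f over a finite set A (seeded by a value of f on A, so it is the
   true maximum whenever A is nonempty) *)
Definition maxover {I : finType} (A : {set I}) (f : I -> R) : R :=
  \big[Num.max/(if [pick p in A] is Some p then f p else 0)]_(p in A) f p.

Section Deltas.
Context {n : nat}.
Variables (m : nat) (mu : 'cV[R]_n) (B : 'M[R]_n) (wbar : 'I_n -> 'cV[R]_n).
Definition Pm : {set 'I_n} := [set p : 'I_n | (p < m)%N].
Definition delta4 : R := maxover Pm (fun p => delta4p B (wbar p)).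
Definition P4 : {set 'I_n} := [set p in Pm | delta4p B (wbar p) == delta4].
Definition delta3 : R := maxover P4 (fun p => delta3p mu B (wbar p)).
Definition P3 : {set 'I_n} := [set p in P4 | delta3p mu B (wbar p) == delta3].
Definition delta2 : R := maxover P3 (fun p => delta2p (wbar p)).
Definition P2 : {set 'I_n} := [set p in P3 | delta2p (wbar p) == delta2].
Definition delta1 : R := \sum_(p in P2) delta1p mu B (wbar p).

Definition main_term (x : R) : R :=
  delta1 * (ln x) `^ delta2 * x `^ delta3 * expR (- (ln x ^+ 2) / (2 * delta4)).
End Deltas.

End Defs.

(* Main.v *)
Require Import Defs.
From HB Require Import structures.
From mathcomp Require Import all_boot all_order all_algebra.
From mathcomp Require Import all_classical all_reals all_analysis.
From mathcomp Require Import measurable_realfun ring lra.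
Import Order.TTheory GRing.Theory Num.Theory.
Import numFieldNormedType.Exports.
Local Open Scope ring_scope.
Set Implicit Arguments.
Unset Strict Implicit.
(* On the event {X >= e^L} some coordinate p < m is within a constant of L and
   dominates the others, so w . Y >= L - const for every w in Delta^p. Minimising
   w^T B w gives the Gaussian exponent -L^2 / (2 V_p) with V_p = 1/S^(p), attained
   at the peak y = L B w / V_p; its coordinates equal L on the support of w and, by
   the first-order conditions, A_1 and the maximality of V_p, are strictly smaller
   elsewhere. Chernoff bounds dispose of the p that do not maximise V_p and of the
   points at distance more than eps L from the peaks. Near a peak the coordinates off
   the support are exponentially negligible in X, and the boundary of {X >= e^L} is
   v_p = log (1 + sum exp v_i), where v = y - L peak. Laplace's method there
   (scale 1/L across the boundary, 1/sqrt L along it, Gaussian integral in the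
   remaining coordinates) yields the term of index p with relative error L^(-1/2);
   its constant is evaluated by a single Gaussian integral whose determinant
   factors by Sylvester's identity. *)

(** A relative error [L^(-1/2)] needs bounds that are uniform in [L] and integrable over the whole
    rescaled space. They are available because the substitution at a peak is exact: it turns the
    exponent into [L] times the Jensen gap of a log-sum-exp, taken at scale [1/sqrt L]. That gap is
    quadratic near 0 but grows only linearly, so the common majorant is [exp (-c |v|_1)] and not a
    Gaussian; a Gibbs inequality with tilted weights gives it for all [L >= 1] at once. The cubic
    Taylor remainder of the gap, multiplied by [L], and the displacement of the remaining Gaussian
    weight are both of order [L^(-1/2)]; the uncertainty about the boundary lives in a slab of width
    of order [1/L]. The Jacobian [L^-1 * L^(-(nbar-1)/2)] is the origin of [delta2]. Two distinct
    values of [delta2p] differ by at least 1/2, so a term that loses only there is just absorbed by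
    the error. All substitutions are triangular, so Tonelli and one-dimensional affine substitutions
    suffice and no Jacobian theorem is used. *)

(** * Integration over column vectors *)
Section product_sigma_finite.
Local Open Scope classical_set_scope.
Context d1 d2 (T1 : measurableType d1) (T2 : measurableType d2) (R : realType).
Variable m1 : {sigma_finite_measure set T1 -> \bar R}.
Variable m2 : {sigma_finite_measure set T2 -> \bar R}.

(* A fresh head constant: on [product_measure1] itself, canonical inference of a
   sigma-finite structure only succeeds for subprobabilities. *)
Definition sigma_finite_prod : set (T1 * T2) -> \bar R := (m1 \x m2)%E.

HB.instance Definition _ := Measure.on sigma_finite_prod.

Lemma sigma_finite_prodP : sigma_finite setT sigma_finite_prod.
Proof.
have /sigma_finiteP[F [TF ndF Foo]] := sigma_finiteT m1.
have /sigma_finiteP[G [TG ndG Goo]] := sigma_finiteT m2.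
exists (fun n => F n `*` G n).
  rewrite -setXTT TF TG predeqE => -[x y]; split=> [[/= [n _ Fnx] [k _ Gky]]|].
    exists (maxn n k) => //; split.
    - by move: x Fnx; exact/subsetPset/ndF/leq_maxl.
    - by move: y Gky; exact/subsetPset/ndG/leq_maxr.
  by move=> [n _ []/= ? ?]; split; exists n.
move=> k; have [? ?] := Foo k; have [? ?] := Goo k.
split; first exact: measurableX.
by rewrite /sigma_finite_prod product_measure1E// lte_mul_pinfty// ge0_fin_numE.
Qed.

HB.instance Definition _ :=
  Measure_isSigmaFinite.Build _ _ _ sigma_finite_prod sigma_finite_prodP.

End product_sigma_finite.

Section iterated_space.
Local Open Scope classical_set_scope.
Variable R : realType.

(* Bundling the measurable structure lets the carrier of a tower of products be
   computed by recursion on the dimension; Tonelli then applies at each step. *)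
Record sfspace := SFSpace {
  sf_disp : measure_display ;
  sf_type : measurableType sf_disp ;
  sf_mu : {sigma_finite_measure set sf_type -> \bar R} }.

Definition sfspace_prod (S : sfspace) : sfspace :=
  @SFSpace _ _ (sigma_finite_prod (@lebesgue_measure R) (sf_mu S)).

Fixpoint itspace (n : nat) : sfspace :=
  if n is k.+1 then sfspace_prod (itspace k) else @SFSpace _ _ (@dirac _ unit tt R).

Fixpoint vec (n : nat) : sf_type (itspace n) -> 'cV[R]_n :=
  match n return sf_type (itspace n) -> 'cV[R]_n with
  | 0 => fun _ => 0
  | k.+1 => fun e => cons_cV e.1 (@vec k e.2)
  end.

Definition tail_cV n (v : 'cV[R]_n.+1) : 'cV[R]_n := \col_i v (lift ord0 i) 0.

Fixpoint unvec (n : nat) : 'cV[R]_n -> sf_type (itspace n) :=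
  match n return 'cV[R]_n -> sf_type (itspace n) with
  | 0 => fun _ => tt
  | k.+1 => fun v => (v ord0 0, @unvec k (tail_cV v))
  end.

Definition J n (F : 'cV[R]_n -> \bar R) : \bar R :=
  (\int[sf_mu (itspace n)]_e F (vec e))%E.

Definition mcV d (U : sigmaRingType d) n (F : 'cV[R]_n -> U) :=
  measurable_fun [set: sf_type (itspace n)] (fun e => F (vec e)).

Lemma cons_cV0 n (t : R) (v : 'cV[R]_n) : cons_cV t v ord0 0 = t.
Proof. by rewrite mxE unlift_none. Qed.

Lemma cons_cVS n (t : R) (v : 'cV[R]_n) i : cons_cV t v (lift ord0 i) 0 = v i 0.
Proof. by rewrite mxE liftK. Qed.

Lemma cons_tail n (v : 'cV[R]_n.+1) : cons_cV (v ord0 0) (tail_cV v) = v.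
Proof.
apply/colP => i; case: (unliftP ord0 i) => [j|] ->; first by rewrite cons_cVS mxE.
by rewrite cons_cV0.
Qed.

Lemma unvecK n : cancel (@unvec n) (@vec n).
Proof.
elim: n => [|n IH] v /=; first by apply/colP => -[].
by rewrite IH cons_tail.
Qed.

Lemma measurable_coord n (i : 'I_n) : mcV (fun v : 'cV[R]_n => v i 0 : measurableTypeR R).
Proof.
elim: n i => [|n IH] i; first by case: i.
rewrite /mcV /=.
case: (unliftP ord0 i) => [j|] ->.
  under eq_fun do rewrite cons_cVS.
  exact: (measurableT_comp (IH j) measurable_snd).
under eq_fun do rewrite cons_cV0.
exact: measurable_fst.
Qed.

Lemma measurable_unvec d (U : measurableType d) n (G : U -> 'cV[R]_n) :
  (forall i, measurable_fun setT (fun u => G u i 0 : measurableTypeR R)) ->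
  measurable_fun setT (fun u => unvec (G u)).
Proof.
elim: n G => [|n IH] G mG /=; first exact: measurable_cst.
apply: measurable_fun_pair; first exact: mG.
by apply: IH => i; under eq_fun do rewrite mxE; exact: mG.
Qed.

Lemma mcV_comp_gen d d' (U : sigmaRingType d) (V : measurableType d') n
    (F : 'cV[R]_n -> U) (G : V -> 'cV[R]_n) :
  mcV F -> (forall i, measurable_fun setT (fun u => G u i 0 : measurableTypeR R)) ->
  measurable_fun setT (fun v => F (G v)).
Proof.
move=> mF mG; rewrite (_ : (fun v => _) = (fun e => F (vec e)) \o (fun v => unvec (G v))).
  by apply: (measurable_comp measurableT) => //; exact: measurable_unvec.
by apply/funext => v /=; rewrite unvecK.
Qed.

Lemma mcV_comp d (U : sigmaRingType d) n k (F : 'cV[R]_n -> U)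
    (G : 'cV[R]_k -> 'cV[R]_n) :
  mcV F -> (forall i, mcV (fun v => G v i 0 : measurableTypeR R)) ->
  mcV (fun v => F (G v)).
Proof. by move=> mF mG; exact: mcV_comp_gen mF mG. Qed.

Lemma mcV_cons d (U : sigmaRingType d) n (F : 'cV[R]_n.+1 -> U) t :
  mcV F -> mcV (fun v => F (cons_cV t v)).
Proof.
move=> mF; apply: mcV_comp => // i.
case: (unliftP ord0 i) => [j|] ->.
  rewrite /mcV; under eq_fun do rewrite cons_cVS; exact: measurable_coord.
rewrite /mcV; under eq_fun do rewrite cons_cV0; exact: measurable_cst.
Qed.

Lemma J_cons n (F : 'cV[R]_n.+1 -> \bar R) : mcV F -> (forall v, (0 <= F v)%E) ->
  J F = (\int[@lebesgue_measure R]_t J (fun v => F (cons_cV t v)))%E.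
Proof. by move=> mF F0; rewrite /J /= fubini_tonelli1. Qed.

Lemma J_cons2 n (F : 'cV[R]_n.+1 -> \bar R) : mcV F -> (forall v, (0 <= F v)%E) ->
  J F = J (fun v => \int[@lebesgue_measure R]_t F (cons_cV t v))%E.
Proof. by move=> mF F0; rewrite /J /= fubini_tonelli2. Qed.

Lemma mcV_int n (F : 'cV[R]_n.+1 -> \bar R) : mcV F -> (forall v, (0 <= F v)%E) ->
  mcV (fun v => \int[@lebesgue_measure R]_t F (cons_cV t v))%E.
Proof.
move=> mF F0.
have := @measurable_fun_fubini_tonelli_G _ _ (measurableTypeR R)
  (sf_type (itspace n)) R (@lebesgue_measure R) (fun e => F (cons_cV e.1 (vec e.2))).
by apply => // e.
Qed.

Lemma mcV_intJ n (F : 'cV[R]_n.+1 -> \bar R) : mcV F -> (forall v, (0 <= F v)%E) ->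
  measurable_fun setT (fun t => J (fun v => F (cons_cV t v))).
Proof.
move=> mF F0.
have := @measurable_fun_fubini_tonelli_F _ _ (measurableTypeR R)
  (sf_type (itspace n)) R (sf_mu (itspace n)) (fun e => F (cons_cV e.1 (vec e.2))).
by apply => // e.
Qed.

Lemma J0 (F : 'cV[R]_0 -> \bar R) : J F = F 0.
Proof. by rewrite /J integral_dirac// diracT mul1e. Qed.

(** Passage from the recursive integral in the definition of a Gaussian vector to one integral
    against a product measure, to which the general theory applies. *)
Lemma iintE n (F : 'cV[R]_n -> \bar R) : mcV F -> (forall v, (0 <= F v)%E) ->
  iint F = J F.
Proof.
elim: n F => [|n IH] F mF F0; first by rewrite J0.
rewrite J_cons//=; apply: eq_integral => t _; apply: IH => //.
exact: mcV_cons.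
Qed.

End iterated_space.

(** * Finite measures are determined by boxes *)

Section measure_uniqueness.
Local Open Scope classical_set_scope.

Section restricted_pushforward.
Context d1 d2 (T1 : measurableType d1) (T2 : measurableType d2) (R : realType).
Variables (m : {measure set T1 -> \bar R}) (f : T1 -> T2) (D : set T1).
Variables (mf : measurable_fun setT f) (mD : measurable D).

(** With [f] a projection and [D] a slab, this is a section of a measure on a product, so uniqueness
    can be applied one factor at a time; with [D = setT] it is the law of [f]. The measurability
    proofs are arguments so that the measure structure can be inferred. *)
Definition restr_pushforward of measurable_fun setT f & measurable D :=
  fun A : set T2 => m (f @^-1` A `&` D).

Let nu := restr_pushforward mf mD.

Let mpre A : measurable A -> measurable (f @^-1` A).
Proof. by move=> mA; rewrite -[X in measurable X]setTI; exact: mf. Qed.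

Let nu0 : nu set0 = 0%E.
Proof. by rewrite /nu /restr_pushforward preimage_set0 set0I measure0. Qed.

Let nu_ge0 A : (0 <= nu A)%E. Proof. exact: measure_ge0. Qed.

Let nu_additive : semi_sigma_additive nu.
Proof.
move=> F mF tF mU; rewrite /nu /restr_pushforward preimage_bigcup setI_bigcupl.
apply: measure_semi_sigma_additive.
- by move=> n; apply: measurableI => //; exact: mpre.
- apply/trivIsetP => i j _ _ ij; rewrite setIACA -preimage_setI.
  by move/trivIsetP : tF => /(_ _ _ Logic.I Logic.I ij) ->; rewrite preimage_set0 set0I.
- by rewrite -setI_bigcupl -preimage_bigcup; apply: measurableI => //; exact: mpre.
Qed.

HB.instance Definition _ := isMeasure.Build _ _ _ (restr_pushforward mf mD)
  nu0 nu_ge0 nu_additive.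

End restricted_pushforward.

Variable R : realType.

Lemma finite_measureR_unique (m1 m2 : {measure set (measurableTypeR R) -> \bar R}) :
  (m1 setT < +oo)%E -> (forall a b : R, m1 `]a, b] = m2 `]a, b]) ->
  forall A, measurable A -> m1 A = m2 A.
Proof.
move=> m1oo m12 A mA.
apply: (@measure_unique _ _ (measurableTypeR R) (@ocitv R)
  (fun k : nat => `](- k%:R)%R, k%:R])) => //.
- exact: ocitvI.
- by move=> k; exists (- k%:R, k%:R).
- by rewrite bigcup_itvT.
- by move=> _ [[a b] _ <-]; exact: m12.
- move=> k; apply: le_lt_trans m1oo; apply: le_measure; rewrite ?inE//.
Qed.

Definition box n (a b : 'I_n -> R) : set (sf_type (itspace R n)) :=
  [set e | forall i, a i < vec e i 0 <= b i].

(** Two passes: with an interval fixed in the first factor, induction identifies the measures in the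
    second; with a measurable set fixed in the second, the one-dimensional case treats the first.
    Measurable rectangles then form a generating pi-system. *)
Lemma itspace_measure_unique n (m1 m2 : {measure set (sf_type (itspace R n)) -> \bar R}) :
  (m1 setT < +oo)%E -> (m2 setT < +oo)%E ->
  (forall a b, m1 (box a b) = m2 (box a b)) ->
  forall A, measurable A -> m1 A = m2 A.
Proof.
elim: n m1 m2 => [|n IH] m1 m2 m1oo m2oo m12 A mA.
  have bT : box (fun _ : 'I_0 => 0) (fun _ => 0) = setT by rewrite -subTset => e _ [].
  have [->|/set0P[t At]] := eqVneq A set0; first by rewrite !measure0.
  suff -> : A = setT by have := m12 (fun _ => 0) (fun _ => 0); rewrite bT.
  by rewrite -subTset => -[] _; case: t At.
pose T2 := sf_type (itspace R n).
pose m1' : {measure set (measurableTypeR R * T2)%type -> \bar R} := m1.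
pose m2' : {measure set (measurableTypeR R * T2)%type -> \bar R} := m2.
have fst_m : measurable_fun setT (fst : measurableTypeR R * T2 -> _) := measurable_fst.
have snd_m : measurable_fun setT (snd : measurableTypeR R * T2 -> _) := measurable_snd.
have fin (m : {measure set (measurableTypeR R * T2)%type -> \bar R}) B :
    (m setT < +oo)%E -> measurable B -> (m B < +oo)%E.
  by move=> moo mB; apply: le_lt_trans moo; apply: le_measure; rewrite ?inE.
have rect s t (C : set T2) : measurable C -> m1' (`]s, t] `*` C) = m2' (`]s, t] `*` C).
  move=> mC.
  have mD : measurable (`]s, t] `*` setT : set (measurableTypeR R * T2)).
    by apply: measurableX.
  have E (m : {measure set (measurableTypeR R * T2)%type -> \bar R}) B :
      m (`]s, t] `*` B) = restr_pushforward m snd_m mD B.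
    rewrite /restr_pushforward; congr (m _); apply/seteqP; split => -[x y] /=; tauto.
  rewrite !E; apply: IH => //.
  - by rewrite /restr_pushforward; apply: fin => //; rewrite preimage_setT setTI.
  - by rewrite /restr_pushforward; apply: fin => //; rewrite preimage_setT setTI.
  - move=> a b; rewrite -[LHS]E -[RHS]E.
    have -> : (`]s, t] `*` box a b : set (measurableTypeR R * T2)) =
      box (fun i => if unlift ord0 i is Some j then a j else s)
          (fun i => if unlift ord0 i is Some j then b j else t).
      apply/seteqP; split => -[x e] /=.
        move=> [/itvP xst eab] i; case: (unliftP ord0 i) => [j|] ->.
          by rewrite cons_cVS.
        by rewrite cons_cV0 !xst.
      move=> H; split; first by have := H ord0; rewrite cons_cV0 unlift_none in_itv.
      by move=> j; have := H (lift ord0 j); rewrite cons_cVS liftK.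
    exact: m12.
have rect2 (B : set (measurableTypeR R)) (C : set T2) : measurable B -> measurable C ->
    m1' (B `*` C) = m2' (B `*` C).
  move=> mB mC.
  have mD : measurable (setT `*` C : set (measurableTypeR R * T2)).
    by apply: measurableX.
  have E (m : {measure set (measurableTypeR R * T2)%type -> \bar R}) D :
      m (D `*` C) = restr_pushforward m fst_m mD D.
    rewrite /restr_pushforward; congr (m _); apply/seteqP; split => -[x y] /=; tauto.
  rewrite !E; apply: finite_measureR_unique => //.
    by rewrite /restr_pushforward; apply: fin => //; rewrite preimage_setT setTI.
  by move=> a b; rewrite -[LHS]E -[RHS]E rect.
pose G : set (set (measurableTypeR R * T2)) :=
  [set B `*` C | B in measurable & C in measurable].
apply: (@measure_unique _ _ _ G (fun _ => setT) _ _ _ _ m1' m2') => //.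
- exact: measurable_prod_measurableType.
- move=> _ _ [B1 mB1 [C1 mC1 <-]] [B2 mB2 [C2 mC2 <-]].
  rewrite -setXI; exists (B1 `&` B2); first exact: measurableI.
  by exists (C1 `&` C2) => //; exact: measurableI.
- by move=> _; exists setT => //; exists setT => //; rewrite setXTT.
- by apply/seteqP; split => // x _; exists 0%N.
- by move=> _ [B mB [C mC <-]]; exact: rect2.
Qed.

End measure_uniqueness.

(** * Affine and triangular substitutions *)

Section change_of_variables.
Local Open Scope classical_set_scope.
Variable R : realType.

(** The image of Lebesgue measure under [t |-> a * t + c], scaled by [a], agrees with Lebesgue
    measure on half-open intervals, hence everywhere. *)
Lemma integral_affine (a c : R) (F : R -> \bar R) : 0 < a ->
  measurable_fun setT F -> (forall t, (0 <= F t)%E) ->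
  (\int[@lebesgue_measure R]_t F t = a%:E * \int[@lebesgue_measure R]_t F (a * t + c)%R)%E.
Proof.
move=> a0 mF F0.
have mphi : measurable_fun setT (fun t : measurableTypeR R => a * t + c : measurableTypeR R).
  by apply: measurable_funD => //; exact: measurable_funM.
pose psi := restr_pushforward (@lebesgue_measure R) mphi measurableT.
have psiE A : psi A = lebesgue_measure ((fun t : measurableTypeR R => a * t + c) @^-1` A).
  by rewrite /psi /restr_pushforward setIT.
pose k : {nonneg R} := NngNum (ltW a0).
transitivity (\int[mscale k psi]_t F t)%E.
  apply: eq_measure_integral => A mA _.
  apply: (@lebesgue_measure_unique R (mscale k psi)) => // _ [[u v] _ <-].
  transitivity (a%:E * psi `]u, v])%E; last by [].
  rewrite psiE.
  rewrite (_ : (fun t => _) @^-1` _ = `](u - c) / a, (v - c) / a]).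
    rewrite !lebesgue_measure_itv/= !lte_fin ltr_pM2r ?invr_gt0// ltrD2r.
    case: ifP => _; last by rewrite mule0.
    by rewrite -!EFinB -EFinM; congr EFin; field; rewrite gt_eqF.
  apply/seteqP; split => t /=; rewrite !in_itv/= ltr_pdivrMr// ler_pdivlMr// ltrBlDr lerBrDr;
    by rewrite [t * a]mulrC.
rewrite ge0_integral_mscale//; congr (_ * _)%E.
rewrite -[RHS](@ge0_integral_pushforward _ _ _ _ _ _ mphi (@lebesgue_measure R) setT)//.
by apply: eq_measure_integral => A mA _; exact: psiE.
Qed.

Definition upd n (v : 'cV[R]_n) (p : 'I_n) (t : R) : 'cV[R]_n :=
  \col_i (if i == p then t else v i 0).

Lemma updE n (v : 'cV[R]_n) p t i : upd v p t i 0 = if i == p then t else v i 0.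
Proof. by rewrite mxE. Qed.

Lemma upd_cons0 n (v : 'cV[R]_n) t t' : upd (cons_cV t v) ord0 t' = cons_cV t' v.
Proof.
apply/colP => i; case: (unliftP ord0 i) => [j|] ->; rewrite updE.
  by rewrite !cons_cVS eq_sym (negbTE (neq_lift _ _)).
by rewrite eqxx cons_cV0.
Qed.

Lemma upd_consS n (v : 'cV[R]_n) t p t' :
  upd (cons_cV t v) (lift ord0 p) t' = cons_cV t (upd v p t').
Proof.
apply/colP => i; case: (unliftP ord0 i) => [j|] ->; rewrite updE.
  by rewrite !cons_cVS updE (inj_eq lift_inj).
by rewrite !cons_cV0 (negbTE (neq_lift _ _)).
Qed.

Lemma mcV_upd d (U : sigmaRingType d) n (F : 'cV[R]_n -> U) (p : 'I_n)
    (h : 'cV[R]_n -> measurableTypeR R) :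
  mcV F -> mcV h -> mcV (fun v => F (upd v p (h v))).
Proof.
move=> mF mh; apply: mcV_comp => // i; rewrite /mcV.
by under eq_fun do rewrite updE; case: (i == p) => //; exact: measurable_coord.
Qed.

Lemma J_ge0 n (F : 'cV[R]_n -> \bar R) : (forall v, (0 <= F v)%E) -> (0 <= J F)%E.
Proof. by move=> F0; apply: integral_ge0. Qed.

Lemma eq_J n (F G : 'cV[R]_n -> \bar R) : F =1 G -> J F = J G.
Proof. by move=> FG; apply: eq_integral => e _; rewrite FG. Qed.

Lemma JZ n (F : 'cV[R]_n -> \bar R) (k : R) : mcV F -> (forall v, (0 <= F v)%E) ->
  0 <= k -> (J (fun v => k%:E * F v) = k%:E * J F)%E.
Proof. by move=> mF F0 k0; rewrite /J ge0_integralZl. Qed.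

(** The shift [g] may be nonlinear in the other coordinates: once these are frozen by Tonelli, the
    substitution in coordinate [p] is affine. This is how a curved boundary gets straightened. *)
Lemma J_upd n (p : 'I_n) (a : R) (g : 'cV[R]_n -> measurableTypeR R) (F : 'cV[R]_n -> \bar R) :
  0 < a -> mcV F -> (forall v, (0 <= F v)%E) -> mcV g ->
  (forall v t, g (upd v p t) = g v) ->
  (J F = a%:E * J (fun v => F (upd v p (a * v p ord0 + g v)%R)))%E.
Proof.
move=> a0; elim: n p g F => [|n IH] p g F mF F0 mg gp; first by case: p gp.
have mh q : mcV (fun v : 'cV[R]_n.+1 => a * v q 0 + g v : measurableTypeR R).
  apply: measurable_funD => //; apply: measurable_funM => //; exact: measurable_coord.
have mFu q : mcV (fun v => F (upd v q (a * v q 0 + g v))) by exact: mcV_upd.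
case: (unliftP ord0 p) => [q|] pE; subst p.
  rewrite J_cons// (J_cons (mFu _))//.
  rewrite -[RHS](@ge0_integralZl _ (measurableTypeR R) R (@lebesgue_measure R) setT
    measurableT _ _ a%:E) ?lee_fin ?(ltW a0)//; [|exact: (mcV_intJ (mFu _))|by move=> t _; exact: J_ge0].
  apply: eq_integral => t _.
  rewrite (IH q (fun v => g (cons_cV t v)))//; [|exact: (mcV_cons t mF)|exact: (mcV_cons t mg)|].
  - congr (_ * _)%E; apply: eq_J => v.
    by rewrite upd_consS cons_cVS.
  - by move=> v s; rewrite -upd_consS gp.
rewrite J_cons2// (J_cons2 (mFu _))//.
rewrite -JZ ?(ltW a0)//; [|exact: (mcV_int (mFu _))|by move=> v; exact: integral_ge0].
apply: eq_J => v.
rewrite (@integral_affine a (g (cons_cV 0 v)))//.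
- congr (_ * _)%E; apply: eq_integral => t _.
  by rewrite upd_cons0 cons_cV0 -(gp (cons_cV t v) 0) upd_cons0.
- apply: (mcV_comp_gen mF) => i.
  case: (unliftP ord0 i) => [j|] ->.
    by under eq_fun do rewrite cons_cVS; exact: measurable_cst.
  by under eq_fun do rewrite cons_cV0; exact: measurable_id.
Qed.

End change_of_variables.

(** * The Gaussian law *)
Section gaussian_integral.
Local Open Scope classical_set_scope.
Variable R : realType.

Lemma J_affine n (d c : 'I_n -> R) (F : 'cV[R]_n -> \bar R) : (forall i, 0 < d i) ->
  mcV F -> (forall v, (0 <= F v)%E) ->
  (J F = (\prod_i d i)%:E * J (fun v => F (\col_i (d i * v i ord0 + c i)%R)))%E.
Proof.
elim: n d c F => [|n IH] d c F d0 mF F0.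
  by rewrite !J0 big_ord0 mul1e; congr F; apply/colP => -[].
have colE t (v : 'cV[R]_n) : cons_cV (d ord0 * t + c ord0)
   (\col_(i < n) (d (lift ord0 i) * v i ord0 + c (lift ord0 i))) =
   \col_i (d i * (cons_cV t v) i ord0 + c i).
  apply/colP => i; case: (unliftP ord0 i) => [j|] ->.
    by rewrite cons_cVS !mxE liftK.
  by rewrite cons_cV0 !mxE unlift_none.
have mcol i : mcV (fun v : 'cV[R]_n.+1 => (\col_j (d j * v j ord0 + c j)) i ord0 : measurableTypeR R).
  rewrite /mcV; under eq_fun do rewrite mxE.
  by apply: measurable_funD => //; apply: measurable_funM => //; exact: measurable_coord.
rewrite J_cons// J_cons//; last exact: mcV_comp mF mcol.
rewrite (@integral_affine R (d ord0) (c ord0))//; last 2 first.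
- exact: mcV_intJ.
- by move=> t; exact: J_ge0.
rewrite big_ord_recl EFinM -muleA; congr (_ * _)%E.
rewrite -ge0_integralZl//; last 3 first.
- exact: (mcV_intJ (mcV_comp mF mcol)).
- by move=> t _; exact: J_ge0.
- by rewrite lee_fin prodr_ge0// => i _; exact: ltW.
apply: eq_integral => t _.
rewrite (IH (fun i => d (lift ord0 i)) (fun i => c (lift ord0 i)))//; last exact: mcV_cons.
by congr (_ * _)%E; apply: eq_J => v; rewrite colE.
Qed.

Lemma J_shift n (c : 'cV[R]_n) (F : 'cV[R]_n -> \bar R) :
  mcV F -> (forall v, (0 <= F v)%E) -> J F = J (fun v => F (v + c)).
Proof.
move=> mF F0; rewrite (@J_affine _ (fun=> 1) (fun i => c i ord0))//.
rewrite big1// mul1e; apply: eq_J => v; congr F.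
by apply/colP => i; rewrite !mxE mul1r.
Qed.

Lemma mcV_prod n (I : Type) (s : seq I) (F : I -> 'cV[R]_n -> R) :
  (forall i, mcV (F i : _ -> measurableTypeR R)) ->
  mcV ((fun v => \prod_(i <- s) F i v) : _ -> measurableTypeR R).
Proof.
move=> mF; elim: s => [|i s IH]; rewrite /mcV.
  by under eq_fun do rewrite big_nil; exact: measurable_cst.
under eq_fun do rewrite big_cons; exact: (measurable_funM (mF i) IH).
Qed.

Lemma mcV_sum n (I : Type) (s : seq I) (P : pred I) (F : I -> 'cV[R]_n -> R) :
  (forall i, mcV (F i : _ -> measurableTypeR R)) ->
  mcV ((fun v => \sum_(i <- s | P i) F i v) : _ -> measurableTypeR R).
Proof.
move=> mF; elim: s => [|i s IH]; rewrite /mcV.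
  by under eq_fun do rewrite big_nil; exact: measurable_cst.
under eq_fun do rewrite big_cons; case: (P i) => //; exact: (measurable_funD (mF i) IH).
Qed.

Lemma J_prod n (f : 'I_n -> R -> R) (c : 'I_n -> R) :
  (forall i, measurable_fun setT (f i)) -> (forall i t, 0 <= f i t) ->
  (forall i, \int[@lebesgue_measure R]_t (f i t)%:E = (c i)%:E)%E ->
  J (fun v => (\prod_i f i (v i 0))%:E) = (\prod_i c i)%:E.
Proof.
elim: n f c => [|n IH] f c mf f0 fc; first by rewrite J0 !big_ord0.
have c0 i : 0 <= c i by rewrite -lee_fin -fc; apply: integral_ge0 => t _; rewrite lee_fin.
have mp k (g : 'I_k -> R -> R) : (forall i, measurable_fun setT (g i)) ->
    mcV (fun v : 'cV[R]_k => (\prod_i g i (v i 0))%:E).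
  move=> mg; apply/measurable_EFinP.
  apply: (@mcV_prod _ _ _ (fun i (v : 'cV[R]_k) => g i (v i 0))) => i.
  exact: (measurableT_comp (mg i) (measurable_coord i)).
rewrite (J_cons (mp _ _ mf)); last by move=> v; rewrite lee_fin prodr_ge0.
have p0 : (0 <= (\prod_(i < n) c (lift ord0 i))%:E)%E by rewrite lee_fin prodr_ge0.
rewrite big_ord_recl EFinM -fc -ge0_integralZr//; [|by apply/measurable_EFinP; exact: mf|
  by move=> t _; rewrite lee_fin].
apply: eq_integral => t _.
rewrite -(IH (fun i => f (lift ord0 i)))// -JZ//; [|exact: (mp _ (fun i => f (lift ord0 i)))|].
2: by move=> v; rewrite lee_fin prodr_ge0.
apply: eq_J => v; rewrite big_ord_recl cons_cV0 EFinM; congr (_ * _%:E)%E.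
by apply: eq_bigr => i _; rewrite cons_cVS.
Qed.

Lemma integral_gauss_scaled (a : R) : 0 < a ->
  (\int[@lebesgue_measure R]_t (expR (- (1/2) * (a * t ^+ 2)))%:E = (Num.sqrt (2 * pi / a))%:E)%E.
Proof.
move=> a0; set s := Num.sqrt (a / 2).
have s0 : 0 < s by rewrite sqrtr_gt0 divr_gt0.
have H := @integral_affine R s 0 (fun t => (gauss_fun t)%:E) s0
  (proj2 (measurable_EFinP _ _) (@measurable_gauss_fun R)) (@gauss_fun_ge0 R).
rewrite integralT_gauss in H.
set X := (\int[_]_t _)%E.
have {}H : (s%:E * X = (Num.sqrt pi)%:E)%E.
  rewrite H; congr (_ * _)%E; apply: eq_integral => t _.
  rewrite /gauss_fun addr0 exprMn sqr_sqrtr ?divr_ge0 ?ltW//.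
  by congr (expR _)%:E; field.
have -> : (X = (s^-1)%:E * (s%:E * X))%E by rewrite muleA -EFinM mulVf ?gt_eqF// mul1e.
rewrite H -EFinM; congr EFin.
by rewrite -sqrtrV ?divr_ge0 ?ltW// -sqrtrM ?invr_ge0 ?divr_ge0 ?ltW//; congr Num.sqrt; field; rewrite gt_eqF.
Qed.

End gaussian_integral.

Section gaussian_determinant.
Local Open Scope classical_set_scope.
Variable R : realType.

Definition posdef n (M : 'M[R]_n) := forall v : 'cV[R]_n, v != 0 -> 0 < bform M v v.

Lemma bformE n (M : 'M[R]_n) (u v : 'cV[R]_n) :
  bform M u v = \sum_i \sum_j u i 0 * M i j * v j 0.
Proof.
rewrite /bform -mulmxA mxE; apply: eq_bigr => i _.
rewrite !mxE big_distrr/=; apply: eq_bigr => j _; by rewrite mulrA.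
Qed.

Lemma bformDl n (M : 'M[R]_n) (u v w : 'cV[R]_n) : bform M (u + v) w = bform M u w + bform M v w.
Proof. by rewrite /bform linearD/= !mulmxDl mxE. Qed.

Lemma bformDr n (M : 'M[R]_n) (u v w : 'cV[R]_n) : bform M w (u + v) = bform M w u + bform M w v.
Proof. by rewrite /bform mulmxDr mxE. Qed.

Lemma bformZl n (M : 'M[R]_n) (u v : 'cV[R]_n) k : bform M (k *: u) v = k * bform M u v.
Proof. by rewrite /bform linearZ/= -!scalemxAl mxE. Qed.

Lemma bformZr n (M : 'M[R]_n) (u v : 'cV[R]_n) k : bform M u (k *: v) = k * bform M u v.
Proof. by rewrite /bform -scalemxAr mxE. Qed.

Lemma bformNl n (M : 'M[R]_n) (u v : 'cV[R]_n) : bform M (- u) v = - bform M u v.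
Proof. by rewrite -scaleN1r bformZl mulN1r. Qed.

Lemma bformNr n (M : 'M[R]_n) (u v : 'cV[R]_n) : bform M u (- v) = - bform M u v.
Proof. by rewrite -scaleN1r bformZr mulN1r. Qed.

Lemma bform_sym n (M : 'M[R]_n) (u v : 'cV[R]_n) : M^T = M -> bform M u v = bform M v u.
Proof.
move=> Ms; rewrite /bform.
have -> : (u^T *m M *m v) 0 0 = (u^T *m M *m v)^T 0 0 by rewrite [RHS]mxE.
by rewrite !trmx_mul trmxK Ms mulmxA.
Qed.

Lemma bform_delta n (M : 'M[R]_n) i j : bform M (delta_mx i 0) (delta_mx j 0) = M i j.
Proof. by rewrite /bform trmx_delta -rowE -colE !mxE. Qed.

Lemma mcV_bform n (M : 'M[R]_n) (c : 'cV[R]_n) :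
  mcV (fun v : 'cV[R]_n => bform M (v - c) (v - c) : measurableTypeR R).
Proof.
rewrite /mcV; under eq_fun do rewrite bformE.
apply: (@mcV_sum _ _ _ _ _ (fun i (v : 'cV[R]_n) => \sum_j ((v - c) i 0 * M i j * (v - c) j 0))) => i.
apply: (@mcV_sum _ _ _ _ _ (fun j (v : 'cV[R]_n) => (v - c) i 0 * M i j * (v - c) j 0)) => j.
have m k : mcV (fun v : 'cV[R]_n => (v - c) k 0 : measurableTypeR R).
  rewrite /mcV; under eq_fun do rewrite !mxE.
  by apply: measurable_funD => //; exact: measurable_coord.
exact: (measurable_funM (measurable_funM (m i) (measurable_cst _)) (m j)).
Qed.

Lemma mcV_gauss n (M : 'M[R]_n) (c : 'cV[R]_n) (k : R) :
  mcV (fun v : 'cV[R]_n => expR (k * bform M (v - c) (v - c)) : measurableTypeR R).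
Proof.
by apply: measurableT_comp => //; apply: measurable_funM => //; exact: mcV_bform.
Qed.

(** Completing the square in the first coordinate splits off a one-dimensional Gaussian and leaves
    the Schur complement [D], again symmetric and positive definite, with [det M = a * det D].
    Positivity of the determinant is proved in the same induction. *)
Lemma gaussian_integral_posdef n (M : 'M[R]_n) : M^T = M -> posdef M ->
  0 < \det M /\
  J (fun v => (expR (- (1/2) * bform M v v))%:E) =
    (Num.sqrt ((2 * pi) ^+ n / \det M))%:E.
Proof.
elim: n M => [|n IH] M Ms Mp.
  rewrite det_mx00 expr0 divr1 sqrtr1 J0; split => //.
  by rewrite /bform mulmx0 mxE mulr0 expR0.
pose a := M ord0 ord0.
pose b (v : 'cV[R]_n) := \sum_(j < n) M ord0 (lift ord0 j) * v j 0.
pose D : 'M[R]_n := \matrix_(i, j) (M (lift ord0 i) (lift ord0 j) -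
   M ord0 (lift ord0 i) * M ord0 (lift ord0 j) / a).
have Mij i j : M i j = M j i by rewrite -[in LHS]Ms mxE.
have a0 : 0 < a.
  have /Mp : (delta_mx ord0 0 : 'cV[R]_n.+1) != 0.
    by apply/eqP => /colP /(_ ord0); rewrite !mxE !eqxx/= => /eqP; rewrite oner_eq0.
  by rewrite bform_delta.
have bE (v : 'cV[R]_n) : \sum_(i < n) v i 0 * M (lift ord0 i) ord0 = b v.
  by apply: eq_bigr => i _; rewrite mulrC Mij.
have sq t (v : 'cV[R]_n) : bform M (cons_cV t v) (cons_cV t v) =
    a * (t + b v / a) ^+ 2 + bform D v v.
  rewrite !bformE big_ord_recl big_ord_recl cons_cV0.
  have -> : \sum_(i < n) t * M ord0 (lift ord0 i) * cons_cV t v (lift ord0 i) 0 = t * b v.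
    by rewrite big_distrr/=; apply: eq_bigr => i _; rewrite cons_cVS mulrA.
  under [X in _ + X]eq_bigr => i _.
    rewrite big_ord_recl cons_cV0 cons_cVS.
    under eq_bigr do rewrite cons_cVS.
    over.
  rewrite big_split/= -big_distrl/= bE.
  have -> : \sum_(i < n) \sum_(j < n) v i 0 * D i j * v j 0 =
     \sum_(i < n) \sum_(j < n) v i 0 * M (lift ord0 i) (lift ord0 j) * v j 0 - b v * b v / a.
    rewrite /b mulr_suml mulr_suml -sumrB; apply: eq_bigr => i _.
    rewrite mulr_sumr mulr_suml -sumrB; apply: eq_bigr => j _.
    by rewrite mxE; ring.
  by rewrite -/a; field; rewrite gt_eqF//.
have Ds : D^T = D.
  by apply/matrixP => i j; rewrite !mxE (Mij (lift ord0 j)) [X in _ - X / _]mulrC.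
have Dp : posdef D.
  move=> v v0; have := Mp (cons_cV (- (b v / a)) v); rewrite sq addNr expr0n/= mulr0 add0r.
  apply; apply: contra v0 => /eqP/colP H; apply/eqP/colP => i.
  by have := H (lift ord0 i); rewrite cons_cVS !mxE.
have [dD JD] := IH D Ds Dp.
have detM : \det M = a * \det D.
  pose N : 'M[R]_(1 + n) := M.
  have -> : \det M = \det N by [].
  have ulE : ulsubmx N = a%:M.
    apply/matrixP => i j; rewrite !ord1 !mxE eqxx mulr1n.
    by congr (M _ _); apply/val_inj.
  have -> : N = block_mx 1%:M 0 (a^-1 *: dlsubmx N) 1%:M *m block_mx (ulsubmx N) (ursubmx N) 0 D.
    rewrite -[LHS]submxK mulmx_block !mul1mx !mul0mx !addr0; congr block_mx.
      by rewrite ulE -scalemxAl mul_mx_scalar scalerA mulVf ?gt_eqF// scale1r.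
    apply/matrixP => i j; rewrite !mxE big_ord1 !mxE.
    have rE k : rshift 1 k = lift ord0 k by apply/val_inj.
    have lE : lshift n (0 : 'I_1) = ord0 by apply/val_inj.
    rewrite !rE !lE /N (Mij (lift ord0 i) ord0); field; rewrite gt_eqF//.
  rewrite det_mulmx det_lblock !det1 mul1r mul1r det_ublock ulE det_scalar1//.
split; first by rewrite detM mulr_gt0.
rewrite J_cons2; first last.
- by move=> v; rewrite lee_fin expR_ge0.
- apply/measurable_EFinP; have := @mcV_gauss _ M 0 (- (1/2)).
  by rewrite /mcV; under eq_fun do rewrite subr0.
rewrite (eq_J (G := fun v => (Num.sqrt (2 * pi / a))%:E * (expR (- (1/2) * bform D v v))%:E)%E).
  rewrite JZ//; last first.
  - apply/measurable_EFinP; have := @mcV_gauss _ D 0 (- (1/2)).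
    by rewrite /mcV; under eq_fun do rewrite subr0.
  rewrite JD -EFinM -sqrtrM ?divr_ge0 ?mulr_ge0 ?pi_ge0 ?ltW//.
  congr (Num.sqrt _)%:E; rewrite detM exprS; field.
  by rewrite !gt_eqF.
move=> v; rewrite -integral_gauss_scaled//.
rewrite -ge0_integralZr//; last first.
  by apply/measurable_EFinP; apply: measurableT_comp => //; do 2 apply: measurable_funM => //.
rewrite (@integral_affine R 1 (- (b v / a)))//; last first.
- apply/measurable_EFinP; apply: measurableT_comp => //; apply: measurable_funM => //.
  under eq_fun do rewrite sq; apply: measurable_funD => //; apply: measurable_funM => //.
  by apply: measurable_funX; apply: measurable_funD.
rewrite mul1e; apply: eq_integral => t _.
by rewrite sq addrNK !mul1r mulrDr expRD EFinM.
Qed.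

End gaussian_determinant.

Section density_measure.
Local Open Scope classical_set_scope.
Context d (T : measurableType d) (R : realType).
Variables (m : {measure set T -> \bar R}) (f : T -> \bar R).

Definition density_measure of measurable_fun setT f & (forall x, (0 <= f x)%E) :=
  fun A : set T => (\int[m]_(x in A) f x)%E.

Variables (mf : measurable_fun setT f) (f0 : forall x, (0 <= f x)%E).
Let nu := density_measure mf f0.

Let nu0 : nu set0 = 0%E. Proof. exact: integral_set0. Qed.
Let nu_ge0 A : (0 <= nu A)%E. Proof. exact: integral_ge0. Qed.

Let nu_additive : semi_sigma_additive nu.
Proof.
move=> F mF tF mUF; rewrite /nu /density_measure ge0_integral_bigcup//.
  by apply: is_cvg_ereal_nneg_natsum_cond => n _ _; exact: integral_ge0.
exact: measurable_funTS.
Qed.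

HB.instance Definition _ := isMeasure.Build _ _ _ (density_measure mf f0)
  nu0 nu_ge0 nu_additive.

End density_measure.

Section gaussian_law.
Local Open Scope classical_set_scope.
Context d (T : measurableType d) (R : realType).

Lemma mcV_forall n (I : finType) (q : I -> 'cV[R]_n -> bool) :
  (forall i, mcV (q i)) -> mcV (fun v => [forall i, q i v]).
Proof.
move=> mq; rewrite /mcV.
have E v : [forall i, q i v] = all (q^~ v) (index_enum I).
  by apply/forallP/allP => [H i _|H i]; [|apply: H; rewrite mem_index_enum].
under eq_fun do rewrite E; elim: (index_enum I) => [|i s IH]; first exact: measurable_cst.
exact: (measurable_and (mq i) IH).
Qed.

(** If the form vanishes at [v], moving from [v] along [u = B v] changes it by [2 t |u|^2 + O(t^2)],
    which is negative for small negative [t] unless [u = 0]; invertibility then gives [v = 0]. *)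
Lemma psd_posdef n (B : 'M[R]_n) : B^T = B -> (forall v, 0 <= bform B v v) ->
  0 < \det B -> posdef B.
Proof.
move=> Bs B0 Bd v v0; rewrite lt_neqAle B0 andbT; apply/negP => /eqP/esym vB.
have uB : B \in unitmx by rewrite unitmxE unitfE gt_eqF.
suff Bv0 : B *m v = 0 by move/negP: v0; apply; apply/eqP; rewrite -(mulKmx uB v) Bv0 mulmx0.
set u := B *m v.
have uv : bform B u v = \sum_i u i 0 ^+ 2.
  rewrite /bform -mulmxA -/u mxE; apply: eq_bigr => i _; by rewrite mxE expr2.
have H t : 0 <= 2 * t * bform B u v + t ^+ 2 * bform B u u.
  have := B0 (v + t *: u).
  rewrite !bformDl !bformDr !bformZl !bformZr vB (bform_sym v u Bs) add0r.
  by move/le_trans; apply; rewrite le_eqVlt; apply/orP; left; apply/eqP; ring.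
have uv0 : 0 <= bform B u v by rewrite uv sumr_ge0// => i _; exact: sqr_ge0.
have {H} uvE : bform B u v = 0.
  apply/eqP; rewrite eq_le uv0 andbT leNgt; apply/negP => uvp.
  have c0 : 0 < bform B u u + 1 by rewrite ltr_wpDl.
  (* The [+ 1] keeps the denominator positive even when [bform B u u] is 0. *)
  have := H (- (bform B u v / (bform B u u + 1))); rewrite leNgt => /negP; apply.
  rewrite [ltLHS](_ : _ = - (bform B u v ^+ 2 / (bform B u u + 1) ^+ 2 * (bform B u u + 2))); last first.
    by field; rewrite gt_eqF.
  by rewrite oppr_lt0 mulr_gt0// ?divr_gt0 ?exprn_gt0// ltr_wpDl.
apply/colP => i; rewrite [RHS]mxE; apply/eqP; rewrite -sqrf_eq0.
move: uvE; rewrite uv => /eqP; rewrite psumr_eq0; last by move=> j _; exact: sqr_ge0.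
by move/allP => /(_ i (mem_index_enum _)).
Qed.

Lemma posdef_inv n (B : 'M[R]_n) : B^T = B -> posdef B -> B \in unitmx ->
  (invmx B)^T = invmx B /\ posdef (invmx B).
Proof.
move=> Bs Bp uB; have Is : (invmx B)^T = invmx B by rewrite trmx_inv Bs.
split => // v v0.
have -> : bform (invmx B) v v = bform B (invmx B *m v) (invmx B *m v).
  by rewrite /bform trmx_mul Is -!mulmxA mulKVmx.
apply: Bp; apply: contra v0 => /eqP H; by rewrite -(mulKVmx uB v) H mulmx0.
Qed.

Lemma mcV_gauss_density n (mu : 'cV[R]_n) B :
  mcV (gauss_density mu B : _ -> measurableTypeR R).
Proof. by apply: measurable_funM => //; exact: mcV_gauss. Qed.

Lemma gauss_density_ge0 n (mu : 'cV[R]_n) B y : 0 <= gauss_density mu B y.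
Proof. by rewrite mulr_ge0 ?invr_ge0 ?sqrtr_ge0 ?expR_ge0. Qed.

Lemma J_gauss_density n (mu : 'cV[R]_n) B : B^T = B -> posdef B -> 0 < \det B ->
  J (fun y => (gauss_density mu B y)%:E) = 1%E.
Proof.
move=> Bs Bp Bd.
have uB : B \in unitmx by rewrite unitmxE unitfE gt_eqF.
have [Is Ip] := posdef_inv Bs Bp uB.
have [_ GI] := gaussian_integral_posdef Is Ip.
have s0 : 0 < Num.sqrt ((2 * pi) ^+ n * \det B).
  by rewrite sqrtr_gt0 mulr_gt0// exprn_gt0// mulr_gt0// pi_gt0.
rewrite (J_shift mu); [|exact/measurable_EFinP/mcV_gauss_density|
  by move=> v; rewrite lee_fin gauss_density_ge0].
rewrite (eq_J (G := fun v => ((Num.sqrt ((2 * pi) ^+ n * \det B))^-1)%:E *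
   (expR (- (1/2) * bform (invmx B) v v))%:E)%E); last first.
  by move=> v; rewrite /gauss_density EFinM addrK.
rewrite JZ ?invr_ge0 ?sqrtr_ge0//; first last.
  apply/measurable_EFinP; have := @mcV_gauss _ _ (invmx B) 0 (- (1/2)).
  by rewrite /mcV; under eq_fun do rewrite subr0.
by rewrite GI -EFinM det_inv invrK mulVf// gt_eqF.
Qed.

(** The law of [Y] and the measure with density [gauss_density] are finite and agree on boxes by
    hypothesis, so they agree on every measurable event. *)
Lemma gaussian_vector_law (P : probability T R) n (Y : 'I_n -> T -> R)
    (mu : 'cV[R]_n) (B : 'M[R]_n) :
  B^T = B -> posdef B -> 0 < \det B ->
  (forall i, measurable_fun setT (Y i)) -> gaussian_vector P Y mu B ->
  forall Q : 'cV[R]_n -> bool, mcV Q ->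
  P [set t | Q (\col_i Y i t)] = J (fun y => (if Q y then gauss_density mu B y else 0)%:E).
Proof.
move=> Bs Bp Bd mY GY Q mQ.
have mYv : measurable_fun setT (fun t => unvec (\col_i Y i t)).
  by apply: measurable_unvec => i; under eq_fun do rewrite mxE; exact: mY.
pose f e := (gauss_density mu B (vec e : 'cV[R]_n))%:E.
have mf : measurable_fun setT f by exact/measurable_EFinP/mcV_gauss_density.
have f0 e : (0 <= f e)%E by rewrite lee_fin gauss_density_ge0.
have dT : density_measure (sf_mu (itspace R n)) mf f0 setT = 1%E by exact: J_gauss_density.
have ifE (D : set (sf_type (itspace R n))) (q : 'cV[R]_n -> bool) :
    (forall e, D e <-> q (vec e)) ->
    (density_measure (sf_mu (itspace R n)) mf f0 D =
      J (fun y => (if q y then gauss_density mu B y else 0)%:E)).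
  move=> Dq; rewrite /density_measure integral_mkcond; apply: eq_integral => e _.
  rewrite patchE; case: ifPn => [/set_mem/Dq ->//|/negP nD]; rewrite ifN//.
  by apply/negP => /Dq He; apply: nD; rewrite inE.
pose D : set (sf_type (itspace R n)) := [set e | Q (vec e)].
have mD : measurable D.
  by rewrite -[D]setTI; exact: (mQ measurableT [set true]).
transitivity (restr_pushforward P mYv measurableT D).
  rewrite /restr_pushforward setIT; congr (P _).
  by apply/seteqP; split => t /=; rewrite /D /= unvecK.
rewrite (@itspace_measure_unique _ _ _ (density_measure (sf_mu (itspace R n)) mf f0))//.
- exact: ifE.
- have F : (restr_pushforward P mYv measurableT setT < +oo)%E.
    apply: (@le_lt_trans _ _ 1%E); last exact: ltry.
    by rewrite /restr_pushforward preimage_setT setIT; exact: probability_le1.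
  exact: F.
- have F : (density_measure (sf_mu (itspace R n)) mf f0 setT < +oo)%E by rewrite dT ltry.
  exact: F.
- move=> a b.
  transitivity (restr_pushforward P mYv measurableT (box a b)) => //.
  transitivity (density_measure (sf_mu (itspace R n)) mf f0 (box a b)) => //.
  rewrite (ifE _ (fun y => [forall i, (a i < y i 0) && (y i 0 <= b i)])); last first.
    by move=> e; split => [H|/forallP H]; [apply/forallP|].
  rewrite -iintE -?GY//.
  + rewrite /restr_pushforward setIT; congr (P _).
    by apply/seteqP; split => t /= H i; have := H i; rewrite unvecK mxE.
  + apply/measurable_EFinP; apply: measurable_fun_ifT => //; last exact: mcV_gauss_density.
    apply: (@mcV_forall _ _ (fun i (y : 'cV[R]_n) => (a i < y i 0) && (y i 0 <= b i))) => i.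
    apply: measurable_and.
      exact: (measurable_fun_ltr (measurable_cst _) (measurable_coord i)).
    exact: (measurable_fun_ler (measurable_coord i) (measurable_cst _)).
  + by move=> v; case: ifP => _; rewrite lee_fin// gauss_density_ge0.
Qed.

End gaussian_law.

(** * Real-valued integrals and majorants *)
Section real_integral.
Local Open Scope classical_set_scope.
Variable R : realType.

Definition Jint n (F : 'cV[R]_n -> R) :=
  (sf_mu (itspace R n)).-integrable setT (fun e => (F (vec e))%:E).

(** For [Jint] functions [fine] loses nothing ([JRE]), and real values allow subtraction and bounds
    in absolute value. *)
Definition JR n (F : 'cV[R]_n -> R) : R := fine (J (fun v => (F v)%:E)).

Lemma Jint_le n (F G : 'cV[R]_n -> R) : mcV (F : _ -> measurableTypeR R) ->
  (forall v, `|F v| <= G v) -> Jint G -> Jint F.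
Proof.
move=> mF FG; apply: le_integrable => //; first exact/measurable_EFinP.
by move=> e _; rewrite lee_fin (le_trans (FG _))// ler_norm.
Qed.

Lemma Jint_lty n (F : 'cV[R]_n -> R) : mcV (F : _ -> measurableTypeR R) ->
  (forall v, 0 <= F v) -> (J (fun v => (F v)%:E) < +oo)%E -> Jint F.
Proof.
move=> mF F0 Foo; apply/integrableP; split; first exact/measurable_EFinP.
by under eq_integral do rewrite /= ger0_norm//.
Qed.

Lemma JRE n (F : 'cV[R]_n -> R) : Jint F -> J (fun v => (F v)%:E) = (JR F)%:E.
Proof. by move=> iF; rewrite /JR fineK//; exact: integrable_fin_num. Qed.

Lemma JintZ n (F : 'cV[R]_n -> R) k : Jint F -> Jint (fun v => k * F v).
Proof.
by move=> iF; rewrite /Jint; under eq_fun do rewrite EFinM; exact: integrableZl.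
Qed.

Lemma JintD n (F G : 'cV[R]_n -> R) : Jint F -> Jint G -> Jint (fun v => F v + G v).
Proof.
by move=> iF iG; rewrite /Jint; under eq_fun do rewrite EFinD; exact: integrableD.
Qed.

Lemma JRZ n (F : 'cV[R]_n -> R) k : Jint F -> JR (fun v => k * F v) = k * JR F.
Proof.
move=> iF; rewrite /JR /J; under eq_integral do rewrite EFinM.
by rewrite integralZl//= fineM//; exact: integrable_fin_num.
Qed.

Lemma JRD n (F G : 'cV[R]_n -> R) : Jint F -> Jint G ->
  JR (fun v => F v + G v) = JR F + JR G.
Proof.
move=> iF iG; rewrite /JR /J; under eq_integral do rewrite EFinD.
by rewrite integralD//= fineD//; exact: integrable_fin_num.
Qed.

Lemma JRB n (F G : 'cV[R]_n -> R) : Jint F -> Jint G ->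
  JR (fun v => F v - G v) = JR F - JR G.
Proof.
move=> iF iG; rewrite /JR /J; under eq_integral do rewrite EFinB.
by rewrite integralB//= fineB//; exact: integrable_fin_num.
Qed.

Lemma JR_le n (F G : 'cV[R]_n -> R) : Jint F -> Jint G -> (forall v, F v <= G v) -> JR F <= JR G.
Proof.
move=> iF iG FG; rewrite -lee_fin -!JRE//.
by apply: le_integral => // e _; rewrite lee_fin.
Qed.

Lemma JR_norm_le n (F G : 'cV[R]_n -> R) : Jint F -> Jint G -> (forall v, `|F v| <= G v) ->
  `|JR F| <= JR G.
Proof.
move=> iF iG FG; rewrite ler_norml; apply/andP; split.
  rewrite -mulN1r -JRZ//; apply: JR_le => //; first exact: JintZ.
  by move=> v; rewrite mulN1r lerNl; apply: le_trans (FG v); rewrite -normrN ler_norm.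
by apply: JR_le => // v; apply: le_trans (FG v); exact: ler_norm.
Qed.

Lemma JR_ge0 n (F : 'cV[R]_n -> R) : (forall v, 0 <= F v) -> 0 <= JR F.
Proof. by move=> F0; rewrite /JR fine_ge0//; apply: J_ge0 => v; rewrite lee_fin. Qed.

Lemma eq_JR n (F G : 'cV[R]_n -> R) : F =1 G -> JR F = JR G.
Proof. by move=> FG; congr fine; apply: eq_J => v; rewrite FG. Qed.

Lemma eq_Jint n (F G : 'cV[R]_n -> R) : F =1 G -> Jint F -> Jint G.
Proof. by move=> /funext ->. Qed.

Lemma Jint_sum n (I : Type) (s : seq I) (P : pred I) (F : I -> 'cV[R]_n -> R) :
  (forall i, P i -> Jint (F i)) -> Jint (fun v => \sum_(i <- s | P i) F i v).
Proof.
move=> iF; rewrite /Jint; under eq_fun do rewrite -sumEFin.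
by apply: integrable_sum => // i Pi; exact: iF.
Qed.

Lemma JR_sum n (I : Type) (s : seq I) (P : pred I) (F : I -> 'cV[R]_n -> R) :
  (forall i, P i -> Jint (F i)) ->
  JR (fun v => \sum_(i <- s | P i) F i v) = \sum_(i <- s | P i) JR (F i).
Proof.
move=> iF; elim: s => [|i s IH].
  by rewrite big_nil /JR /J; under eq_integral do rewrite big_nil; rewrite integral0.
rewrite big_cons; case: ifPn => Pi.
  rewrite -IH -(JRD (iF i Pi) (Jint_sum s iF)).
  by apply: eq_JR => v; rewrite big_cons Pi.
by rewrite -IH; apply: eq_JR => v; rewrite big_cons (negbTE Pi).
Qed.

Lemma integral_reflect (f : R -> \bar R) : measurable_fun setT f -> (forall t, (0 <= f t)%E) ->
  (\int[@lebesgue_measure R]_t f (- t)%R = \int[@lebesgue_measure R]_t f t)%E.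
Proof.
move=> mf f0.
have mN : measurable_fun setT (fun t : measurableTypeR R => - t : measurableTypeR R).
  exact: measurable_funN.
rewrite -[LHS](@ge0_integral_pushforward _ _ _ _ _ _ mN (@lebesgue_measure R) setT)//.
by apply: eq_measure_integral => A mA _; exact: lebesgue_measureN.
Qed.

Lemma integral_exp_ray (a : R) : 0 < a ->
  (\int[@lebesgue_measure R]_t (if 0 <= t then expR (- a * t) else 0)%:E = (a^-1)%:E)%E.
Proof.
move=> a0; have ai : (0 <= (a^-1)%:E)%E by rewrite lee_fin invr_ge0 ltW.
rewrite -[RHS]mule1 -(integral_exponential_pdf a0) -ge0_integralZl//.
  2: by apply/measurable_EFinP; exact: measurable_exponential_pdf.
  2: by move=> t _; rewrite lee_fin exponential_pdf_ge0// ltW.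
apply: eq_integral => t _; rewrite -EFinM; case: leP => t0.
  by rewrite exponential_pdfE// mulrA mulVf ?gt_eqF// mul1r.
by rewrite lt0_exponential_pdf// mulr0.
Qed.

Lemma measurable_exp_ray (a : R) : measurable_fun setT (fun t : R => if 0 <= t then expR (- a * t) else 0).
Proof.
apply: measurable_fun_ifT => //.
  by apply: measurable_fun_ler.
by apply: measurableT_comp => //; exact: measurable_funM.
Qed.

Lemma measurable_exp_abs (a : R) : measurable_fun setT (fun t : R => expR (- a * `|t|)).
Proof.
by apply: measurableT_comp => //; apply: measurable_funM => //; exact: measurableT_comp.
Qed.

(** Two half-lines bound the integral above, the right one alone bounds it below; the value itself
    stays anonymous. *)
Lemma integral_exp_abs (a : R) : 0 < a -> exists2 k, 0 < k &
  (\int[@lebesgue_measure R]_t (expR (- a * `|t|))%:E = k%:E)%E.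
Proof.
move=> a0; set f := fun t : R => if 0 <= t then expR (- a * t) else 0.
have f0 t : 0 <= f t by rewrite /f; case: ifP => // _; exact: expR_ge0.
have mf : measurable_fun setT (EFin \o f) by apply/measurable_EFinP; exact: measurable_exp_ray.
have mg : measurable_fun setT (fun t : R => (expR (- a * `|t|))%:E).
  by apply/measurable_EFinP; exact: measurable_exp_abs.
have mN : measurable_fun setT (fun t : R => (f (- t))%:E).
  exact: (measurableT_comp mf (@oppr_measurable R setT)).
have ub : (\int[@lebesgue_measure R]_t (expR (- a * `|t|))%:E <= (a^-1 + a^-1)%:E)%E.
  rewrite EFinD -{1}(integral_exp_ray a0) -(integral_exp_ray a0).
  rewrite -[X in (_ <= _ + X)%E](@integral_reflect (EFin \o f))//.
  rewrite -ge0_integralD//.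
    2,3: by move=> t _; rewrite lee_fin; exact: f0.
  apply: ge0_le_integral => //; first by apply: emeasurable_funD.
  move=> t _; rewrite /= -EFinD lee_fin.
  have [t0|t0] := leP 0 t; first by rewrite ger0_norm// lerDl.
  by rewrite ltr0_norm// add0r /f oppr_ge0 (ltW t0).
have lb : ((a^-1)%:E <= \int[@lebesgue_measure R]_t (expR (- a * `|t|))%:E)%E.
  rewrite -(integral_exp_ray a0); apply: ge0_le_integral => //.
  - by move=> t _; rewrite lee_fin; exact: f0.
  - by move=> t _; rewrite lee_fin /f; have [t0|t0] := leP 0 t; rewrite ?expR_ge0// ger0_norm.
move: lb ub; case: (\int[_]_t _)%E => [k| |] //; rewrite !lee_fin => kl _.
by exists k => //; apply: lt_le_trans kl; rewrite invr_gt0.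
Qed.

End real_integral.

Section majorant.
Local Open Scope classical_set_scope.
Variable R : realType.

(** A factor depending on [v p] alone may be exchanged for any other with the same integral. This
    trades the indicator of a thin slab for a multiple of an exponential, and later a one-sided
    exponential for a Gaussian. *)
Lemma J_swap_coord n (p : 'I_n) (f f' : R -> R) (G : 'cV[R]_n -> R) :
  measurable_fun setT f -> measurable_fun setT f' ->
  (forall t, 0 <= f t) -> (forall t, 0 <= f' t) ->
  (\int[@lebesgue_measure R]_t (f t)%:E = \int[@lebesgue_measure R]_t (f' t)%:E)%E ->
  mcV (G : _ -> measurableTypeR R) -> (forall v, 0 <= G v) ->
  (forall v t, G (upd v p t) = G v) ->
  J (fun v => (f (v p 0) * G v)%:E) = J (fun v => (f' (v p 0) * G v)%:E).
Proof.
move=> mf mf' f0 f'0 ff'; elim: n p G => [|n IH] p G mG G0 Gp; first by case: p Gp.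
have mh (g : R -> R) : measurable_fun setT g -> mcV (fun v => (g (v p 0) * G v)%:E).
  move=> mg; apply/measurable_EFinP; apply: measurable_funM => //.
  exact: (measurableT_comp mg (measurable_coord p)).
case: (unliftP ord0 p) => [q|] pE; subst p.
  rewrite (J_cons (mh _ mf)); last by move=> v; rewrite lee_fin mulr_ge0.
  rewrite (J_cons (mh _ mf')); last by move=> v; rewrite lee_fin mulr_ge0.
  apply: eq_integral => t _.
  under eq_J do rewrite cons_cVS.
  under [RHS]eq_J do rewrite cons_cVS.
  apply: (IH q (fun v => G (cons_cV t v))) => //.
    exact: (mcV_cons t mG).
  by move=> v s; rewrite -upd_consS Gp.
rewrite (J_cons2 (mh _ mf)); last by move=> v; rewrite lee_fin mulr_ge0.
rewrite (J_cons2 (mh _ mf')); last by move=> v; rewrite lee_fin mulr_ge0.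
apply: eq_J => v.
have GE t : G (cons_cV t v) = G (cons_cV 0 v) by rewrite -[in LHS](upd_cons0 v 0) Gp.
have E (g : R -> R) : measurable_fun setT g -> (forall t, 0 <= g t) ->
   (\int[@lebesgue_measure R]_t (g (cons_cV t v ord0 ord0) * G (cons_cV t v))%:E =
   \int[@lebesgue_measure R]_t (g t)%:E * (G (cons_cV 0 v))%:E)%E.
  move=> mg g0; rewrite -ge0_integralZr//.
  - by apply: eq_integral => t _; rewrite cons_cV0 GE EFinM.
  - by apply/measurable_EFinP.
  - by move=> t _; rewrite lee_fin.
  - by rewrite lee_fin.
by rewrite !E// ff'.
Qed.

Definition l1 n (v : 'cV[R]_n) : R := \sum_i `|v i 0|.

(** The common integrable majorant: the pointwise bounds of the Laplace argument are brought to this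
    form. *)
Definition Phi n (c : R) (v : 'cV[R]_n) : R := expR (- c * l1 v).

Lemma l1_ge0 n (v : 'cV[R]_n) : 0 <= l1 v. Proof. exact: sumr_ge0. Qed.

Lemma Phi_ge0 n c (v : 'cV[R]_n) : 0 <= Phi c v. Proof. exact: expR_ge0. Qed.

Lemma mcV_l1 n : mcV (@l1 n : _ -> measurableTypeR R).
Proof.
apply: (@mcV_sum _ _ _ _ _ (fun i (v : 'cV[R]_n) => `|v i 0|)) => i.
by apply: measurableT_comp => //; exact: measurable_coord.
Qed.

Lemma mcV_Phi n c : mcV (@Phi n c : _ -> measurableTypeR R).
Proof.
by apply: measurableT_comp => //; apply: measurable_funM => //; exact: mcV_l1.
Qed.

Lemma PhiE n c (v : 'cV[R]_n) : Phi c v = \prod_i expR (- c * `|v i 0|).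
Proof. by rewrite -expR_sum -mulr_sumr. Qed.

Lemma Jint_Phi n c : 0 < c -> Jint (@Phi n c).
Proof.
move=> c0; have [k k0 kE] := integral_exp_abs c0.
apply: Jint_lty; [exact: mcV_Phi|exact: Phi_ge0|].
under eq_J do rewrite PhiE.
rewrite (@J_prod _ _ (fun _ t => expR (- c * `|t|)) (fun=> k)) ?ltry//.
  by move=> _; exact: measurable_exp_abs.
Qed.

Lemma poly_exp_le (k : nat) (c : R) : 0 < c -> exists2 C, 0 < C &
  forall x, 0 <= x -> (1 + x) ^+ k * expR (- c * x) <= C * expR (- (c / 2) * x).
Proof.
(* Chosen so that [1 + x <= D * (1 + e * x)] and [(1 + e * x) ^+ k.+1 <= expR (c / 2 * x)]. The
   exponent [k.+1] avoids a division by zero when [k = 0]. *)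
move=> c0; pose D := 1 + 2 * k.+1%:R / c; pose e := c / (2 * k.+1%:R).
have k0 : (0 : R) < k.+1%:R by [].
have D0 : 0 < D by rewrite ltr_wpDr// ltW// divr_gt0// mulr_gt0.
have e0 : 0 < e by rewrite divr_gt0// mulr_gt0.
exists (D ^+ k.+1); first exact: exprn_gt0.
move=> x x0.
have x1 : 1 <= 1 + x by rewrite lerDl.
have le1 : 1 + x <= D * (1 + e * x).
  have -> : D * (1 + e * x) = 1 + x + (2 * k.+1%:R / c + e * x).
    by rewrite /D /e; field; rewrite !gt_eqF.
  rewrite lerDl addr_ge0//; last by rewrite mulr_ge0// ltW.
  by rewrite ltW// divr_gt0// mulr_gt0.
have le2 : (1 + x) ^+ k <= D ^+ k.+1 * expR (c / 2 * x).
  apply: le_trans (_ : (1 + x) ^+ k.+1 <= _); first by rewrite exprS ler_peMl// exprn_ge0// (le_trans ler01).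
  apply: le_trans (_ : (D * (1 + e * x)) ^+ k.+1 <= _).
    by rewrite lerXn2r ?nnegrE ?(le_trans ler01 x1)// mulr_ge0 ?(ltW D0)// addr_ge0// mulr_ge0// ltW.
  rewrite exprMn ler_wpM2l ?exprn_ge0 ?(ltW D0)//.
  have -> : c / 2 * x = (e * x) *+ k.+1 by rewrite -mulr_natr /e; field; rewrite gt_eqF.
  by rewrite -mulr_natl expRM_natl lerXn2r ?nnegrE ?expR_ge0 ?expR_ge1Dx// addr_ge0// mulr_ge0// ltW.
have -> : expR (- (c / 2) * x) = expR (c / 2 * x) * expR (- c * x) by rewrite -expRD; congr expR; field.
rewrite mulrA ler_wpM2r ?expR_ge0//.
Qed.

End majorant.

(** * Log-sum-exp inequalities *)
Section log_sum_exp.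
Variable R : realType.

Definition expR2 (t : R) := expR t - 1 - t.

Lemma expR2_ge0 t : 0 <= expR2 t.
Proof. by rewrite /expR2 -addrA -opprD subr_ge0 expR_ge1Dx. Qed.

Lemma expR2_le t : t <= 1/2 -> expR2 t <= 2 * t ^+ 2.
Proof.
move=> t12; have t1 : 0 < 1 - t by lra.
have : expR t <= (1 - t)^-1.
  rewrite -[leLHS]invrK -expRN lef_pV2 ?posrE ?expR_gt0//.
  by apply: le_trans (expR_ge1Dx _).
have -> : (1 - t)^-1 = 1 + t + t ^+ 2 / (1 - t) by field; rewrite gt_eqF.
have : t ^+ 2 / (1 - t) <= 2 * t ^+ 2.
  by rewrite ler_pdivrMr// mulrAC ler_peMl ?sqr_ge0//; lra.
rewrite /expR2; lra.
Qed.

(** The remainder has derivative [expR2], already quadratic near 0 by [expR2_le]; the mean value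
    theorem adds one power. *)
Lemma expR_taylor2 t : `|t| <= 1/2 -> `|expR2 t - t ^+ 2 / 2| <= 2 * `|t| ^+ 3.
Proof.
pose g (x : R) := expR x - 1 - x - x ^+ 2 / 2.
have dg (x : R) : is_derive x 1 g (expR2 x).
  rewrite /g /expR2; apply: is_derive_eq.
  by rewrite !scaler0 /GRing.scale/= ; lra.
have cg (a b : R) : {within `[a, b], continuous g}%classic.
  by apply: derivable_within_continuous => x _; exact: (@ex_derive _ _ _ _ _ _ _ (dg x)).
have g0 : g 0 = 0 by rewrite /g expR0; lra.
move=> /[dup] th; rewrite ler_norml => /andP[t1 t2].
rewrite -[X in `|X|]/(g t).
have key (x : R) : `|x| <= `|t| -> `|expR2 x| <= 2 * `|t| ^+ 2.
  move=> xt; rewrite ger0_norm ?expR2_ge0//; apply: le_trans (expR2_le _) _.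
    by apply: le_trans (ler_norm x) _; apply: le_trans xt th.
  by rewrite ler_pM2l// -(real_normK (num_real x)) lerXn2r ?nnegrE.
have -> : 2 * `|t| ^+ 3 = 2 * `|t| ^+ 2 * `|t| by rewrite exprSr mulrA.
have [tn0|tp|->] := ltgtP t 0; last by rewrite g0 !normr0 mulr0.
  have [x] := MVT tn0 (fun x _ => dg x) (cg t 0).
  rewrite in_itv/= => /andP[tx x0]; rewrite g0 !sub0r => gE.
  rewrite -[leLHS]normrN gE normrM normrN ler_pM//; apply: key.
  by rewrite !ltr0_norm// lerN2 ltW.
have [x] := MVT tp (fun x _ => dg x) (cg 0 t).
rewrite in_itv/= => /andP[x0 tx]; rewrite g0 !subr0 => gE.
rewrite gE normrM ler_pM//; apply: key.
by rewrite !gtr0_norm// ltW.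
Qed.

(** Both bounds are [1 + z <= expR z], at [z = ln (1 + y)] and at [z = - ln (1 + y)]. *)
Lemma ln1D_bounds (y : R) : 0 <= y -> 0 <= y - ln (1 + y) <= y ^+ 2.
Proof.
move=> y0; have y1 : 0 < 1 + y by lra.
have := expR_ge1Dx (ln (1 + y)); rewrite lnK ?posrE// => h1.
have := expR_ge1Dx (- ln (1 + y)); rewrite expRN lnK ?posrE// => h2.
have : (1 + y)^-1 <= 1 - y + y ^+ 2.
  rewrite -[leLHS]mul1r ler_pdivrMr//.
  have : 0 <= y ^+ 3 by exact: exprn_ge0.
  rewrite !exprS expr0; nra.
by move=> h3; apply/andP; split; lra.
Qed.

End log_sum_exp.

Section softmax.
Variables (R : realType) (T : finType) (I : {set T}) (p : T) (q : T -> R).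
Hypotheses (pI : p \in I) (q0 : forall i, i \in I -> 0 < q i) (q1 : \sum_(i in I) q i = 1).

(** The Jensen gap of the exponential under the weights [q]: log-moment generating function minus
    mean. Its second-order term is half the variance [wvar]. *)
Definition lse_gap (s : T -> R) :=
  ln (\sum_(i in I) q i * expR (s i)) - \sum_(i in I) q i * s i.
Definition wvar (s : T -> R) :=
  \sum_(i in I) q i * s i ^+ 2 - (\sum_(i in I) q i * s i) ^+ 2.
Definition abs_sum (s : T -> R) := \sum_(i in I) `|s i|.

Lemma abs_sum_ge0 s : 0 <= abs_sum s. Proof. exact: sumr_ge0. Qed.

Lemma le_abs_sum s i : i \in I -> `|s i| <= abs_sum s.
Proof. by move=> iI; rewrite /abs_sum (bigD1 i)//= lerDl sumr_ge0. Qed.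

Lemma sum_gt0 (f : T -> R) : (forall i, i \in I -> 0 < f i) -> 0 < \sum_(i in I) f i.
Proof.
move=> f0; rewrite (bigD1 p)//= ltr_wpDr ?f0// sumr_ge0// => i /andP[iI _].
by rewrite ltW// f0.
Qed.

(** The inverse of the sum of the inverses is an explicit lower bound. *)
Lemma min_pos (f : T -> R) : (forall i, i \in I -> 0 < f i) ->
  exists2 c, 0 < c & forall i, i \in I -> c <= f i.
Proof.
move=> f0; exists (\sum_(i in I) (f i)^-1)^-1.
  by rewrite invr_gt0 sum_gt0// => i iI; rewrite invr_gt0 f0.
move=> i iI; rewrite -[leRHS]invrK lef_pV2 ?posrE ?invr_gt0 ?f0//.
  by rewrite (bigD1 i)//= lerDl sumr_ge0// => j /andP[jI _]; rewrite invr_ge0 ltW// f0.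
by rewrite sum_gt0// => j jI; rewrite invr_gt0 f0.
Qed.

Lemma q_le1 i : i \in I -> q i <= 1.
Proof.
by move=> iI; rewrite -q1 (bigD1 i)//= lerDl sumr_ge0// => j /andP[jI _]; rewrite ltW// q0.
Qed.

(* Gibbs variational inequality with the relative entropy replaced by the
   larger chi-squared divergence. *)
Lemma gibbs_chi2 (q' x : T -> R) : (forall i, i \in I -> 0 < q' i) ->
  \sum_(i in I) q' i = 1 ->
  \sum_(i in I) q' i * x i + 1 - \sum_(i in I) q' i ^+ 2 / q i
    <= ln (\sum_(i in I) q i * expR (x i)).
Proof.
move=> q'0 q'1; set k := (X in X <= _).
rewrite -ler_expR lnK ?posrE; last by rewrite sum_gt0// => i iI; rewrite mulr_gt0 ?q0 ?expR_gt0.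
(* By the choice of [k] the sum equals 1. Termwise, [1 + z <= expR z] brings in [expR (x i)], and
   [q' i * expR (1 - q' i / q i) <= q i] follows from the same inequality. *)
have -> : expR k = expR k * \sum_(i in I) (q' i * (1 + (x i + 1 - q' i / q i - k))).
  rewrite [X in _ = _ * X](_ : _ = 1) ?mulr1//.
  under eq_bigr do rewrite !mulrDr !mulr1 !mulrN.
  rewrite !big_split/= !sumrN -mulr_suml q'1 mul1r.
  under [X in _ - X - _]eq_bigr do rewrite mulrA -expr2.
  by rewrite /k; ring.
rewrite mulr_sumr; apply: ler_sum => i iI.
have qi := q0 iI; have q'i := q'0 _ iI.
apply: le_trans (_ : expR k * (q' i * expR (x i + 1 - q' i / q i - k)) <= _).
  by rewrite ler_pM2l ?expR_gt0// ler_pM2l// expR_ge1Dx.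
have -> : expR k * (q' i * expR (x i + 1 - q' i / q i - k)) =
    q' i * expR (1 - q' i / q i) * expR (x i).
  rewrite mulrCA -expRD -mulrA -expRD; congr (_ * expR _); ring.
rewrite ler_wpM2r ?expR_ge0//.
have h : q' i / q i <= expR (q' i / q i - 1).
  by apply: le_trans (expR_ge1Dx _); lra.
have -> : 1 - q' i / q i = - (q' i / q i - 1) by lra.
rewrite expRN ler_pdivrMr ?expR_gt0//.
by rewrite mulrC -ler_pdivrMr.
Qed.

(** With [t = 1/sqrt L] this bounds [L] times the gap below by a linear function of [|s|_1],
    uniformly in [L >= 1]. In [gibbs_chi2] the weights are tilted by [c * t] in the direction of the
    signs of [s]: the gain is [c * t^2 * |s|_1], the chi-squared cost [O(t^2)]. *)
Lemma lse_gap_lower : exists2 c, 0 < c & exists2 C, 0 <= C &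
  forall (s : T -> R) (t : R), s p = 0 -> 0 < t <= 1 ->
    t ^+ 2 * (c * abs_sum s - C) <= lse_gap (fun i => t * s i).
Proof.
have [m m0 mq] := min_pos q0.
set N := #|I|%:R : R.
have N0 : 0 <= N by [].
have N1 : 0 < N + 1 by rewrite ltr_wpDl.
(* As the tilts are at most [N + 1], the tilted weights stay above [m / 2] for [t <= 1]. *)
pose c := m / (N + 1) / 2.
have c0 : 0 < c by rewrite divr_gt0// divr_gt0.
pose C := c ^+ 2 * \sum_(i in I) (N + 1) ^+ 2 / q i.
exists c => //; exists C.
  by rewrite mulr_ge0 ?sqr_ge0// sumr_ge0// => i iI; rewrite divr_ge0 ?sqr_ge0// ltW// q0.
move=> s t sp /andP[t0 t1].
(* The total mass is restored at [p], which costs nothing in the mean because [s p = 0]. *)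
pose sg i : R := if i == p then - \sum_(j in I | j != p) Num.sg (s j) else Num.sg (s i).
have sgN i : `|sg i| <= N + 1.
  have sg1 j : `|Num.sg (s j)| <= 1 by rewrite normr_sg; case: (s j != 0).
  rewrite /sg; case: ifP => _; last by apply: le_trans (sg1 i) _; rewrite lerDr.
  rewrite normrN; apply: le_trans (ler_norm_sum _ _ _) _.
  apply: le_trans (_ : \sum_(j in I) 1 <= _); last by rewrite sumr_const lerDl.
  rewrite [leRHS](bigD1 p)//=; apply: le_trans (ler_sum _ (fun j _ => sg1 j)) _.
  by rewrite lerDr.
have sg0 : \sum_(i in I) sg i = 0.
  rewrite (bigD1 p)//= {1}/sg eqxx addrC.
  rewrite (eq_bigr (fun i => Num.sg (s i))) ?subrr// => i /andP[_ /negbTE ip].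
  by rewrite /sg ip.
have sgs : \sum_(i in I) sg i * s i = abs_sum s.
  apply: eq_bigr => i _; rewrite /sg; case: eqP => [->|_]; first by rewrite sp mulr0 normr0.
  by rewrite normrEsg.
pose q' i := q i + c * t * sg i.
have q'0 i : i \in I -> 0 < q' i.
  move=> iI; have := mq _ iI; have := sgN i; rewrite ler_norml => /andP[h _] h2.
  have h3 : c * t * - (N + 1) <= c * t * sg i by rewrite ler_wpM2l// mulr_ge0// ltW.
  have h4 : c * t * (N + 1) <= c * 1 * (N + 1).
    by rewrite ler_wpM2r ?(ltW N1)// ler_wpM2l// ltW.
  have h5 : c * 1 * (N + 1) = m / 2 by rewrite /c; field; rewrite gt_eqF.
  rewrite /q'; lra.
have q'1 : \sum_(i in I) q' i = 1 by rewrite big_split/= -mulr_sumr sg0 mulr0 addr0.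
have := gibbs_chi2 (fun i => t * s i) q'0 q'1.
have -> : \sum_(i in I) q' i * (t * s i) =
    \sum_(i in I) q i * (t * s i) + t ^+ 2 * (c * abs_sum s).
  rewrite -sgs !mulr_sumr -big_split/=; apply: eq_bigr => i _; rewrite /q'; ring.
have -> : \sum_(i in I) q' i ^+ 2 / q i = 1 + t ^+ 2 * \sum_(i in I) c ^+ 2 * (sg i ^+ 2 / q i).
  transitivity (\sum_(i in I) (q i + 2 * c * t * sg i + t ^+ 2 * (c ^+ 2 * (sg i ^+ 2 / q i)))).
    by apply: eq_bigr => i iI; rewrite /q'; field; rewrite gt_eqF// q0.
  by rewrite !big_split/= -!mulr_sumr sg0 q1 mulr0 addr0.
have : t ^+ 2 * \sum_(i in I) c ^+ 2 * (sg i ^+ 2 / q i) <= t ^+ 2 * C.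
  rewrite ler_wpM2l ?sqr_ge0// /C mulr_sumr; apply: ler_sum => i iI.
  rewrite ler_wpM2l ?sqr_ge0// ler_wpM2r ?invr_ge0 ?(ltW (q0 iI))//.
  by rewrite -real_normK ?num_real// lerXn2r ?nnegrE// ltW.
rewrite /lse_gap mulrBr; lra.
Qed.

(** With second moment [A] and mean [b], dropping [p] from the variance sum leaves
    [A - b^2 (1 + q p) >= 0]; since [(1 + q p) (1 - q p / 2) >= 1], this yields
    [b^2 <= A (1 - q p / 2)]. *)
Lemma wvar_lower (s : T -> R) : s p = 0 ->
  q p / 2 * (\sum_(i in I) q i * s i ^+ 2) <= wvar s.
Proof.
move=> sp; set A := \sum_(i in I) q i * s i ^+ 2; set b := \sum_(i in I) q i * s i.
have : 0 <= \sum_(i in I | i != p) q i * (s i - b) ^+ 2.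
  by apply: sumr_ge0 => i /andP[iI _]; rewrite mulr_ge0 ?sqr_ge0// ltW// q0.
have AE : A = \sum_(i in I | i != p) q i * s i ^+ 2 by rewrite /A (bigD1 p)//= sp expr0n/= mulr0 add0r.
have bE : b = \sum_(i in I | i != p) q i * s i by rewrite /b (bigD1 p)//= sp mulr0 add0r.
have qE : \sum_(i in I | i != p) q i = 1 - q p by rewrite -q1 [in RHS](bigD1 p)//= addrAC subrr add0r.
have -> : \sum_(i in I | i != p) q i * (s i - b) ^+ 2 = A - 2 * b * b + b ^+ 2 * (1 - q p).
  transitivity (\sum_(i in I | i != p) (q i * s i ^+ 2 + (- (2 * b) * (q i * s i) + b ^+ 2 * q i))).
    by apply: eq_bigr => i _; ring.
  by rewrite !big_split/= -!mulr_sumr -AE -bE qE mulNr addrA.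
have A0 : 0 <= A by apply: sumr_ge0 => i iI; rewrite mulr_ge0 ?sqr_ge0// ltW// q0.
have := q0 pI; have := q_le1 pI; rewrite /wvar -/A -/b => qp1 qp0 h.
have h2 : b ^+ 2 * (1 + q p) <= A by rewrite !expr2 in h *; nra.
have : b ^+ 2 <= A / (1 + q p) by rewrite ler_pdivlMr//; lra.
have : A / (1 + q p) <= A * (1 - q p / 2).
  rewrite ler_pdivrMr; [|lra]; rewrite -mulrA ler_peMr//; nra.
nra.
Qed.

Lemma wvar_ge0 (s : T -> R) : s p = 0 -> 0 <= wvar s.
Proof.
move=> sp; apply: le_trans (wvar_lower sp); rewrite mulr_ge0//.
  by rewrite divr_ge0// ltW// q0.
by apply: sumr_ge0 => i iI; rewrite mulr_ge0 ?sqr_ge0// ltW// q0.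
Qed.

(** Linearised through [x^2 >= 2 |x| - 1], so that the limiting exponent has the same majorant as
    the exponents at finite [L]. *)
Lemma wvar_linear_lower : exists2 c, 0 < c & exists2 C, 0 <= C &
  forall s : T -> R, s p = 0 -> c * abs_sum s - C <= wvar s / 2.
Proof.
have [m m0 mq] := min_pos q0; have qp0 := q0 pI.
exists (q p / 2 * m); first by rewrite mulr_gt0// divr_gt0.
exists (q p / 4 * m * #|I|%:R).
  by rewrite !mulr_ge0// ?ltW// divr_ge0// ltW.
move=> s sp; have := wvar_lower sp.
have : m * (2 * abs_sum s - #|I|%:R) <= \sum_(i in I) q i * s i ^+ 2.
  rewrite -sumr_const /abs_sum mulr_sumr -sumrB mulr_sumr; apply: ler_sum => i iI.
  apply: le_trans (_ : m * s i ^+ 2 <= _); last by rewrite ler_wpM2r ?sqr_ge0// mq.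
  rewrite ler_pM2l//.
  have := sqr_ge0 (`|s i| - 1); rewrite sqrrB1 real_normK ?num_real//; lra.
move=> h1 h2.
have : q p / 2 * (m * (2 * abs_sum s - #|I|%:R)) <= wvar s.
  by apply: le_trans h2; rewrite ler_wpM2l// divr_ge0// ltW.
lra.
Qed.

Lemma lse_abs (s : T -> R) : `|ln (\sum_(i in I) q i * expR (s i))| <= abs_sum s.
Proof.
have Z0 : 0 < \sum_(i in I) q i * expR (s i) by rewrite sum_gt0// => i iI; rewrite mulr_gt0 ?q0 ?expR_gt0.
have bd i : i \in I -> - abs_sum s <= s i <= abs_sum s by move=> iI; rewrite -ler_norml le_abs_sum.
rewrite ler_norml -(expRK (- abs_sum s)) -[in X in _ && X](expRK (abs_sum s)).
rewrite !ler_ln ?posrE ?expR_gt0//; apply/andP; split.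
  rewrite -[leLHS]mul1r -q1 mulr_suml; apply: ler_sum => i iI.
  by rewrite ler_wpM2l ?(ltW (q0 iI))// ler_expR; have /andP[] := bd _ iI.
rewrite -[leRHS]mul1r -q1 mulr_suml; apply: ler_sum => i iI.
by rewrite ler_wpM2l ?(ltW (q0 iI))// ler_expR; have /andP[] := bd _ iI.
Qed.

(** After centring at the mean the gap is [ln (1 + Y)], with [Y] the average of [expR2], itself half
    the variance up to a cubic error. There is no smallness condition, so the bound applies to every
    point of the rescaled space. *)
Lemma lse_gap_taylor (s : T -> R) :
  `|lse_gap s - wvar s / 2| <= 40 * abs_sum s ^+ 3.
Proof.
set M := abs_sum s; have M0 : 0 <= M by exact: abs_sum_ge0.
set m := \sum_(i in I) q i * s i.
pose t i := s i - m.
have mM : `|m| <= M.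
  apply: le_trans (ler_norm_sum _ _ _) _; apply: ler_sum => i iI.
  by rewrite normrM ger0_norm ?(ltW (q0 iI))// ler_piMl// q_le1.
have tM i : i \in I -> `|t i| <= 2 * M.
  move=> iI; apply: le_trans (ler_normB _ _) _.
  by have := le_abs_sum s iI; rewrite -/M; lra.
have qt0 : \sum_(i in I) q i * t i = 0.
  under eq_bigr do rewrite mulrBr.
  by rewrite sumrB -mulr_suml q1 mul1r subrr.
pose Y := \sum_(i in I) q i * expR2 (t i).
have Y0 : 0 <= Y by apply: sumr_ge0 => i iI; rewrite mulr_ge0 ?expR2_ge0// ltW// q0.
have YE : \sum_(i in I) q i * expR (t i) = 1 + Y.
  transitivity (\sum_(i in I) (q i + (q i * expR2 (t i) + q i * t i))).
    by apply: eq_bigr => i _; rewrite /expR2; ring.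
  by rewrite !big_split/= q1 qt0 addr0.
have gE : lse_gap s = ln (1 + Y).
  rewrite /lse_gap -YE -/m.
  have -> : \sum_(i in I) q i * expR (s i) = expR m * \sum_(i in I) q i * expR (t i).
    rewrite mulr_sumr; apply: eq_bigr => i _; rewrite mulrCA -expRD; congr (_ * expR _).
    by rewrite /t; ring.
  rewrite lnM ?posrE ?expR_gt0 ?YE ?expRK; [ring|by []|].
  by rewrite ltr_wpDr.
have vE : wvar s = \sum_(i in I) q i * t i ^+ 2.
  rewrite /wvar -/m.
  transitivity (\sum_(i in I) (q i * s i ^+ 2 + (- (2 * m) * (q i * s i) + m ^+ 2 * q i))).
    by rewrite !big_split/= -!mulr_sumr -/m q1; ring.
  by apply: eq_bigr => i _; rewrite /t; ring.
have t2 i : i \in I -> t i ^+ 2 <= 4 * M ^+ 2.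
  move=> iI; rewrite -real_normK ?num_real//.
  have -> : 4 * M ^+ 2 = (2 * M) ^+ 2 by ring.
  by rewrite lerXn2r ?nnegrE ?mulr_ge0// tM.
have avg (f : T -> R) K : (forall i, i \in I -> f i <= K) -> \sum_(i in I) q i * f i <= K.
  move=> fK; rewrite -[leRHS]mul1r -q1 mulr_suml; apply: ler_sum => i iI.
  by rewrite ler_wpM2l ?(ltW (q0 iI))// fK.
have V4 : wvar s <= 4 * M ^+ 2 by rewrite vE avg.
have V0 : 0 <= wvar s by rewrite vE sumr_ge0// => i iI; rewrite mulr_ge0 ?sqr_ge0// ltW// q0.
rewrite gE.
(* Small [M]: expansion, with error [16 M^3 + 16 M^3]. Large [M]: the crude bounds [2 M] on the gap
   and [4 M^2] on the variance are themselves cubic, giving [32 M^3 + 8 M^3], the origin of the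
   constant 40. *)
have [M4|M4] := leP M (1/4).
  have t12 i : i \in I -> `|t i| <= 1/2 by move=> iI; apply: le_trans (tM _ iI) _; lra.
  have Y8 : Y <= 8 * M ^+ 2.
    apply: avg => i iI; apply: le_trans (expR2_le _) _.
      by apply: le_trans (ler_norm _) (t12 _ iI).
    have := t2 _ iI; lra.
  have YV : `|Y - wvar s / 2| <= 16 * M ^+ 3.
    rewrite vE /Y mulr_suml -sumrB; apply: le_trans (ler_norm_sum _ _ _) _.
    apply: le_trans (_ : \sum_(i in I) q i * (16 * M ^+ 3) <= _); last exact: avg.
    apply: ler_sum => i iI; rewrite -mulrA -mulrBr normrM ger0_norm ?(ltW (q0 iI))//.
    rewrite ler_wpM2l ?(ltW (q0 iI))//; apply: le_trans (expR_taylor2 (t12 _ iI)) _.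
    have : `|t i| ^+ 3 <= (2 * M) ^+ 3 by rewrite lerXn2r ?nnegrE ?mulr_ge0// tM.
    by rewrite exprMn; lra.
  have Y2 : Y ^+ 2 <= 16 * M ^+ 3.
    apply: le_trans (_ : (8 * M ^+ 2) ^+ 2 <= _); first by rewrite lerXn2r ?nnegrE ?mulr_ge0 ?sqr_ge0.
    have -> : (8 * M ^+ 2) ^+ 2 = M ^+ 3 * (64 * M) by ring.
    by rewrite mulrC ler_wpM2r ?exprn_ge0//; lra.
  have /andP[l1 l2] := ln1D_bounds Y0.
  have M3 : 0 <= M ^+ 3 by exact: exprn_ge0.
  move: YV; rewrite !ler_norml => /andP[h1 h2]; apply/andP; split; lra.
have l0 : 0 <= ln (1 + Y) by rewrite ln_ge0// lerDl.
have l1 : ln (1 + Y) <= 2 * M.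
  rewrite -gE /lse_gap -/m; have := lse_abs s; rewrite -/M; move: mM.
  by rewrite !ler_norml => /andP[h1 h2] /andP[h3 h4]; lra.
have M1 : M <= 16 * M ^+ 3.
  have -> : 16 * M ^+ 3 = M * (16 * M ^+ 2) by ring.
  by rewrite ler_peMr//; nra.
have M2 : M ^+ 2 <= 4 * M ^+ 3.
  have -> : 4 * M ^+ 3 = M ^+ 2 * (4 * M) by ring.
  by rewrite ler_peMr ?sqr_ge0//; lra.
by rewrite ler_norml; apply/andP; split; lra.
Qed.

End softmax.

(** * Positive definite forms and Gaussian weights *)

Section gaussian_weight.
Variable R : realType.

(** The sum of the two exponentials is convenient because each has its own integrable majorant. *)
Lemma expRN_lip (x y : R) : `|expR (- x) - expR (- y)| <= `|x - y| * (expR (- x) + expR (- y)).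
Proof.
wlog xy : x y / x <= y => [H|].
  have [/ltW|] := ltP y x => xy; last exact: H.
  by rewrite distrC (distrC x) [X in _ * X]addrC H.
have e0 := expR_gt0 (- y); have e1 := expR_gt0 (- x).
rewrite ger0_norm; last by rewrite subr_ge0 ler_expR lerN2.
rewrite ler0_norm ?subr_le0// opprB.
have -> : expR (- y) = expR (- x) * expR (- (y - x)) by rewrite -expRD; congr expR; ring.
have := expR_ge1Dx (- (y - x)).
set e := expR (- (y - x)) => h.
have : expR (- x) * (1 - (y - x)) <= expR (- x) * e by rewrite ler_pM2l.
have : 0 <= (y - x) * (expR (- x) * e).
  by rewrite mulr_ge0 ?subr_ge0// mulr_ge0 ?expR_ge0.
nra.
Qed.

Lemma bform0r n (M : 'M[R]_n) (u : 'cV[R]_n) : bform M u 0 = 0.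
Proof. by rewrite /bform mulmx0 mxE. Qed.

Lemma posdef_ge0 n (M : 'M[R]_n) (u : 'cV[R]_n) : posdef M -> 0 <= bform M u u.
Proof. by move=> Mp; have [->|/Mp/ltW//] := eqVneq u 0; rewrite bform0r. Qed.

Lemma bform_CS n (M : 'M[R]_n) (x u : 'cV[R]_n) : M^T = M -> posdef M ->
  bform M x u ^+ 2 <= bform M x x * bform M u u.
Proof.
move=> Ms Mp; have [->|u0] := eqVneq u 0.
  by rewrite !bform0r expr0n/= mulr0.
have c0 := Mp _ u0; set c := bform M u u in c0 *; set b := bform M x u.
have := posdef_ge0 (x - (b / c) *: u) Mp.
rewrite !(bformDl, bformDr, bformNl, bformNr, bformZl, bformZr) (bform_sym u x Ms) -/b -/c.
set y := (Y in _ <= Y -> _); have -> : y = bform M x x - b ^+ 2 / c.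
  by rewrite /y; field; rewrite gt_eqF.
by rewrite subr_ge0 ler_pdivrMr.
Qed.

(** No eigenvalues: [u i] is the [M]-product of [u] with [M^-1 e_i], so Cauchy-Schwarz gives
    [u_i^2 <= (M^-1)_ii * bform M u u]; summation makes the trace of [M^-1] appear in the
    constant. *)
Lemma posdef_lower n (M : 'M[R]_n) : M^T = M -> posdef M ->
  exists2 k, 0 < k & forall u : 'cV[R]_n, k * \sum_i u i 0 ^+ 2 <= bform M u u.
Proof.
move=> Ms Mp; have [Md _] := gaussian_integral_posdef Ms Mp.
have uM : M \in unitmx by rewrite unitmxE unitfE gt_eqF.
have [_ Np] := posdef_inv Ms Mp uM.
have N0 i : 0 <= invmx M i i.
  by rewrite -bform_delta posdef_ge0.
have T0 : 0 < 1 + \sum_i invmx M i i by rewrite ltr_pwDl// sumr_ge0.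
exists (1 + \sum_i invmx M i i)^-1; first by rewrite invr_gt0.
move=> u; rewrite mulrC ler_pdivrMr//.
have u0 := posdef_ge0 u Mp.
rewrite mulrDr mulr1 mulr_sumr; apply: le_trans (_ : \sum_i bform M u u * invmx M i i <= _); last by rewrite lerDr.
apply: ler_sum => i _.
have := bform_CS (invmx M *m delta_mx i 0) u Ms Mp.
have [Is _] := posdef_inv Ms Mp uM.
have -> : bform M (invmx M *m delta_mx i 0) u = u i 0.
  by rewrite /bform trmx_mul Is -!mulmxA mulKmx// trmx_delta -rowE !mxE.
have -> : bform M (invmx M *m delta_mx i 0) (invmx M *m delta_mx i 0) = invmx M i i.
  by rewrite /bform trmx_mul Is -!mulmxA mulKVmx// mulmxA trmx_delta -rowE -colE !mxE.
by rewrite mulrC.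
Qed.

Definition gweight n (M : 'M[R]_n) (mu u : 'cV[R]_n) : R :=
  expR (- (1/2) * bform M (u - mu) (u - mu)).

Lemma gweight_ge0 n (M : 'M[R]_n) mu u : 0 <= gweight M mu u. Proof. exact: expR_ge0. Qed.

Lemma mcV_gweight n (M : 'M[R]_n) mu : mcV (gweight M mu : _ -> measurableTypeR R).
Proof. exact: mcV_gauss. Qed.

(** Coordinatewise, [|d| <= k d^2 / 2 + 1 / (2 k)] weakens Gaussian decay to exponential decay. *)
Lemma gweight_le n (M : 'M[R]_n) mu : M^T = M -> posdef M ->
  exists2 C, 0 < C & forall u, gweight M mu u <= C * Phi 1 u.
Proof.
move=> Ms Mp; have [k k0 kM] := posdef_lower Ms Mp.
pose C := \sum_(i < n) ((2 * k)^-1 + `|mu i 0|).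
exists (expR C); first exact: expR_gt0.
move=> u; rewrite /Phi -expRD ler_expR mulN1r.
have : \sum_i (`|u i 0| - ((2 * k)^-1 + `|mu i 0|)) <= (1/2) * bform M (u - mu) (u - mu).
  apply: le_trans (_ : (1/2) * (k * \sum_i (u - mu) i 0 ^+ 2) <= _); last by rewrite ler_wpM2l.
  rewrite !mulr_sumr; apply: ler_sum => i _; rewrite !mxE.
  set d := u i 0 - mu i 0.
  have h : `|u i 0| <= `|d| + `|mu i 0|.
    by rewrite (le_trans _ (ler_normD _ _))// /d subrK.
  have : 0 <= (k * `|d| - 1) ^+ 2 / (2 * k) by rewrite divr_ge0 ?sqr_ge0// mulr_ge0// ltW.
  have -> : (k * `|d| - 1) ^+ 2 / (2 * k) = 1/2 * (k * d ^+ 2) - `|d| + (2 * k)^-1.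
    rewrite -[d ^+ 2]real_normK ?num_real//; field; rewrite gt_eqF//.
  lra.
by rewrite sumrB -/C /l1 => h; lra.
Qed.

Lemma bform_bound n (M : 'M[R]_n) : exists2 C, 0 < C &
  forall u v : 'cV[R]_n, `|bform M u v| <= C * (l1 u * l1 v).
Proof.
pose C := 1 + \sum_i \sum_j `|M i j|.
have C0 : 0 <= \sum_i \sum_j `|M i j| by apply: sumr_ge0 => i _; exact: sumr_ge0.
exists C; first by rewrite ltr_pwDl.
have MC i j : `|M i j| <= C.
  apply: le_trans (_ : \sum_i \sum_j `|M i j| <= _); last by rewrite lerDr.
  rewrite (bigD1 i)//= (bigD1 j)//= -addrA lerDl addr_ge0 ?sumr_ge0// => k _.
  exact: sumr_ge0.
move=> u v; rewrite bformE /l1 mulr_suml mulr_sumr.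
apply: le_trans (ler_norm_sum _ _ _) _; apply: ler_sum => i _.
rewrite mulr_sumr mulr_sumr; apply: le_trans (ler_norm_sum _ _ _) _; apply: ler_sum => j _.
rewrite !normrM mulrAC mulrC ler_wpM2r// mulr_ge0//.
Qed.

Lemma l1D n (u v : 'cV[R]_n) : l1 (u + v) <= l1 u + l1 v.
Proof. by rewrite /l1 -big_split/=; apply: ler_sum => i _; rewrite mxE ler_normD. Qed.

Lemma l1N n (u : 'cV[R]_n) : l1 (- u) = l1 u.
Proof. by apply: eq_bigr => i _; rewrite mxE normrN. Qed.

(** The difference of the two quadratic forms factors as [bform M (u - v) (u + v - 2 mu)]. *)
Lemma gweight_lip n (M : 'M[R]_n) mu : M^T = M ->
  exists2 C, 0 < C & forall u v,
  `|gweight M mu u - gweight M mu v| <=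
    C * l1 (u - v) * (1 + l1 u + l1 v) * (gweight M mu u + gweight M mu v).
Proof.
move=> Ms; have [C C0 CM] := bform_bound M.
exists (C * (1 + 2 * l1 mu)); first by rewrite mulr_gt0// ltr_pwDl// mulr_ge0 ?l1_ge0.
move=> u v; rewrite /gweight !mulNr.
apply: le_trans (expRN_lip _ _) _; rewrite ler_wpM2r ?addr_ge0 ?expR_ge0//.
rewrite -mulrBr.
have -> : bform M (u - mu) (u - mu) - bform M (v - mu) (v - mu) =
   bform M (u - v) ((u - mu) + (v - mu)).
  rewrite !(bformDl, bformDr, bformNl, bformNr).
  rewrite (bform_sym v u Ms) (bform_sym mu u Ms) (bform_sym mu v Ms); ring.
rewrite normrM; set d := l1 (u - v).
have d0 : 0 <= d by exact: l1_ge0.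
have := CM (u - v) (u - mu + (v - mu)); rewrite -/d.
have : l1 (u - mu + (v - mu)) <= l1 u + l1 v + 2 * l1 mu.
  have := l1D (u - mu) (v - mu); have := l1D u (- mu); have := l1D v (- mu).
  rewrite l1N; lra.
set e := l1 (u - mu + _) => he; set b := `|bform _ _ _| => hb.
have u0 := l1_ge0 u; have v0 := l1_ge0 v; have m0 := l1_ge0 mu.
have -> : `|1/2 : R| = 1/2 by rewrite ger0_norm.
apply: le_trans (_ : b <= _); first by rewrite ler_piMl// ?normr_ge0//; lra.
apply: le_trans hb _.
have -> : C * (1 + 2 * l1 mu) * d * (1 + l1 u + l1 v) =
  C * (d * ((1 + 2 * l1 mu) * (1 + l1 u + l1 v))) by ring.
rewrite ler_pM2l// ler_wpM2l//; apply: le_trans he _; nra.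
Qed.

End gaussian_weight.

(** * Laplace's method at a peak *)
Section laplace_chart.
Variables (R : realType) (n : nat) (p : 'I_n) (I : {set 'I_n}) (a : 'cV[R]_n).
Hypotheses (pI : p \in I) (ap0 : 0 < a p 0).
Hypothesis aneg : forall i, i \in I -> i != p -> a i 0 < 0.
Hypothesis aoff : forall i, i \notin I -> a i 0 = 0.
Let S := \sum_i a i 0.
Hypothesis S0 : 0 < S.

Let K := I :\ p.
Implicit Types (v u : 'cV[R]_n) (t L : R).

(** The Gibbs weights of [cone] at [vstar]: [exp (vstar_i) / cone] for [i] in [K], while the index
    [p] stands for the constant term 1 of [cone]. *)
Definition softw (i : 'I_n) : R := if i == p then S / a p 0 else - a i 0 / a p 0.

Lemma softw_gt0 i : i \in I -> 0 < softw i.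
Proof.
move=> iI; rewrite /softw; case: eqVneq => [_|ip]; first exact: divr_gt0.
by rewrite divr_gt0// oppr_gt0 aneg.
Qed.

Lemma sumI (f : 'I_n -> R) : (forall i, i \notin I -> f i = 0) ->
  \sum_i f i = f p + \sum_(i in K) f i.
Proof.
move=> f0; rewrite (bigD1 p)//=; congr (_ + _).
rewrite (bigID (mem I))/= addrC big1 ?add0r; last by move=> i /andP[_ /f0].
by apply: eq_bigl => i; rewrite !inE.
Qed.

Lemma sum_setI (f : 'I_n -> R) : \sum_(i in I) f i = f p + \sum_(i in K) f i.
Proof. by rewrite (big_setD1 p). Qed.

Lemma softw_sum1 : \sum_(i in I) softw i = 1.
Proof.
rewrite sum_setI {1}/softw eqxx.
rewrite (eq_bigr (fun i => - (a i 0 / a p 0))); last first.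
  by move=> i /setD1P[/negbTE ip _]; rewrite /softw ip mulNr.
rewrite sumrN -mulr_suml -mulrBl /S sumI//.
by rewrite addrK divff// gt_eqF.
Qed.

Definition vstar : 'cV[R]_n := \col_i (if i \in I then ln (`|a i 0| / S) else 0).

Definition dots v := \sum_i a i 0 * v i 0.

(** The slot [p] represents the term 1 of [cone], whose exponent is 0; this is the condition
    [s p = 0] of the softmax lemmas. *)
Definition spart v (i : 'I_n) : R := if i == p then 0 else v i 0.

Definition cone v := 1 + \sum_(i in K) expR (v i 0).

Definition widen t v : 'cV[R]_n :=
  \col_i ((if i \in K then t else 1) * v i 0 + (if i \in K then vstar i 0 else 0)).

(* Laplace substitution: [vstar] is the minimiser of the exponent on the surface
   [v_p = ln (cone v)], which bounds [{exp_diff >= e^L}] up to exponentially small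
   terms; coordinates along it scale as [1/sqrt L], the one across it as [1/L]. *)
Definition chart L v :=
  upd (widen (Num.sqrt L)^-1 v) p
    (L^-1 * v p 0 + ln (cone (widen (Num.sqrt L)^-1 v))).

Definition rest v := \sum_(i | i \notin I) `|v i 0|.

(** The limit of [chart L v] as [L] grows: the coordinates in [I] freeze at [vstar]. *)
Definition atstar v : 'cV[R]_n := \col_i (if i \in I then vstar i 0 else v i 0).

Lemma cone_ge1 v : 1 <= cone v.
Proof. by rewrite lerDl sumr_ge0// => i _; exact: expR_ge0. Qed.

Lemma cone_gt0 v : 0 < cone v. Proof. exact: lt_le_trans ltr01 (cone_ge1 v). Qed.

Lemma vstarK i : i \in I -> expR (vstar i 0) = `|a i 0| / S.
Proof.
move=> iI; rewrite mxE iI lnK// posrE divr_gt0// normr_gt0.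
by have [->|ip] := eqVneq i p; [rewrite gt_eqF|rewrite lt_eqF// aneg].
Qed.

Lemma cone_widen t v : cone (widen t v) =
  expR (vstar p 0) * \sum_(i in I) softw i * expR (t * spart v i).
Proof.
rewrite vstarK// gtr0_norm// sum_setI mulrDr /softw /spart eqxx mulr0 expR0 mulr1.
congr (_ + _); first by field; rewrite !gt_eqF.
rewrite mulr_sumr; apply: eq_bigr => i iK; rewrite mxE iK expRD.
move: (iK) => /setD1P[ip iI]; rewrite (negbTE ip) vstarK// ltr0_norm ?aneg//.
by field; rewrite !gt_eqF.
Qed.

Lemma soft_gt0 (x : 'I_n -> R) : 0 < \sum_(i in I) softw i * expR (x i).
Proof.
by rewrite sum_setI ltr_pwDl ?mulr_gt0 ?softw_gt0 ?expR_gt0// sumr_ge0// => i /setD1P[_ iI];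
   rewrite mulr_ge0 ?expR_ge0// ltW// softw_gt0.
Qed.

Lemma ln_cone_widen t v : ln (cone (widen t v)) =
  vstar p 0 + ln (\sum_(i in I) softw i * expR (t * spart v i)).
Proof. by rewrite cone_widen lnM ?posrE ?expR_gt0 ?soft_gt0// expRK. Qed.

Lemma chartp L v : chart L v p 0 = L^-1 * v p 0 + ln (cone (widen (Num.sqrt L)^-1 v)).
Proof. by rewrite updE eqxx. Qed.

Lemma chartK L v i : i \in K -> chart L v i 0 = (Num.sqrt L)^-1 * v i 0 + vstar i 0.
Proof. by move=> iK; rewrite updE mxE iK; case/setD1P: iK => /negbTE ->. Qed.

Lemma chartC L v i : i \notin I -> chart L v i 0 = v i 0.
Proof.
move=> iI; rewrite updE; case: eqVneq => [ip|_]; first by move: iI; rewrite ip pI.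
by rewrite mxE ifN ?ifN ?mul1r ?addr0// !inE negb_and iI orbT.
Qed.

Lemma cone_chart L v : cone (chart L v) = cone (widen (Num.sqrt L)^-1 v).
Proof.
congr (_ + _); apply: eq_bigr => i /setD1P[ip _].
by rewrite updE (negbTE ip).
Qed.

(** Since [a i = - a p * softw i] on [K], the linear terms are minus [a p] times the weighted mean;
    together with the log-sum-exp of coordinate [p] they form the gap. Its vanishing first order is
    the stationarity of [vstar]. *)
Lemma dots_chart L v : dots (chart L v) = dots vstar + a p 0 * (L^-1 * v p 0) +
  a p 0 * lse_gap I softw (fun i => (Num.sqrt L)^-1 * spart v i).
Proof.
set t := (Num.sqrt L)^-1.
rewrite /dots sumI; last by move=> i /aoff ->; rewrite mul0r.
rewrite [\sum_i _ * vstar i 0]sumI; last by move=> i /aoff ->; rewrite mul0r.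
have -> : \sum_(i in K) a i 0 * chart L v i 0 =
    \sum_(i in K) (a i 0 * vstar i 0 - a p 0 * (softw i * (t * spart v i))).
  apply: eq_bigr => i iK; rewrite chartK// -/t /softw /spart; case/setD1P: (iK) => /negbTE -> _.
  by field; rewrite gt_eqF.
rewrite chartp ln_cone_widen -/t.
rewrite sumrB -mulr_sumr /lse_gap.
rewrite [X in _ = _ + _ * (_ - X)](sum_setI (fun i => softw i * (t * spart v i))).
have -> : spart v p = 0 by rewrite /spart eqxx.
ring.
Qed.

Lemma sum_split (f : 'I_n -> R) : \sum_i f i = f p + \sum_(i in K) f i + \sum_(i | i \notin I) f i.
Proof. by rewrite (bigID (mem I))/= sum_setI. Qed.

Lemma l1_split v : l1 v = `|v p 0| + abs_sum I (spart v) + rest v.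
Proof.
rewrite /l1 sum_split /abs_sum sum_setI {1}/spart eqxx normr0 add0r.
by congr (_ + _ + _); apply: eq_bigr => i /setD1P[/negbTE ip _]; rewrite /spart ip.
Qed.

Lemma rest_ge0 v : 0 <= rest v. Proof. exact: sumr_ge0. Qed.

Lemma rest_chart L v : rest (chart L v) = rest v.
Proof. by apply: eq_bigr => i iI; rewrite chartC. Qed.

Lemma rest_atstar v : rest (atstar v) = rest v.
Proof. by apply: eq_bigr => i /negbTE iI; rewrite mxE iI. Qed.

Lemma rest_le_l1 v : rest v <= l1 v.
Proof. by rewrite l1_split lerDr addr_ge0// abs_sum_ge0. Qed.

Lemma sqrtV_le1 L : 1 <= L -> 0 < (Num.sqrt L)^-1 <= 1.
Proof.
move=> L1; have s1 : 1 <= Num.sqrt L by rewrite -sqrtr1 ler_wsqrtr.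
by rewrite invr_gt0 (lt_le_trans ltr01 s1) invf_le1 ?(lt_le_trans ltr01 s1).
Qed.

Lemma sqrtV_sqr L : 1 <= L -> L^-1 = (Num.sqrt L)^-1 ^+ 2.
Proof. by move=> L1; rewrite exprVn sqr_sqrtr// (le_trans ler01). Qed.

Lemma chart_near L v : 1 <= L -> l1 (chart L v - atstar v) <= 2 * (Num.sqrt L)^-1 * l1 v.
Proof.
move=> L1; have /andP[t0 t1] := sqrtV_le1 L1; have LE := sqrtV_sqr L1.
set t := (Num.sqrt L)^-1 in t0 t1 LE *.
have dE i : (chart L v - atstar v) i 0 = chart L v i 0 - atstar v i 0.
  by rewrite [LHS]mxE [X in _ + X]mxE.
have E0 i : i \notin I -> (chart L v - atstar v) i 0 = 0.
  by move=> iI; rewrite dE chartC// [atstar v i 0]mxE (negbTE iI) subrr.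
rewrite /l1 (sum_split (fun i => `|(chart L v - atstar v) i 0|)).
rewrite [X in _ + X]big1 ?addr0; last by move=> i iI; rewrite E0// normr0.
have -> : (chart L v - atstar v) p 0 = L^-1 * v p 0 +
    ln (\sum_(i in I) softw i * expR (t * spart v i)).
  by rewrite dE chartp ln_cone_widen [atstar v p 0]mxE pI -/t; ring.
have -> : \sum_(i in K) `|(chart L v - atstar v) i 0| = \sum_(i in K) (t * `|spart v i|).
  apply: eq_bigr => i iK; rewrite dE chartK// [atstar v i 0]mxE; case/setD1P: (iK) => /negbTE ip ->.
  by rewrite addrK normrM gtr0_norm// /spart ip.
rewrite -mulr_sumr.
have := l1_split v; rewrite /l1 => ->.
have h1 : `|L^-1 * v p 0 + ln (\sum_(i in I) softw i * expR (t * spart v i))| <=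
     t * `|v p 0| + t * abs_sum I (spart v).
  apply: le_trans (ler_normD _ _) _; apply: lerD.
    rewrite LE normrM ger0_norm ?sqr_ge0// ler_wpM2r// expr2 ler_piMl// ltW//.
  apply: le_trans (@lse_abs _ _ _ p _ pI softw_gt0 softw_sum1 _) _.
  rewrite /abs_sum mulr_sumr; apply: ler_sum => i _.
  by rewrite normrM gtr0_norm.
have h2 : \sum_(i in K) `|spart v i| = abs_sum I (spart v).
  by rewrite /abs_sum sum_setI {2}/spart eqxx normr0 add0r.
rewrite h2; have := rest_ge0 v; have : 0 <= abs_sum I (spart v) by exact: abs_sum_ge0.
have := normr_ge0 (v p 0).
move: h1; set x := `|_ + ln _|; set A := abs_sum _ _; set V := `|v p 0|; set r := rest v.
move=> h1 V0 A0 r0; have : 0 <= t * r by rewrite mulr_ge0// ltW.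
have : 0 <= t * V by rewrite mulr_ge0// ltW.
nra.
Qed.

Lemma l1_atstar v : l1 (atstar v) <= l1 vstar + l1 v.
Proof.
rewrite /l1 -big_split/=; apply: ler_sum => i _; rewrite [atstar v i 0]mxE.
by case: ifP => _; rewrite ?lerDl ?lerDr.
Qed.

Lemma l1_chart L v : 1 <= L -> l1 (chart L v) <= l1 vstar + 3 * l1 v.
Proof.
move=> L1; have := chart_near v L1; have /andP[t0 t1] := sqrtV_le1 L1.
have := l1D (chart L v - atstar v) (atstar v); rewrite subrK.
have := l1_atstar v; have := l1_ge0 v; set t := (Num.sqrt L)^-1 in t0 t1 *.
move=> h0 h1 h2 h3; have : t * l1 v <= l1 v by rewrite ler_piMl.
lra.
Qed.

Lemma Phi_le_rest v : Phi 1 v <= expR (- rest v).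
Proof. by rewrite /Phi ler_expR mulN1r lerN2 rest_le_l1. Qed.

End laplace_chart.

(** * Limit and majorant of the rescaled integrand *)

Section laplace_pointwise.
Variables (R : realType) (n : nat) (p : 'I_n) (I : {set 'I_n}) (a : 'cV[R]_n).
Hypotheses (pI : p \in I) (ap0 : 0 < a p 0).
Hypothesis aneg : forall i, i \in I -> i != p -> a i 0 < 0.
Hypothesis aoff : forall i, i \notin I -> a i 0 = 0.
Hypothesis S0 : 0 < \sum_i a i 0.
Variables (M : 'M[R]_n) (mu : 'cV[R]_n).
Hypotheses (Ms : M^T = M) (Mp : posdef M).
Implicit Types (v u : 'cV[R]_n) (L : R).

Let q := softw p a.
Let q0 : forall i, i \in I -> 0 < q i := softw_gt0 ap0 aneg S0.
Let q1 : \sum_(i in I) q i = 1 := softw_sum1 pI ap0 aoff.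
Let sp v : spart p v p = 0. Proof. by rewrite /spart eqxx. Qed.

Definition expo L v := a p 0 * (L * lse_gap I q (fun i => (Num.sqrt L)^-1 * spart p v i)).
Definition expo_lim v := a p 0 * (wvar I q (spart p v) / 2).

Definition scaled L v := expR (- (a p 0 * v p 0)) * expR (- expo L v) *
  gweight M mu (chart p I a L v).
Definition scaled_lim v := expR (- (a p 0 * v p 0)) * expR (- expo_lim v) *
  gweight M mu (atstar I a v).

Lemma Phi_le c c' v : c <= c' -> Phi c' v <= Phi c v.
Proof. by move=> cc; rewrite ler_expR ler_wpM2r ?l1_ge0// lerN2. Qed.

Lemma expo_lower : exists2 c, 0 < c & exists2 C, 0 <= C & forall L v, 1 <= L ->
  (c * abs_sum I (spart p v) - C <= expo L v) /\ (c * abs_sum I (spart p v) - C <= expo_lim v).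
Proof.
have [c1 c10 [C1 C10 h1]] := lse_gap_lower pI q0 q1.
have [c2 c20 [C2 C20 h2]] := wvar_linear_lower pI q0 q1.
exists (a p 0 * Num.min c1 c2); first by rewrite mulr_gt0// lt_min c10.
exists (a p 0 * (C1 + C2)); first by rewrite mulr_ge0 ?addr_ge0// ltW.
move=> L v L1; have A0 := abs_sum_ge0 I (spart p v).
have m1 : Num.min c1 c2 * abs_sum I (spart p v) <= c1 * abs_sum I (spart p v).
  by rewrite ler_wpM2r// ge_min lexx.
have m2 : Num.min c1 c2 * abs_sum I (spart p v) <= c2 * abs_sum I (spart p v).
  by rewrite ler_wpM2r// ge_min lexx orbT.
split; rewrite -mulrA -mulrBr ler_wpM2l ?(ltW ap0)//.
  have /andP[t0 t1] := sqrtV_le1 L1.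
  have L0 : 0 < L by exact: lt_le_trans L1.
  apply: le_trans (_ : c1 * abs_sum I (spart p v) - C1 <= _); first by lra.
  rewrite -ler_pdivrMl// (sqrtV_sqr L1); apply: h1 => //; exact/andP.
by apply: le_trans (h2 _ (sp v)); lra.
Qed.

(** The factor [exp (- a_p v_p)] decays only to the right. For [v p >= -1] one has
    [|v p| <= v p + 2], whence the constant [2 * a p]; the event will force [v p >= - L^-1]. *)
Lemma exp_majorant c1 C1 : 0 < c1 -> exists2 c, 0 < c & exists2 C, 0 < C &
  forall v X, -1 <= v p 0 -> c1 * abs_sum I (spart p v) - C1 <= X ->
  expR (- (a p 0 * v p 0)) * expR (- X) * expR (- rest I v) <= C * Phi c v.
Proof.
move=> c10; pose c := Num.min (Num.min (a p 0) c1) 1.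
have c0 : 0 < c by rewrite !lt_min ap0 c10/=.
exists c => //; exists (expR (2 * a p 0 + C1)); first exact: expR_gt0.
move=> v X v1 hX; rewrite /Phi -!expRD ler_expR (l1_split pI).
have ca : c <= a p 0 by rewrite /c !ge_min lexx.
have cc : c <= c1 by rewrite /c !ge_min lexx orbT.
have c1' : c <= 1 by rewrite /c ge_min lexx orbT.
have A0 := abs_sum_ge0 I (spart p v); have r0 := rest_ge0 I v.
have h1 : c * abs_sum I (spart p v) <= c1 * abs_sum I (spart p v) by rewrite ler_wpM2r.
have h2 : c * rest I v <= rest I v by rewrite ler_piMl.
have h3 : c * `|v p 0| <= a p 0 * v p 0 + 2 * a p 0.
  apply: le_trans (_ : a p 0 * `|v p 0| <= _); first by rewrite ler_wpM2r.
  have -> : a p 0 * v p 0 + 2 * a p 0 = a p 0 * (v p 0 + 2) by ring.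
  rewrite ler_wpM2l ?(ltW ap0)// ler_norml; apply/andP; split; lra.
lra.
Qed.

Lemma scaled_le : exists2 c, 0 < c & exists2 C, 0 < C & forall L v, 1 <= L -> -1 <= v p 0 ->
  scaled L v <= C * Phi c v /\ scaled_lim v <= C * Phi c v.
Proof.
have [c1 c10 [C1 C10 hl]] := expo_lower.
have [c c0 [C C0 hm]] := exp_majorant C1 c10.
have [D D0 hD] := gweight_le mu Ms Mp.
exists c => //; exists (D * C); first exact: mulr_gt0.
move=> L v L1 v1; have [h1 h2] := hl L v L1.
have g1 : gweight M mu (chart p I a L v) <= D * expR (- rest I v).
  apply: le_trans (hD _) _; rewrite ler_pM2l//; apply: le_trans (Phi_le_rest pI _) _.
  by rewrite rest_chart.
have g2 : gweight M mu (atstar I a v) <= D * expR (- rest I v).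
  apply: le_trans (hD _) _; rewrite ler_pM2l//; apply: le_trans (Phi_le_rest pI _) _.
  by rewrite rest_atstar.
have e0 X : 0 <= expR (- (a p 0 * v p 0)) * expR (- X) by rewrite mulr_ge0 ?expR_ge0.
split.
  apply: le_trans (_ : D * (expR (- (a p 0 * v p 0)) * expR (- expo L v) * expR (- rest I v)) <= _).
    by rewrite mulrCA ler_wpM2l.
  by rewrite -[leRHS]mulrA ler_pM2l//; exact: hm.
apply: le_trans (_ : D * (expR (- (a p 0 * v p 0)) * expR (- expo_lim v) * expR (- rest I v)) <= _).
  by rewrite mulrCA ler_wpM2l.
by rewrite -[leRHS]mulrA ler_pM2l//; exact: hm.
Qed.

(** Here the rate arises: a cubic remainder at scale [t = 1/sqrt L], multiplied by [L = t^-2], is of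
    order [t]. *)
Lemma expo_near L v : 1 <= L ->
  `|expo L v - expo_lim v| <= 40 * a p 0 * (Num.sqrt L)^-1 * (1 + l1 v) ^+ 3.
Proof.
move=> L1; have /andP[t0 t1] := sqrtV_le1 L1; have LE := sqrtV_sqr L1.
have L0 : 0 < L by exact: lt_le_trans L1.
rewrite /expo /expo_lim; set t := (Num.sqrt L)^-1 in t0 t1 LE *.
have vE : wvar I q (fun i => t * spart p v i) = t ^+ 2 * wvar I q (spart p v).
  rewrite /wvar mulrBr mulr_sumr; congr (_ - _).
    by apply: eq_bigr => i _; ring.
  rewrite -exprMn mulr_sumr; congr (_ ^+ 2); apply: eq_bigr => i _; ring.
have aE : abs_sum I (fun i => t * spart p v i) = t * abs_sum I (spart p v).
  by rewrite /abs_sum mulr_sumr; apply: eq_bigr => i _; rewrite normrM gtr0_norm.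
have := lse_gap_taylor pI q0 q1 (fun i => t * spart p v i).
rewrite vE aE; set G := lse_gap _ _ _; set V := wvar _ _ _; set A := abs_sum _ _.
have Lt : L * t ^+ 2 = 1 by rewrite -LE divff// gt_eqF.
have -> : a p 0 * (L * G) - a p 0 * (V / 2) = a p 0 * L * (G - t ^+ 2 * V / 2).
  by rewrite -[V in LHS]mul1r -Lt; ring.
move=> h; rewrite normrM ger0_norm; last by rewrite mulr_ge0 ?ltW.
apply: le_trans (_ : a p 0 * L * (40 * (t * A) ^+ 3) <= _).
  by rewrite ler_wpM2l// mulr_ge0 ?ltW.
have -> : a p 0 * L * (40 * (t * A) ^+ 3) = 40 * a p 0 * t * (L * t ^+ 2) * A ^+ 3 by ring.
rewrite Lt mulr1 ler_wpM2l ?mulr_ge0 ?(ltW t0) ?(ltW ap0)//.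
have A0 : 0 <= A by exact: abs_sum_ge0.
rewrite lerXn2r ?nnegrE ?addr_ge0 ?l1_ge0// (l1_split pI) -/A.
have := rest_ge0 I v; have := normr_ge0 (v p 0); lra.
Qed.

(** Product rule over the exponent and the Gaussian weight. Both errors carry at most
    [(1 + l1 v)^3], which [poly_exp_le] absorbs by halving the decay of [Phi]. *)
Lemma scaled_near : exists2 c, 0 < c & exists2 C, 0 < C & forall L v, 1 <= L -> 0 <= v p 0 ->
  `|scaled L v - scaled_lim v| <= C * (Num.sqrt L)^-1 * Phi c v.
Proof.
have [c1 c10 [C1 C10 hl]] := expo_lower.
have [c c0 [C C0 hm]] := exp_majorant C1 c10.
have [D D0 hD] := gweight_le mu Ms Mp.
have [E E0 hE] := gweight_lip mu Ms.
have [F F0 hF] := poly_exp_le 3 c0.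
set w := l1 (vstar I a); have w0 : 0 <= w by exact: l1_ge0.
pose C2 := 40 * a p 0 * D + E * 2 * (4 + 2 * w) * (2 * D).
have C20 : 0 < C2.
  by rewrite ltr_pwDl ?mulr_gt0// !mulr_ge0// ?ltW// ltr_pwDl// mulr_ge0.
exists (c / 2); first by rewrite divr_gt0.
exists (C2 * (2 * C) * F); first by rewrite !mulr_gt0.
move=> L v L1 v0; have [h1 h2] := hl L v L1.
have v1 : -1 <= v p 0 by apply: le_trans v0; rewrite oppr_le0.
have /andP[t0 t1] := sqrtV_le1 L1.
have g1 : gweight M mu (chart p I a L v) <= D * expR (- rest I v).
  apply: le_trans (hD _) _; rewrite ler_pM2l//; apply: le_trans (Phi_le_rest pI _) _.
  by rewrite rest_chart.
have g2 : gweight M mu (atstar I a v) <= D * expR (- rest I v).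
  apply: le_trans (hD _) _; rewrite ler_pM2l//; apply: le_trans (Phi_le_rest pI _) _.
  by rewrite rest_atstar.
have g10 := gweight_ge0 M mu (chart p I a L v).
have := hE (chart p I a L v) (atstar I a v).
have := chart_near pI ap0 aneg aoff S0 v L1.
have := l1_chart pI ap0 aneg aoff S0 v L1.
have := l1_atstar I a v.
have := expo_near v L1.
have := expRN_lip (expo L v) (expo_lim v).
have := hm v (expo L v) v1 h1; have := hm v (expo_lim v) v1 h2.
rewrite /scaled /scaled_lim -/w.
move: g1 g2 g10.
set G1 := gweight _ _ (chart _ _ _ _ _); set G2 := gweight _ _ (atstar _ _ _).
set eA := expR (- expo L v); set eB := expR (- expo_lim v); set er := expR (- rest I v).
set ev := expR (- (a p 0 * v p 0)); set l := l1 v.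
set x1 := l1 (chart _ _ _ _ _); set x2 := l1 (atstar _ _ _); set x3 := l1 (_ - _).
set t := (Num.sqrt L)^-1 in t0 t1 *.
have eA0 : 0 <= eA := expR_ge0 _; have eB0 : 0 <= eB := expR_ge0 _.
have er0 : 0 <= er := expR_ge0 _; have ev0 : 0 <= ev := expR_ge0 _.
have l0 : 0 <= l := l1_ge0 _.
have x30 : 0 <= x3 := l1_ge0 _; have x10 : 0 <= x1 := l1_ge0 _; have x20 : 0 <= x2 := l1_ge0 _.
move=> G1r G2r G10 mB mA eAB xAB hx2 hx1 hx3 G12.
set l' := 1 + l; have l'1 : 1 <= l' by rewrite lerDl.
have l'0 : 0 <= l' by exact: le_trans ler01 l'1.
have dA : `|eA - eB| * G1 <= (40 * a p 0 * D) * t * l' ^+ 3 * ((eA + eB) * er).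
  apply: le_trans (_ : (40 * a p 0 * t * l' ^+ 3 * (eA + eB)) * (D * er) <= _).
    rewrite ler_pM// (le_trans eAB)// ler_wpM2r ?addr_ge0//.
  by rewrite le_eqVlt; apply/orP; left; apply/eqP; ring.
have dG : `|G1 - G2| <= (E * 2 * (4 + 2 * w) * (2 * D)) * t * l' ^+ 3 * er.
  apply: le_trans G12 _.
  have s1 : G1 + G2 <= 2 * D * er by lra.
  have s2 : 1 + x1 + x2 <= (4 + 2 * w) * l'.
    have : 0 <= w * l by rewrite mulr_ge0.
    by rewrite /l'; nra.
  have s3 : x3 <= 2 * t * l'.
    by apply: le_trans hx3 _; rewrite ler_wpM2l ?mulr_ge0 ?(ltW t0)// lerDr.
  apply: le_trans (_ : E * (2 * t * l') * ((4 + 2 * w) * l') * (2 * D * er) <= _).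
    rewrite ler_pM//.
    - by rewrite !mulr_ge0 ?(ltW E0)// !addr_ge0.
    - by rewrite addr_ge0// gweight_ge0.
    - by rewrite ler_pM ?mulr_ge0 ?(ltW E0) ?addr_ge0// ler_pM2l.
  have -> : E * (2 * t * l') * ((4 + 2 * w) * l') * (2 * D * er) =
     (E * 2 * (4 + 2 * w) * (2 * D) * t * er) * l' ^+ 2 by ring.
  have -> : E * 2 * (4 + 2 * w) * (2 * D) * t * l' ^+ 3 * er =
     (E * 2 * (4 + 2 * w) * (2 * D) * t * er) * l' ^+ 3 by ring.
  rewrite ler_wpM2l//; last by rewrite exprS ler_peMl// sqr_ge0.
  by rewrite !mulr_ge0 ?(ltW E0) ?(ltW D0) ?(ltW t0)// addr_ge0// mulr_ge0.
have key : `|eA * G1 - eB * G2| <= C2 * t * l' ^+ 3 * ((eA + eB) * er).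
  have -> : eA * G1 - eB * G2 = (eA - eB) * G1 + eB * (G1 - G2) by ring.
  apply: le_trans (ler_normD _ _) _; rewrite !normrM (ger0_norm G10) (ger0_norm eB0).
  have : eB * `|G1 - G2| <= (E * 2 * (4 + 2 * w) * (2 * D)) * t * l' ^+ 3 * ((eA + eB) * er).
    apply: le_trans (_ : (eA + eB) * ((E * 2 * (4 + 2 * w) * (2 * D)) * t * l' ^+ 3 * er) <= _).
      by rewrite ler_pM// lerDr.
    by rewrite le_eqVlt; apply/orP; left; apply/eqP; ring.
  move: dA; rewrite /C2; set k1 := 40 * a p 0 * D; set k2 := E * 2 * _ * _.
  by rewrite !mulrDl; lra.
have -> : ev * eA * G1 - ev * eB * G2 = ev * (eA * G1 - eB * G2) by ring.
rewrite normrM (ger0_norm ev0).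
apply: le_trans (_ : C2 * t * l' ^+ 3 * (ev * eA * er + ev * eB * er) <= _).
  rewrite -[ev * eA * er + _]/(_) (_ : ev * eA * er + ev * eB * er = ev * ((eA + eB) * er)); last by ring.
  by rewrite mulrCA ler_wpM2l.
apply: le_trans (_ : C2 * t * l' ^+ 3 * (2 * C * Phi c v) <= _).
  rewrite ler_wpM2l ?mulr_ge0 ?exprn_ge0 ?(ltW C20) ?(ltW t0)//; lra.
have := hF l l0; rewrite -/l' => hFl.
have -> : C2 * t * l' ^+ 3 * (2 * C * Phi c v) = C2 * (2 * C) * t * (l' ^+ 3 * Phi c v) by ring.
have -> : C2 * (2 * C) * F * t * Phi (c / 2) v = C2 * (2 * C) * t * (F * Phi (c / 2) v) by ring.
by rewrite ler_wpM2l// !mulr_ge0 ?(ltW C20) ?(ltW C0) ?(ltW t0).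
Qed.

End laplace_pointwise.

(** * The event in rescaled coordinates *)

Section laplace_region.
Variables (R : realType) (n : nat) (p : 'I_n) (I : {set 'I_n}) (a : 'cV[R]_n).
Hypotheses (pI : p \in I) (ap0 : 0 < a p 0).
Hypothesis aneg : forall i, i \in I -> i != p -> a i 0 < 0.
Hypothesis aoff : forall i, i \notin I -> a i 0 = 0.
Hypothesis S0 : 0 < \sum_i a i 0.
Variables (M : 'M[R]_n) (mu : 'cV[R]_n).
Hypotheses (Ms : M^T = M) (Mp : posdef M).
Variables (ys : 'cV[R]_n) (pos : pred 'I_n) (eps : R).
Hypotheses (eps0 : 0 < eps) (posp : pos p).
Hypothesis posI : forall i, i \in I -> i != p -> ~~ pos i.
Hypothesis ysI : forall i, i \in I -> ys i 0 = 1.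
Hypothesis ysC : forall i, i \notin I -> ys i 0 + 2 * eps <= 1.
Implicit Types (v u : 'cV[R]_n) (L : R).

Definition in_cube L v := [forall i, `|v i 0| <= eps * L].

Definition exp_diff (u : 'cV[R]_n) : R :=
  \sum_(i | pos i) expR (u i 0) - \sum_(i | ~~ pos i) expR (u i 0).

Definition exceeds L v := expR L <= exp_diff (L *: ys + v).

(** The coordinates off [I], divided by [exp L]. The gap [2 * eps] of the peak minus the radius
    [eps] of the cube leaves each of them at most [exp (- eps L)]. *)
Definition remainder L v : R :=
  \sum_(i | (i \notin I) && pos i) expR (L * (ys i 0 - 1) + v i 0) -
  \sum_(i | (i \notin I) && ~~ pos i) expR (L * (ys i 0 - 1) + v i 0).

Lemma exp_diff_shift L v : exp_diff (L *: ys + v) =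
  expR L * (expR (v p 0) - \sum_(i in I :\ p) expR (v i 0) + remainder L v).
Proof.
have e i : expR ((L *: ys + v) i 0) = expR L * expR (L * (ys i 0 - 1) + v i 0).
  by rewrite -expRD !mxE; congr expR; ring.
have eI i : i \in I -> expR ((L *: ys + v) i 0) = expR L * expR (v i 0).
  by move=> iI; rewrite e ysI// subrr mulr0 add0r.
rewrite /exp_diff (bigID (mem I))/= [X in _ - X](bigID (mem I))/=.
have -> : \sum_(i | pos i && (i \in I)) expR ((L *: ys + v) i 0) = expR L * expR (v p 0).
  rewrite (bigD1 p) ?posp//= big1 ?addr0 ?eI//.
  by move=> i /andP[/andP[pi iI] ip]; rewrite (negbTE (posI iI ip)) in pi.
have -> : \sum_(i | ~~ pos i && (i \in I)) expR ((L *: ys + v) i 0) =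
    expR L * \sum_(i in I :\ p) expR (v i 0).
  rewrite mulr_sumr; apply: eq_big => [i|i /andP[_ /eI//]].
  rewrite !inE; have [->|ip]/= := eqVneq i p; first by rewrite posp.
  by case iI: (i \in I); rewrite ?andbF// posI.
have rE (P : pred 'I_n) : \sum_(i | P i && (i \notin I)) expR ((L *: ys + v) i 0) =
    expR L * \sum_(i | (i \notin I) && P i) expR (L * (ys i 0 - 1) + v i 0).
  by rewrite mulr_sumr; apply: eq_big => [i|i _]; [rewrite andbC|rewrite e].
rewrite (rE pos) (rE (fun i => ~~ pos i)) /remainder; ring.
Qed.

Lemma remainder_small L v : 0 <= L -> in_cube L v -> `|remainder L v| <= n%:R * expR (- (eps * L)).
Proof.
move=> L0 /forallP vC.
apply: le_trans (ler_normB _ _) _.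
rewrite !ger0_norm; try by apply: sumr_ge0 => i _; exact: expR_ge0.
have -> : n%:R * expR (- (eps * L)) = \sum_(i < n) expR (- (eps * L)).
  by rewrite sumr_const card_ord mulr_natl.
apply: le_trans (_ : \sum_(i | i \notin I) expR (- (eps * L)) <= _); last first.
  by rewrite [leRHS](bigID (fun i => i \notin I))/= lerDl sumr_ge0// => i _; exact: expR_ge0.
rewrite [leRHS](bigID pos)/=.
have b i : i \notin I -> expR (L * (ys i 0 - 1) + v i 0) <= expR (- (eps * L)).
  move=> /ysC h; rewrite ler_expR; have := vC i; rewrite ler_norml => /andP[_ h2]; nra.
by apply: lerD; apply: ler_sum => i /andP[iI _]; exact: b.
Qed.

(** In the chart the boundary would be exactly [v p = 0] if the remainder vanished. *)
Lemma exceeds_chart L v : 1 <= L -> let u := chart p I a L v in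
  exceeds L u = (0 <= cone p I u * (expR (L^-1 * v p 0) - 1) + remainder L u).
Proof.
move=> L1 u; rewrite /exceeds exp_diff_shift -{1}[expR L]mulr1 ler_pM2l ?expR_gt0//.
have -> : expR (u p 0) = expR (L^-1 * v p 0) * cone p I u.
  by rewrite /u chartp expRD lnK ?posrE ?cone_gt0// cone_chart.
rewrite -subr_ge0; congr (0 <= _); rewrite /cone; ring.
Qed.

Section large.
Variable L : R.
Hypotheses (L1 : 1 <= L) (Lbig : 2 * n%:R * L ^+ 2 <= expR (eps * L)).

Let L0 : 0 < L. Proof. exact: lt_le_trans L1. Qed.

Let rem_le v : in_cube L v -> `|remainder L v| <= (2 * L ^+ 2)^-1.
Proof.
move=> vC; apply: le_trans (remainder_small (ltW L0) vC) _.
rewrite expRN ler_pdivrMr ?expR_gt0// ler_pdivlMl ?mulr_gt0 ?exprn_gt0//.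
by apply: le_trans Lbig; rewrite mulrAC.
Qed.

(** As [cone >= 1], a value [v p < - L^-1] makes the main part smaller than [- 1 / (2 L^2)], beyond
    what the remainder can compensate. With [exceeds_upper], the event inside the cube is the
    half-space [0 <= v p] up to the slab [|v p| <= L^-1]. *)
Lemma exceeds_lower v : in_cube L (chart p I a L v) -> exceeds L (chart p I a L v) ->
  - L^-1 <= v p 0.
Proof.
move=> /rem_le; rewrite exceeds_chart// ler_norml => /andP[_ hr] h.
rewrite leNgt; apply/negP => vp.
have c1 := cone_ge1 p I (chart p I a L v).
set x := (L ^+ 2)^-1; have x0 : 0 < x by rewrite invr_gt0 exprn_gt0.
have x1 : x <= 1 by rewrite invf_le1 ?exprn_gt0// exprn_ege1.
have xE : (2 * L ^+ 2)^-1 = x / 2 by rewrite /x invfM mulrC.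
have e1 : expR (L^-1 * v p 0) < expR (- x).
  by rewrite ltr_expR /x expr2 invfM -mulrN ltr_pM2l ?invr_gt0.
have e2 : expR (- x) <= 1 - x / 2.
  rewrite expRN -[leLHS]mul1r ler_pdivrMr ?expR_gt0//.
  have := expR_ge1Dx x; nra.
set e := expR _ in h e1; move: h; rewrite xE in hr; set c := cone _ _ _ in c1 *.
set r := remainder _ _ in hr *; move=> h.
have : e - 1 < - (x / 2) by lra.
nra.
Qed.

Lemma exceeds_upper v : in_cube L (chart p I a L v) -> L^-1 <= v p 0 ->
  exceeds L (chart p I a L v).
Proof.
move=> /rem_le; rewrite exceeds_chart// ler_norml => /andP[hr _] vp.
have c1 := cone_ge1 p I (chart p I a L v).
set x := (L ^+ 2)^-1; have x0 : 0 < x by rewrite invr_gt0 exprn_gt0.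
have xE : (2 * L ^+ 2)^-1 = x / 2 by rewrite /x invfM mulrC.
have e1 : 1 + x <= expR (L^-1 * v p 0).
  apply: le_trans (expR_ge1Dx _); rewrite lerD2l /x expr2 invfM ler_pM2l ?invr_gt0//.
set e := expR _ in e1 *; rewrite xE in hr; set c := cone _ _ _ in c1 *.
set r := remainder _ _ in hr *; nra.
Qed.

End large.

Lemma large_exists : exists2 L0, 1 <= L0 & forall L, L0 <= L -> 2 * n%:R * L ^+ 2 <= expR (eps * L).
Proof.
have [C C0 h] := poly_exp_le 3 eps0.
exists (1 + 2 * n%:R * C); first by rewrite lerDl !mulr_ge0// ltW.
move=> L hL; have nC : 0 <= 2 * n%:R * C by rewrite !mulr_ge0// ltW.
have L1 : 1 <= L by lra.
have L0 : 0 <= L by lra.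
have : (1 + L) ^+ 3 <= C * expR (eps * L).
  have := h L L0; rewrite mulNr expRN ler_pdivrMr ?expR_gt0// => {}h.
  apply: le_trans h _; rewrite ler_wpM2r ?expR_ge0// ler_piMr ?(ltW C0)//.
  by rewrite -[leRHS]expR0 ler_expR mulNr oppr_le0 mulr_ge0// divr_ge0// ltW.
move=> h2.
have h3 : L * L ^+ 2 <= (1 + L) ^+ 3.
  by rewrite -exprS lerXn2r ?nnegrE// ?addr_ge0// lerDr.
have h4 : 2 * n%:R * C * L ^+ 2 <= L * L ^+ 2 by rewrite ler_wpM2r ?sqr_ge0//; lra.
have : C * (2 * n%:R * L ^+ 2) <= C * expR (eps * L).
  by apply: le_trans h2; apply: le_trans h3; apply: le_trans h4; rewrite le_eqVlt; apply/orP; left; apply/eqP; ring.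
by rewrite ler_pM2l.
Qed.

Definition local_part L v :=
  if in_cube L v && exceeds L v then expR (- (L * dots a v)) * gweight M mu v else 0.

Definition local_scaled L v :=
  if in_cube L (chart p I a L v) && exceeds L (chart p I a L v) then scaled p I a M mu L v else 0.

Definition local_lim v := if 0 <= v p 0 then scaled_lim p I a M mu v else 0.

Lemma local_chart L v : 1 <= L -> local_part L (chart p I a L v) =
  expR (- (L * dots a (vstar I a))) * local_scaled L v.
Proof.
move=> L1; rewrite /local_part /local_scaled; case: ifP => _; last by rewrite mulr0.
rewrite /scaled mulrA; congr (_ * _); rewrite -!expRD; congr expR.
rewrite (dots_chart pI ap0 aneg aoff S0) /expo; field.
by rewrite gt_eqF// (lt_le_trans ltr01).
Qed.

Definition tail_l1 v := \sum_(i | i != p) `|v i 0|.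

(** The second error term does not decay pointwise: in the slab the two integrands may differ by
    their full size, and the factor [1/L] comes only from integrating over its width. *)
Lemma local_near : exists2 c, 0 < c & exists2 C, 0 < C & exists2 L0, 1 <= L0 &
  forall L v, L0 <= L -> `|local_scaled L v - local_lim v| <=
   C * (Num.sqrt L)^-1 * Phi c v +
   (if `|v p 0| <= L^-1 then C else 0) * expR (- c * tail_l1 v).
Proof.
have [c1 c10 [C1 C10 h1]] := scaled_le pI ap0 aneg aoff S0 mu Ms Mp.
have [c2 c20 [C2 C20 h2]] := scaled_near pI ap0 aneg aoff S0 mu Ms Mp.
have [F F0 hF] := poly_exp_le 1 c10.
have [L0 L01 hL0] := large_exists.
set w := l1 (vstar I a); have w0 : 0 <= w by exact: l1_ge0.
pose c := Num.min (c1 / 2) c2.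
have c0 : 0 < c by rewrite lt_min divr_gt0.
pose C3 := C1 * F * (3 + w) / eps.
have C30 : 0 < C3 by rewrite divr_gt0// !mulr_gt0// ltr_pwDl.
exists c => //; exists (2 * C1 + C2 + C3); first by rewrite !addr_gt0// mulr_gt0.
exists L0 => // L v LL; have L1 : 1 <= L by exact: le_trans LL.
have Lp : 0 < L by exact: lt_le_trans L1.
have Li : 0 < L^-1 by rewrite invr_gt0.
have Li1 : L^-1 <= 1 by rewrite invf_le1.
have /andP[t0 t1] := sqrtV_le1 L1.
have P0 := Phi_ge0 c v.
have sc0 : 0 <= scaled p I a M mu L v by rewrite !mulr_ge0 ?expR_ge0// gweight_ge0.
have sl0 : 0 <= scaled_lim p I a M mu v by rewrite !mulr_ge0 ?expR_ge0// gweight_ge0.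
have A0 : 0 <= (2 * C1 + C2 + C3) * (Num.sqrt L)^-1 * Phi c v.
  by rewrite !mulr_ge0 ?(ltW t0)//; lra.
have T0 : 0 <= expR (- c * tail_l1 v) by exact: expR_ge0.
rewrite /local_scaled /local_lim.
have [vs|vb] := leP `|v p 0| L^-1.
  move: (vs); rewrite ler_norml => /andP[v1 v2].
  have vm1 : -1 <= v p 0 by apply: le_trans v1; rewrite lerN2.
  have [b1 b2] := h1 L v L1 vm1.
  have Pt : Phi c1 v <= expR (- c * tail_l1 v).
    rewrite ler_expR !mulNr lerN2 /l1 (bigD1 p)//= -/(tail_l1 v).
    have tl0 : 0 <= tail_l1 v by exact: sumr_ge0.
    have : c <= c1 by rewrite /c ge_min; apply/orP; left; lra.
    by have := normr_ge0 (v p 0); nra.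
  apply: le_trans (_ : (2 * C1 + C2 + C3) * expR (- c * tail_l1 v) <= _); last by rewrite lerDr.
  apply: le_trans (_ : 2 * C1 * Phi c1 v <= _); last first.
    rewrite ler_pM ?mulr_ge0 ?Phi_ge0 ?(ltW C10)//; lra.
  apply: le_trans (ler_normB _ _) _.
  have P10 : 0 <= C1 * Phi c1 v by rewrite mulr_ge0 ?Phi_ge0// ltW.
  have -> : 2 * C1 * Phi c1 v = C1 * Phi c1 v + C1 * Phi c1 v by ring.
  by apply: lerD; case: ifP => _; rewrite ?normr0// ger0_norm.
rewrite mul0r addr0.
have [vp|vn] := leP 0 (v p 0); last first.
  rewrite ifF ?subrr ?normr0//; apply/negP => /andP[vC vR].
  have := exceeds_lower L1 (hL0 _ LL) vC vR.
  by move: vb; rewrite ltr0_norm//; lra.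
move: vb; rewrite ger0_norm// => vb.
have vm1 : -1 <= v p 0 by apply: le_trans vp; rewrite oppr_le0.
case: (boolP (in_cube L (chart p I a L v))) => /= [vC|].
  rewrite (exceeds_upper L1 (hL0 _ LL) vC (ltW vb)).
  apply: le_trans (h2 L v L1 vp) _.
  rewrite ler_pM ?mulr_ge0 ?Phi_ge0 ?(ltW C20) ?(ltW t0)//.
    by rewrite ler_wpM2r ?(ltW t0)//; lra.
  by apply: Phi_le; rewrite /c ge_min lexx orbT.
(* Outside the cube only the limit survives, and there [1 + l1 v] is at least of order [L]: a factor
   [L^-1] is gained at the price of half the decay of [Phi]. *)
rewrite negb_forall => /existsP[i]; rewrite -ltNge => ui.
rewrite sub0r normrN ger0_norm//.
have [_ b2] := h1 L v L1 vm1.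
have ul : eps * L <= l1 (chart p I a L v).
  apply: le_trans (ltW ui) _; rewrite /l1 (bigD1 i)//= lerDl sumr_ge0//.
have := l1_chart pI ap0 aneg aoff S0 v L1; rewrite -/w => ul2.
set l := l1 v in ul2; have l0 : 0 <= l := l1_ge0 v.
have := hF l l0; rewrite expr1 => hl.
have k1 : eps * L <= (3 + w) * (1 + l).
  have : 0 <= w * l by exact: mulr_ge0. 
  nra.
have tL : L^-1 <= (Num.sqrt L)^-1.
  by rewrite (sqrtV_sqr L1) expr2 ler_piMl// ltW.
have P1 : 0 <= Phi c1 v by exact: Phi_ge0.
have k2 : Phi c1 v <= (3 + w) / eps * L^-1 * ((1 + l) * Phi c1 v).
  have -> : (3 + w) / eps * L^-1 * ((1 + l) * Phi c1 v) =
      ((3 + w) * (1 + l) / (eps * L)) * Phi c1 v by field; rewrite !gt_eqF.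
  by rewrite ler_peMl// ler_pdivlMr ?mulr_gt0// mul1r.
have k3 : C1 * Phi c1 v <= C3 * L^-1 * Phi (c1 / 2) v.
  have -> : C3 * L^-1 * Phi (c1 / 2) v = C1 * ((3 + w) / eps * L^-1 * (F * Phi (c1 / 2) v)).
    by rewrite /C3; ring.
  rewrite ler_pM2l//; apply: le_trans k2 _; rewrite ler_wpM2l//.
  by rewrite !mulr_ge0 ?invr_ge0 ?addr_ge0// ltW.
apply: le_trans b2 _; apply: le_trans k3 _.
have m1 : C3 * L^-1 <= (2 * C1 + C2 + C3) * (Num.sqrt L)^-1.
  by apply: ler_pM => //; [exact: ltW|exact: ltW|lra].
apply: ler_pM => //; [by rewrite mulr_ge0 ?(ltW C30) ?(ltW Li)|exact: Phi_ge0|].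
by apply: Phi_le; rewrite /c ge_min lexx.
Qed.

End laplace_region.

Section laplace_integral.
Variables (R : realType) (n : nat) (p : 'I_n) (I : {set 'I_n}) (a : 'cV[R]_n).
Hypotheses (pI : p \in I) (ap0 : 0 < a p 0).
Hypothesis aneg : forall i, i \in I -> i != p -> a i 0 < 0.
Hypothesis aoff : forall i, i \notin I -> a i 0 = 0.
Hypothesis S0 : 0 < \sum_i a i 0.
Variables (M : 'M[R]_n) (mu : 'cV[R]_n).
Hypotheses (Ms : M^T = M) (Mp : posdef M).
Variables (ys : 'cV[R]_n) (pos : pred 'I_n) (eps : R).
Hypotheses (eps0 : 0 < eps) (posp : pos p).
Hypothesis posI : forall i, i \in I -> i != p -> ~~ pos i.
Hypothesis ysI : forall i, i \in I -> ys i 0 = 1.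
Hypothesis ysC : forall i, i \notin I -> ys i 0 + 2 * eps <= 1.
Implicit Types (v u : 'cV[R]_n) (L : R).

Local Notation lpart := (local_part a M mu ys pos eps).
Local Notation lscaled := (local_scaled p I a M mu ys pos eps).
Local Notation llim := (local_lim p I a M mu).

Lemma mcV_exp_diff (c : 'cV[R]_n) : mcV ((fun v => exp_diff pos (c + v)) : _ -> measurableTypeR R).
Proof.
have m i : mcV ((fun v => expR ((c + v) i 0)) : _ -> measurableTypeR R).
  apply: measurableT_comp => //; under eq_fun do rewrite !mxE.
  by apply: measurable_funD => //; exact: measurable_coord.
apply: measurable_funB.
  exact: (@mcV_sum _ _ _ _ _ (fun i v => expR ((c + v) i 0)) m).
exact: (@mcV_sum _ _ _ _ _ (fun i v => expR ((c + v) i 0)) m).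
Qed.

Lemma mcV_dots : mcV (dots a : _ -> measurableTypeR R).
Proof.
apply: (@mcV_sum _ _ _ _ _ (fun i (v : 'cV[R]_n) => a i 0 * v i 0)) => i.
by apply: measurable_funM => //; exact: measurable_coord.
Qed.

Lemma mcV_local L : mcV (lpart L : _ -> measurableTypeR R).
Proof.
apply: measurable_fun_ifT.
- apply: measurable_and.
    apply: (@mcV_forall _ _ _ (fun i (v : 'cV[R]_n) => `|v i 0| <= eps * L)) => i.
    apply: measurable_fun_ler => //.
    by apply: measurableT_comp => //; exact: measurable_coord.
  by apply: measurable_fun_ler => //; exact: mcV_exp_diff.
- apply: measurable_funM; last exact: mcV_gweight.
  apply: measurableT_comp => //; apply: measurableT_comp => //.
  by apply: measurable_funM => //; exact: mcV_dots.
- exact: measurable_cst.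
Qed.

Lemma mcV_ln_cone : mcV ((fun v => ln (cone p I v)) : _ -> measurableTypeR R).
Proof.
apply: (measurableT_comp (@measurable_ln R)); apply: measurable_funD => //.
apply: (@mcV_sum _ _ _ _ _ (fun i (v : 'cV[R]_n) => expR (v i 0))) => i.
by apply: measurableT_comp => //; exact: measurable_coord.
Qed.

Lemma mcV_widen t i : mcV ((fun v => widen p I a t v i 0) : _ -> measurableTypeR R).
Proof.
rewrite /mcV; under eq_fun do rewrite mxE.
by apply: measurable_funD => //; apply: measurable_funM => //; exact: measurable_coord.
Qed.

Lemma mcV_chart L i : mcV ((fun v => chart p I a L v i 0) : _ -> measurableTypeR R).
Proof.
rewrite /mcV; under eq_fun do rewrite updE.
case: (i == p); last exact: mcV_widen.
apply: measurable_funD; first by apply: measurable_funM => //; exact: measurable_coord.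
exact: (mcV_comp mcV_ln_cone (mcV_widen _)).
Qed.

Lemma prod_widen t : \prod_i (if i \in I :\ p then t else 1) = t ^+ #|I :\ p| :> R.
Proof. by rewrite -big_mkcond/= prodr_const. Qed.

(** The chart is a diagonal scaling followed by a shear of coordinate [p], since [cone] does not
    depend on that coordinate; the Jacobian is the product of the scales. *)
Lemma J_chart L (F : 'cV[R]_n -> \bar R) : 1 <= L -> mcV F -> (forall v, (0 <= F v)%E) ->
  J F = ((L^-1 * (Num.sqrt L)^-1 ^+ #|I :\ p|)%:E * J (fun v => F (chart p I a L v)))%E.
Proof.
move=> L1 mF F0; have /andP[t0 _] := sqrtV_le1 L1.
have Li : 0 < L^-1 by rewrite invr_gt0 (lt_le_trans ltr01).
have lnc v t : ln (cone p I (upd v p t)) = ln (cone p I v).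
  congr (ln (_ + _)); apply: eq_bigr => i /setD1P[/negbTE ip _].
  by rewrite updE ip.
have -> := J_upd Li mF F0 mcV_ln_cone lnc.
rewrite EFinM -muleA; congr (_ * _)%E.
pose F1 (w : 'cV[R]_n) := F (upd w p (L^-1 * w p ord0 + ln (cone p I w))).
have mF1 : mcV F1.
  apply: mcV_upd => //; apply: measurable_funD; last exact: mcV_ln_cone.
  by apply: measurable_funM => //; exact: measurable_coord.
rewrite -[J _]/(J F1) (@J_affine _ _ (fun i => if i \in I :\ p then (Num.sqrt L)^-1 else 1)
   (fun i => if i \in I :\ p then vstar I a i 0 else 0) F1)//;
  [|by move=> i; case: (i \in I :\ p)|by move=> v; exact: F0].
rewrite prod_widen; congr (_ * _)%E; apply: eq_J => v; rewrite /F1; congr F.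
rewrite /chart; congr (upd _ _ (_ * _ + _)).
by rewrite [LHS]mxE !inE eqxx/= mul1r addr0.
Qed.

Lemma mcV_local_scaled L : 1 <= L -> mcV (lscaled L : _ -> measurableTypeR R).
Proof.
move=> L1; have e0 := expR_gt0 (- (L * dots a (vstar I a))).
have E : lscaled L = fun v => (expR (- (L * dots a (vstar I a))))^-1 * lpart L (chart p I a L v).
  apply/funext => v; rewrite (local_chart pI ap0 aneg aoff S0)// mulrA mulVf ?mul1r// gt_eqF//.
rewrite E; apply: measurable_funM => //.
exact: (mcV_comp (mcV_local L) (mcV_chart L)).
Qed.

Lemma mcV_local_lim : mcV (llim : _ -> measurableTypeR R).
Proof.
have ms i : mcV ((fun v => spart p v i) : _ -> measurableTypeR R).
  rewrite /mcV /spart; case: (i == p); first exact: measurable_cst.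
  exact: measurable_coord.
have mt (f : 'I_n -> 'cV[R]_n -> R) : (forall i, mcV (f i : _ -> measurableTypeR R)) ->
   mcV ((fun v => \sum_(i in I) f i v) : _ -> measurableTypeR R).
  by move=> mf; exact: mcV_sum.
apply: measurable_fun_ifT => //.
  by apply: measurable_fun_ler => //; exact: measurable_coord.
apply: measurable_funM; last first.
  apply: (mcV_comp (mcV_gweight M mu)) => i; rewrite /mcV; under eq_fun do rewrite mxE.
  case: (i \in I); [exact: measurable_cst|exact: measurable_coord].
apply: measurable_funM.
  apply: measurableT_comp => //; apply: measurableT_comp => //; apply: measurable_funM => //.
  exact: measurable_coord.
apply: measurableT_comp => //; apply: measurableT_comp => //; apply: measurable_funM => //.
apply: measurable_funM => //; apply: measurable_funB.
  apply: (mt (fun i v => softw p a i * spart p v i ^+ 2)) => i.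
  apply: measurable_funM => //; apply: measurable_funX; exact: ms.
apply: measurable_funX; apply: (mt (fun i v => softw p a i * spart p v i)) => i.
apply: measurable_funM => //; exact: ms.
Qed.

End laplace_integral.

(** * The integrated Laplace expansion *)

Section laplace_expansion.
Variables (R : realType) (n : nat) (p : 'I_n) (I : {set 'I_n}) (a : 'cV[R]_n).
Hypotheses (pI : p \in I) (ap0 : 0 < a p 0).
Hypothesis aneg : forall i, i \in I -> i != p -> a i 0 < 0.
Hypothesis aoff : forall i, i \notin I -> a i 0 = 0.
Hypothesis S0 : 0 < \sum_i a i 0.
Variables (M : 'M[R]_n) (mu : 'cV[R]_n).
Hypotheses (Ms : M^T = M) (Mp : posdef M).
Variables (ys : 'cV[R]_n) (pos : pred 'I_n) (eps : R).
Hypotheses (eps0 : 0 < eps) (posp : pos p).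
Hypothesis posI : forall i, i \in I -> i != p -> ~~ pos i.
Hypothesis ysI : forall i, i \in I -> ys i 0 = 1.
Hypothesis ysC : forall i, i \notin I -> ys i 0 + 2 * eps <= 1.
Implicit Types (v u : 'cV[R]_n) (L : R).

Local Notation lpart := (local_part a M mu ys pos eps).
Local Notation lscaled := (local_scaled p I a M mu ys pos eps).
Local Notation llim := (local_lim p I a M mu).

Lemma integral_slab (C d : R) : 0 <= C -> 0 <= d ->
  (\int[@lebesgue_measure R]_t (if `|t| <= d then C else 0)%:E = (2 * C * d)%:E)%E.
Proof.
move=> C0 d0.
transitivity (\int[@lebesgue_measure R]_(t in `[(- d)%R, d]%classic) (C%:E))%E.
  rewrite [RHS]integral_mkcond; apply: eq_integral => t _.
  rewrite patchE; case: ifPn => td; case: ifPn => // tm; exfalso.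
    by move/negP: tm; apply; rewrite inE/= in_itv/= -ler_norml.
  by move: tm; rewrite inE/= in_itv/= -ler_norml (negbTE td).
rewrite integral_cst//= lebesgue_measure_itv/= lte_fin.
case: ifPn => h; first by rewrite -EFinB -EFinM; congr EFin; ring.
have -> : d = 0 by move: h; rewrite -leNgt; lra.
by rewrite mulr0 mule0.
Qed.

(** The slab term becomes a multiple of [Phi], with the width [d] as an explicit factor. *)
Lemma J_slab c C : 0 < c -> 0 <= C -> exists2 k, 0 < k & forall d, 0 <= d ->
  J (fun v => ((if `|v p 0| <= d then C else 0) * expR (- c * tail_l1 p v))%:E) =
  J (fun v : 'cV[R]_n => (2 * C * d / k * Phi c v)%:E).
Proof.
move=> c0 C0; have [k k0 kE] := integral_exp_abs c0; exists k; [exact: k0|move=> d d0].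
have x0 : 0 <= 2 * C * d / k by rewrite divr_ge0 ?mulr_ge0// ltW.
rewrite (@J_swap_coord _ _ p (fun t => if `|t| <= d then C else 0)
   (fun t => 2 * C * d / k * expR (- c * `|t|)) (fun v => expR (- c * tail_l1 p v))).
- apply: eq_J => v; congr EFin; rewrite /= -[LHS]mulrA -expRD; congr (_ * expR _).
  by rewrite -mulrDr [in RHS]/l1 (bigD1 p).
- apply: measurable_fun_ifT => //; apply: measurable_fun_ler => //.
- by apply: measurable_funM => //; exact: measurable_exp_abs.
- by move=> t; case: ifP.
- by move=> t; rewrite mulr_ge0 ?expR_ge0.
- rewrite integral_slab//; under eq_integral do rewrite EFinM.
  rewrite ge0_integralZl//.
  + by rewrite kE -EFinM divfK// gt_eqF.
  + by apply/measurable_EFinP; exact: measurable_exp_abs.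
- apply: measurableT_comp => //; apply: measurable_funM => //.
  apply: (@mcV_sum _ _ _ _ _ (fun i (v : 'cV[R]_n) => `|v i 0|)) => i.
  by apply: measurableT_comp => //; exact: measurable_coord.
- by move=> v; exact: expR_ge0.
- move=> v t; congr (expR (_ * _)); apply: eq_bigr => i /negbTE ip.
  by rewrite updE ip.
Qed.

Lemma Jint_local_lim : Jint llim.
Proof.
have [c1 c10 [C1 C10 h1]] := scaled_le pI ap0 aneg aoff S0 mu Ms Mp.
have iC : Jint (fun v => C1 * Phi c1 v) by exact: (JintZ C1 (Jint_Phi n c10)).
apply: (Jint_le _ _ iC) => [|v]; first exact: mcV_local_lim.
rewrite /local_lim; case: ifP => [v0|_]; last by rewrite normr0 mulr_ge0 ?Phi_ge0// ltW.
rewrite ger0_norm; last by rewrite !mulr_ge0 ?expR_ge0// gweight_ge0.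
have v1 : -1 <= v p 0 by apply: le_trans v0; rewrite oppr_le0.
by have [] := h1 1 v (lexx 1) v1.
Qed.

Definition laplace_scale L :=
  L^-1 * (Num.sqrt L)^-1 ^+ #|I :\ p| * expR (- (L * dots a (vstar I a))).

Lemma laplace_main : exists2 C, 0 < C & exists2 L0, 1 <= L0 & forall L, L0 <= L ->
  Jint (lpart L) /\
  `|JR (lpart L) - laplace_scale L * JR llim| <= C * (Num.sqrt L)^-1 * laplace_scale L.
Proof.
have [c c0 [C C0 [L0 L01 hn]]] :=
  local_near pI ap0 aneg aoff S0 mu Ms Mp eps0 posp posI ysI ysC.
have [k k0 hk] := J_slab c0 (ltW C0).
have iP := Jint_Phi n c0; have P0 := JR_ge0 (@Phi_ge0 R n c).
exists ((C + 2 * C / k) * JR (@Phi R n c) + 1).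
  by rewrite ltr_wpDl// mulr_ge0// addr_ge0 ?(ltW C0)// divr_ge0 ?mulr_ge0// ltW.
exists L0 => // L LL; have L1 : 1 <= L by exact: le_trans LL.
have Lp : 0 < L by exact: lt_le_trans L1.
have Li : 0 < L^-1 by rewrite invr_gt0.
have /andP[t0 t1] := sqrtV_le1 L1.
pose slab v := (if `|v p 0| <= L^-1 then C else 0) * expR (- c * tail_l1 p v).
have mslab : mcV (slab : _ -> measurableTypeR R).
  apply: measurable_funM.
    apply: measurable_fun_ifT => //; apply: measurable_fun_ler => //.
    by apply: measurableT_comp => //; exact: measurable_coord.
  apply: measurableT_comp => //; apply: measurable_funM => //.
  apply: (@mcV_sum _ _ _ _ _ (fun i (v : 'cV[R]_n) => `|v i 0|)) => i.
  by apply: measurableT_comp => //; exact: measurable_coord.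
have slab0 v : 0 <= slab v by rewrite mulr_ge0 ?expR_ge0//; case: ifP => // _; rewrite (ltW C0).
have slabE : J (fun v => (slab v)%:E) = (2 * C * L^-1 / k * JR (@Phi R n c))%:E.
  by rewrite hk ?(ltW Li)// JRE ?JRZ//; exact: JintZ.
have islab : Jint slab by apply: Jint_lty => //; rewrite slabE ltry.
have slabR : JR slab = 2 * C * L^-1 / k * JR (@Phi R n c) by rewrite /JR slabE.
pose G v := C * (Num.sqrt L)^-1 * Phi c v + slab v.
have iG : Jint G by apply: JintD => //; exact: JintZ.
have iL := Jint_local_lim.
have mS : mcV (lscaled L : _ -> measurableTypeR R) by exact: mcV_local_scaled.
have iD : Jint (fun v => lscaled L v - llim v).
  apply: (Jint_le _ _ iG); last by move=> v; exact: hn.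
  by apply: measurable_funB => //; exact: mcV_local_lim.
have iS : Jint (lscaled L).
  by apply: eq_Jint (JintD iD iL) => v; rewrite subrK.
have e0 := expR_ge0 (- (L * dots a (vstar I a))).
have lp0 v : 0 <= lpart L v.
  by rewrite /local_part; case: ifP => // _; rewrite mulr_ge0 ?expR_ge0 ?gweight_ge0.
have w0 : 0 <= laplace_scale L.
  by rewrite !mulr_ge0 ?expR_ge0 ?exprn_ge0 ?(ltW t0) ?(ltW Li).
have JE : J (fun v => (lpart L v)%:E) = (laplace_scale L * JR (lscaled L))%:E.
  rewrite (J_chart p I a L1)//; [|exact/measurable_EFinP/mcV_local].
  under eq_J do rewrite (local_chart pI ap0 aneg aoff S0)// EFinM.
  rewrite JZ//; [|exact/measurable_EFinP|]; last first.
    move=> v; rewrite lee_fin /local_scaled; case: ifP => // _.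
    by rewrite !mulr_ge0 ?expR_ge0// gweight_ge0.
  by rewrite JRE// -!EFinM mulrA.
have il : Jint (lpart L).
  by apply: Jint_lty => //; [exact: mcV_local|rewrite JE ltry].
split => //.
have -> : JR (lpart L) = laplace_scale L * JR (lscaled L) by rewrite {1}/JR JE.
rewrite -mulrBr normrM (ger0_norm w0) -(JRB iS iL) [leRHS]mulrC ler_wpM2l//.
apply: le_trans (JR_norm_le iD iG _) _; first by move=> v; exact: hn.
rewrite /G JRD//; last exact: JintZ.
rewrite JRZ// slabR.
have tL : L^-1 <= (Num.sqrt L)^-1.
  by rewrite (sqrtV_sqr L1) expr2 ler_piMl// ltW.
have : 2 * C * L^-1 / k * JR (@Phi R n c) <= 2 * C * (Num.sqrt L)^-1 / k * JR (@Phi R n c).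
  rewrite ler_wpM2r// ler_wpM2r ?invr_ge0 ?(ltW k0)// ler_wpM2l// mulr_ge0// ltW//.
move=> h; rewrite mulrDl mul1r; lra.
Qed.

End laplace_expansion.

(** * The constant *)
Section principal_minor.
Variable R : realType.

(** Two block-triangular factorisations of one and the same matrix. *)
Lemma det_sylvester m n (X : 'M[R]_(m, n)) (Y : 'M[R]_(n, m)) :
  \det (1%:M + X *m Y) = \det (1%:M + Y *m X).
Proof.
have e1 : block_mx 1%:M 0 Y 1%:M *m block_mx 1%:M (- X) 0 (1%:M + Y *m X) =
    block_mx 1%:M (- X) Y 1%:M :> 'M[R]_(m + n).
  by rewrite mulmx_block !mul1mx !mul0mx !mulmx1 !addr0 mulmxN [- _ + _]addrC addrK.
have e2 : block_mx 1%:M (- X) 0 1%:M *m block_mx (1%:M + X *m Y) 0 Y 1%:M =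
    block_mx 1%:M (- X) Y 1%:M :> 'M[R]_(m + n).
  by rewrite mulmx_block !mul1mx !mul0mx !mulmx1 !mulNmx !add0r addrK.
have := congr1 determinant e1; rewrite det_mulmx det_lblock det_ublock !det1 !mul1r => ->.
by rewrite -e2 det_mulmx det_ublock det_lblock !det1 !mul1r mulr1.
Qed.

Variables (n : nat) (I : {set 'I_n}) (B : 'M[R]_n).
Hypotheses (Bs : B^T = B) (Bp : posdef B).

Definition minor : 'M[R]_#|I| := \matrix_(i, j) B (enum_val i) (enum_val j).
Definition selmx : 'M[R]_(#|I|, n) := \matrix_(k, j) (enum_val k == j)%:R.
Definition inmx : 'M[R]_n := \matrix_(i, j) ((i == j) && (i \in I))%:R.
Definition outmx : 'M[R]_n := \matrix_(i, j) ((i == j) && (i \notin I))%:R.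

Local Notation U := selmx.
Local Notation E := inmx.
Local Notation F := outmx.

Lemma inmxD_outmx : E + F = 1%:M.
Proof.
apply/matrixP => i j; rewrite !mxE; case: (i == j) => /=; last by rewrite addr0.
by case: (i \in I); rewrite ?addr0 ?add0r.
Qed.

Lemma mul_inmx k (A : 'M[R]_(n, k)) i j : (E *m A) i j = if i \in I then A i j else 0.
Proof.
rewrite mxE (bigD1 i)//= big1 ?addr0 => [|l li]; last first.
  by rewrite mxE eq_sym (negbTE li) mul0r.
by rewrite mxE eqxx/=; case: ifP; rewrite ?mul1r ?mul0r.
Qed.

Lemma mul_outmx k (A : 'M[R]_(n, k)) i j : (F *m A) i j = if i \in I then 0 else A i j.
Proof.
rewrite mxE (bigD1 i)//= big1 ?addr0 => [|l li]; last first.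
  by rewrite mxE eq_sym (negbTE li) mul0r.
by rewrite mxE eqxx/=; case: ifP; rewrite ?mul1r ?mul0r.
Qed.

Lemma inmx_idem : E *m E = E.
Proof. by apply/matrixP => i j; rewrite mul_inmx mxE; case: (i \in I); rewrite ?andbF. Qed.
Lemma outmx_idem : F *m F = F.
Proof. by apply/matrixP => i j; rewrite mul_outmx mxE; case: (i \in I); rewrite ?andbF. Qed.
Lemma inmx_outmx : E *m F = 0.
Proof. by apply/matrixP => i j; rewrite mul_inmx !mxE; case: (i \in I); rewrite ?andbF. Qed.
Lemma outmx_inmx : F *m E = 0.
Proof. by apply/matrixP => i j; rewrite mul_outmx !mxE; case: (i \in I); rewrite ?andbF. Qed.
Lemma tr_outmx : F^T = F.
Proof. by apply/matrixP => i j; rewrite !mxE eq_sym; case: eqVneq => // ->. Qed.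

Lemma mul_selmx k (A : 'M[R]_(n, k)) i j : (U *m A) i j = A (enum_val i) j.
Proof.
rewrite mxE (bigD1 (enum_val i))//= big1 ?addr0 => [|l li]; last first.
  by rewrite mxE eq_sym (negbTE li) mul0r.
by rewrite mxE eqxx mul1r.
Qed.

Lemma selmx_mulT : U *m U^T = 1%:M.
Proof. by apply/matrixP => i j; rewrite mul_selmx !mxE (inj_eq enum_val_inj) eq_sym. Qed.

Lemma selmxT_mul : U^T *m U = E.
Proof.
apply/matrixP => i j; rewrite !mxE.
have [iI|iI] := boolP (i \in I).
  rewrite (bigD1 (enum_rank_in iI i))//= big1 ?addr0.
    by rewrite !mxE enum_rankK_in// eqxx mul1r andbT.
  move=> k ki; rewrite !mxE; case: eqP => [ke|]; rewrite ?mul0r//.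
  by case/eqP: ki; rewrite -[LHS](enum_valK_in iI) ke.
rewrite andbF big1// => k _; rewrite !mxE; case: eqP => [ke|]; rewrite ?mul0r//.
by rewrite -ke enum_valP in iI.
Qed.

Lemma selmx_form : U *m B *m U^T = minor.
Proof.
apply/matrixP => i j; rewrite -mulmxA mul_selmx [RHS]mxE.
have -> : B *m U^T = (U *m B)^T by rewrite trmx_mul Bs.
by rewrite mxE mul_selmx -[in LHS]Bs mxE.
Qed.

Lemma minor_sym : minor^T = minor.
Proof. by rewrite -selmx_form !trmx_mul trmxK Bs mulmxA. Qed.

Lemma minor_posdef : posdef minor.
Proof.
move=> c c0; have -> : bform minor c c = bform B (U^T *m c) (U^T *m c).
  by rewrite /bform -selmx_form trmx_mul trmxK !mulmxA.
apply: Bp; apply: contra c0 => /eqP h.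
by rewrite -[c]mul1mx -selmx_mulT -mulmxA h mulmx0.
Qed.

Lemma minor_unit : minor \in unitmx.
Proof.
have [d0 _] := gaussian_integral_posdef minor_sym minor_posdef.
by rewrite unitmxE unitfE gt_eqF.
Qed.

(** Padding with the identity off [I] keeps all determinants in dimension [n], where they can be
    multiplied. *)
Lemma det_minor : \det minor = \det (F + E *m B *m E).
Proof.
have -> : F + E *m B *m E = 1%:M + U^T *m ((minor - 1%:M) *m U).
  rewrite mulmxA mulmxBr mulmxBl mulmx1 selmxT_mul -selmx_form !mulmxA selmxT_mul -!mulmxA selmxT_mul.
  by rewrite -inmxD_outmx [E + F]addrC -addrA [E + _]addrC subrK.
by rewrite det_sylvester -mulmxA selmx_mulT mulmx1 addrCA subrr addr0.
Qed.

(** Jacobi's identity for complementary minors of an inverse: [E + M F] and [B (E + M F)] each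
    factor into a padded block and a unipotent matrix. *)
Lemma det_out_inv : 
  \det (E + F *m invmx B *m F) = \det minor / \det B.
Proof.
have [d0 _] := gaussian_integral_posdef Bs Bp.
have uB : B \in unitmx by rewrite unitmxE unitfE gt_eqF.
set M := invmx B.
have tri (X : 'M[R]_n) : \det (1%:M + E *m X *m F) = 1.
  by rewrite -mulmxA det_sylvester -mulmxA outmx_inmx mulmx0 addr0 det1.
have Z : E + M *m F = (E + F *m M *m F) *m (1%:M + E *m M *m F).
  rewrite mulmxDr mulmx1 mulmxDl -!mulmxA !(mulmxA E E) inmx_idem.
  rewrite [F *m (M *m (F *m (E *m _)))]mulmxA.
  rewrite !(mulmxA F E) outmx_inmx !mul0mx !mulmx0 addr0 -addrA; congr (_ + _).
  by rewrite -mulmxDl [F + E]addrC inmxD_outmx mul1mx.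
have Z2 : B *m (E + M *m F) = (F + E *m B *m E) *m (1%:M + F *m B *m E).
  rewrite [LHS]mulmxDr (mulmxA B M) (mulmxV uB) mul1mx mulmxDr mulmx1 mulmxDl -!mulmxA.
  rewrite !(mulmxA F F) outmx_idem !(mulmxA E F) inmx_outmx !mul0mx !mulmx0 addr0 addrC -addrA; congr (_ + _).
  by rewrite -mulmxDl inmxD_outmx mul1mx.
have tri2 (X : 'M[R]_n) : \det (1%:M + F *m X *m E) = 1.
  by rewrite -mulmxA det_sylvester -mulmxA inmx_outmx mulmx0 addr0 det1.
have := congr1 determinant Z2; rewrite !det_mulmx Z det_mulmx tri tri2 !mulr1 -det_minor => <-.
by rewrite mulrC mulKf// gt_eqF.
Qed.

End principal_minor.

Section laplace_constant.
Variables (R : realType) (n : nat) (p : 'I_n) (I : {set 'I_n}) (a : 'cV[R]_n).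
Hypotheses (pI : p \in I) (ap0 : 0 < a p 0).
Hypothesis aneg : forall i, i \in I -> i != p -> a i 0 < 0.
Hypothesis aoff : forall i, i \notin I -> a i 0 = 0.
Let S := \sum_i a i 0.
Hypothesis S0 : 0 < S.
Variables (B : 'M[R]_n) (mu : 'cV[R]_n).
Hypotheses (Bs : B^T = B) (Bp : posdef B) (Bd : 0 < \det B).
Implicit Types (v u : 'cV[R]_n).

Let M := invmx B.
Let K := I :\ p.
Let F := outmx R I.
Let E := inmx R I.
Let U := selmx R I.
Let uB : B \in unitmx. Proof. by rewrite unitmxE unitfE gt_eqF. Qed.
Let Ms : M^T = M. Proof. exact: (posdef_inv Bs Bp uB).1. Qed.
Let Mp : posdef M. Proof. exact: (posdef_inv Bs Bp uB).2. Qed.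

(** The diagonal and, with [kv], the rank-one part of [hessmx]. The value 1 off [I] matches the
    padding by [outmx] in [det_hess_out]. *)
Let dv i := if i == p then a p 0 ^+ 2 else if i \in I then - a i 0 else 1.
Let kv i := if i \in K then - a i 0 else 0.

(* Hessian of the limiting exponent, as a quadratic form on the coordinates of
   [I \ p], plus a fictitious Gaussian [a_p^2 v_p^2] in place of the exponential
   factor in [v_p], which makes the whole integral Gaussian. *)
Definition hessmx : 'M[R]_n := \matrix_(i, j)
  (if (i \in I) && (j \in I) then (i == j)%:R * dv i - kv i * kv j / a p 0 else 0).

Lemma hess_sym : hessmx^T = hessmx.
Proof.
apply/matrixP => i j; rewrite !mxE andbC; case: ifP => // _.
by rewrite eq_sym; case: eqVneq => [->//|_]; rewrite !mul0r [kv j * _]mulrC.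
Qed.

Lemma dv_gt0 i : 0 < dv i.
Proof.
rewrite /dv; case: eqVneq => [_|ip]; first by rewrite exprn_gt0.
by case: ifPn => // iI; rewrite oppr_gt0 aneg.
Qed.

Lemma hess_form v : bform hessmx v v =
  a p 0 ^+ 2 * v p 0 ^+ 2 + a p 0 * wvar I (softw p a) (spart p v).
Proof.
have spp : spart p v p = 0 by rewrite /spart eqxx.
have kE : \sum_(i in I) softw p a i * spart p v i = (\sum_(i in K) kv i * v i 0) / a p 0.
  rewrite (sum_setI pI) spp mulr0 add0r mulr_suml; apply: eq_bigr => i iK.
  rewrite /kv iK /softw /spart; case/setD1P: iK => /negbTE -> _; ring.
have qE : \sum_(i in I) softw p a i * spart p v i ^+ 2 = (\sum_(i in K) dv i * v i 0 ^+ 2) / a p 0.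
  rewrite (sum_setI pI) spp expr0n/= mulr0 add0r mulr_suml; apply: eq_bigr => i iK.
  rewrite /dv /softw /spart; case/setD1P: iK => /negbTE -> ->; ring.
rewrite /wvar kE qE bformE.
have -> : \sum_i \sum_j v i 0 * hessmx i j * v j 0 =
   \sum_(i in I) (dv i * v i 0 ^+ 2 - kv i * v i 0 * (\sum_(j in K) kv j * v j 0) / a p 0).
  rewrite [RHS]big_mkcond/=; apply: eq_bigr => i _.
  case: ifPn => [iI|/negbTE iI]; last by rewrite big1// => j _; rewrite mxE iI mulr0 mul0r.
  transitivity (\sum_(j in I) ((i == j)%:R * dv i * v i 0 * v j 0 - kv i * v i 0 * (kv j * v j 0) / a p 0)).
    rewrite [RHS]big_mkcond/=; apply: eq_bigr => j _.
    by rewrite mxE iI/=; case: ifP => _; [ring|rewrite mulr0 mul0r].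
  rewrite sumrB; congr (_ - _).
    rewrite (bigD1 i)//= eqxx big1 ?addr0 /=; first by rewrite mul1r expr2 mulrA.
    by move=> j /andP[_ ji]; rewrite eq_sym (negbTE ji) !mul0r.
  rewrite -mulr_suml -mulr_sumr (sum_setI pI); congr (_ * _ * _).
  by rewrite {1}/kv !inE eqxx mul0r add0r.
rewrite (sum_setI pI) {1}/dv eqxx {1}/kv !inE eqxx/= !mul0r subr0; congr (_ + _).
rewrite sumrB mulrBr; congr (_ - _); first by field; rewrite gt_eqF.
rewrite -mulr_suml -mulr_suml; field; by rewrite gt_eqF.
Qed.

Let HF : hessmx *m F = 0.
Proof.
rewrite -[LHS]trmxK trmx_mul hess_sym tr_outmx; apply/matrixP => i j.
by rewrite mxE mul_outmx !mxE; case: ifP => // h; rewrite h.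
Qed.

Let HE : hessmx *m E = hessmx.
Proof. by rewrite -[RHS]mulmx1 -(inmxD_outmx R I) mulmxDr HF addr0. Qed.

(** A rank-one perturbation of a diagonal matrix: by Sylvester the correction is the scalar
    [1 + sum_K a_i / a_p = S / a_p], which turns the diagonal entry [a_p^2] into [S * a_p]. *)
Lemma det_hess_out : \det (hessmx + F) = S * \prod_(i in I) `|a i 0|.
Proof.
have dn i : dv i != 0 by rewrite gt_eqF// dv_gt0.
pose D : 'M[R]_n := diag_mx (\row_i dv i).
pose X : 'cV[R]_n := \col_i (- (kv i / (a p 0 * dv i))).
pose Y : 'rV[R]_n := \row_i kv i.
have -> : hessmx + F = D *m (1%:M + X *m Y).
  apply/matrixP => i j; rewrite mul_diag_mx !mxE big_ord1 !mxE.
  case: (boolP (i \in I)) => iI; last first.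
    have ki : kv i = 0 by rewrite /kv !inE (negbTE iI) andbF.
    have ip : i != p by apply: contraNneq iI => ->.
    by rewrite /= andbT add0r ki mul0r oppr0 mul0r addr0 /dv (negbTE ip) (negbTE iI) mul1r.
  rewrite /= andbF addr0; case: (boolP (j \in I)) => jI.
    by case: (i == j); field; rewrite dn gt_eqF.
  have kj : kv j = 0 by rewrite /kv !inE (negbTE jI) andbF.
  rewrite kj mulr0 addr0; case: eqVneq => [ij|_]; last by rewrite mulr0.
  by rewrite -ij iI in jI.
rewrite det_mulmx det_diag det_sylvester.
have -> : \det (1%:M + Y *m X) = S / a p 0.
  rewrite [X in \det X]mx11_scalar det_scalar1 !mxE eqxx.
  transitivity (1 + \sum_(i in K) (a i 0 / a p 0)).
    congr (_ + _); rewrite [RHS]big_mkcond/=; apply: eq_bigr => i _; rewrite !mxE /kv.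
    case: ifPn => iK; last by rewrite mul0r.
    rewrite /dv; case/setD1P: (iK) => /negbTE ip iI; rewrite ip iI; field.
    by rewrite gt_eqF// lt_eqF// aneg// ip.
  rewrite /S (@sumI _ _ p I); last exact: aoff.
  by rewrite -mulr_suml; field; rewrite gt_eqF.
have -> : \prod_i (\row_i dv i) 0 i = \prod_i dv i by apply: eq_bigr => i _; rewrite mxE.
rewrite (bigID (mem I))/= [X in _ * X * _]big1 ?mulr1; last first.
  move=> i iI; rewrite /dv (negbTE iI); case: eqVneq => // ip; by rewrite ip pI in iI.
rewrite (bigD1 p)//= [in RHS](bigD1 p)//= {1}/dv eqxx gtr0_norm//.
rewrite (eq_bigr (fun i => `|a i 0|)); first by field; rewrite gt_eqF.
by move=> i /andP[iI ip]; rewrite /dv (negbTE ip) iI ltr0_norm// aneg.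
Qed.

Definition lapmx := hessmx + F *m M *m F.

(** The two blocks act on complementary coordinates, so [lapmx] is the product of their padded
    versions. *)
Lemma det_lapmx : \det lapmx = S * (\prod_(i in I) `|a i 0|) * (\det (minor I B) / \det B).
Proof.
rewrite -det_hess_out -(det_out_inv I Bs Bp) -det_mulmx; congr determinant.
rewrite mulmxDl !mulmxDr HE -!mulmxA (mulmxA hessmx F) HF mul0mx addr0.
by rewrite /F /E outmx_inmx add0r !mulmxA outmx_idem.
Qed.

Lemma bform_FMF u v : bform (F *m M *m F) u v = bform M (F *m u) (F *m v).
Proof. by rewrite /bform trmx_mul tr_outmx !mulmxA. Qed.

Lemma bform_addmx (M1 M2 : 'M[R]_n) u v : bform (M1 + M2) u v = bform M1 u v + bform M2 u v.
Proof. by rewrite /bform mulmxDr mulmxDl mxE. Qed.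

Let q0 := softw_gt0 ap0 aneg S0.
Let q1 := softw_sum1 pI ap0 aoff.

Lemma lapmx_sym : lapmx^T = lapmx.
Proof. by rewrite /lapmx linearD/= hess_sym !trmx_mul tr_outmx Ms mulmxA. Qed.

(** Each of the three nonnegative summands controls its own coordinates: [p], those off [I], and [I]
    without [p] through [wvar_lower]. *)
Lemma lapmx_posdef : posdef lapmx.
Proof.
move=> v v0; rewrite bform_addmx bform_FMF hess_form.
have sp : spart p v p = 0 by rewrite /spart eqxx.
have h1 : 0 <= a p 0 ^+ 2 * v p 0 ^+ 2 by rewrite mulr_ge0 ?sqr_ge0.
have h2 : 0 <= a p 0 * wvar I (softw p a) (spart p v).
  by rewrite mulr_ge0 ?(ltW ap0)//; apply: (wvar_ge0 pI q0 q1).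
have h3 := posdef_ge0 (F *m v) Mp.
rewrite lt_neqAle addr_ge0 ?addr_ge0// andbT; apply: contra v0; rewrite eq_sym.
rewrite paddr_eq0 ?addr_ge0// paddr_eq0// => /andP[/andP[z1 z2] z3].
have Fv : F *m v = 0.
  by apply/eqP; apply: contraTT z3 => /Mp h; rewrite gt_eqF.
have vp : v p 0 = 0.
  move: z1; rewrite mulf_eq0 sqrf_eq0 gt_eqF//=.
  by rewrite sqrf_eq0 => /eqP.
move: z2; rewrite mulf_eq0 gt_eqF//= => /eqP wv0.
have := wvar_lower pI q0 q1 sp; rewrite wv0 => hw.
have q2 : 0 < softw p a p / 2 by rewrite divr_gt0// q0.
have {hw} hw : \sum_(i in I) softw p a i * spart p v i ^+ 2 <= 0 by rewrite -(pmulr_rle0 _ q2).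
have pos i : i \in I -> 0 <= softw p a i * spart p v i ^+ 2.
  by move=> iI; rewrite mulr_ge0 ?sqr_ge0// ltW// q0.
apply/eqP/colP => i; rewrite [RHS]mxE; have [iI|/negbTE iI] := boolP (i \in I); last first.
  by have := congr1 (fun A : 'cV_n => A i 0) Fv; rewrite /F mul_outmx iI mxE.
have [->//|ip] := eqVneq i p.
have : \sum_(i in I) softw p a i * spart p v i ^+ 2 = 0.
  by apply/eqP; rewrite eq_le hw sumr_ge0.
move/eqP; rewrite psumr_eq0// => /allP/(_ i (mem_index_enum _))/implyP/(_ iI).
by rewrite mulf_eq0 gt_eqF ?q0//= sqrf_eq0 /spart (negbTE ip) => /eqP.
Qed.

Definition cbar (k : 'I_#|I|) := vstar I a (enum_val k) 0 - mu (enum_val k) 0.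

Let cv : 'cV[R]_#|I| := U *m (vstar I a - mu).
Let y0 : 'cV[R]_#|I| := invmx (minor I B) *m cv.
(** The conditional mean of the centred Gaussian vector given that its coordinates in [I] equal
    [vstar - mu]. As [M b0] is supported in [I], it is [M]-orthogonal to every vector vanishing on
    [I]. *)
Let b0 : 'cV[R]_n := B *m (U^T *m y0).

Let Mb0 : M *m b0 = U^T *m y0. Proof. by rewrite /b0 /M mulKmx. Qed.

Let FUT : F *m U^T = 0.
Proof.
have : (E + F) *m U^T = U^T by rewrite inmxD_outmx mul1mx.
rewrite mulmxDl /E -(selmxT_mul R I) -mulmxA selmx_mulT mulmx1 => h.
by apply: (addrI U^T); rewrite h addr0.
Qed.

Let Eb0 i : i \in I -> b0 i 0 = vstar I a i 0 - mu i 0.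
Proof.
move=> iI; have := mul_inmx I b0 i 0; rewrite iI => <-.
rewrite -(selmxT_mul R I) -!mulmxA /b0 (mulmxA U B) (mulmxA (U *m B) U^T) (selmx_form I Bs) /y0.
rewrite (mulmxA (minor I B)) mulmxV ?minor_unit// mul1mx /cv mulmxA selmxT_mul mul_inmx iI.
by rewrite [LHS]mxE [X in _ + X]mxE.
Qed.

Lemma bform_b0 : bform M b0 b0 = \sum_i \sum_l invmx (minor I B) i l * cbar i * cbar l.
Proof.
have -> : bform M b0 b0 = bform (invmx (minor I B)) cv cv.
  rewrite /bform -mulmxA Mb0 /b0 !trmx_mul trmxK Bs -!mulmxA.
  have ms : (invmx (minor I B))^T = invmx (minor I B) by rewrite trmx_inv minor_sym.
  rewrite (mulmxA U B) (mulmxA (U *m B) U^T) (selmx_form I Bs) ms /y0.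
  by rewrite (mulmxA (minor I B)) mulmxV ?minor_unit// mul1mx.
rewrite bformE; apply: eq_bigr => i _; apply: eq_bigr => l _.
have e k : cv k 0 = cbar k by rewrite mul_selmx [LHS]mxE [X in _ + X]mxE.
by rewrite !e [cbar i * _]mulrC.
Qed.

Let z0 : 'cV[R]_n := F *m (mu + b0).

(** Completing the square in the coordinates off [I]: the cross term vanishes by that orthogonality,
    and the shift [z0] leaves the coordinates in [I] alone. *)
Lemma local_exponent v :
  bform hessmx v v + bform M (atstar I a v - mu) (atstar I a v - mu) =
  bform lapmx (v - z0) (v - z0) + bform M b0 b0.
Proof.
set u := F *m (v - z0).
have uE : atstar I a v - mu = b0 + u.
  apply/colP => i; rewrite [LHS]mxE [X in _ + X]mxE [atstar I a v i 0]mxE [RHS]mxE /u mul_outmx.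
  case: ifPn => iI; first by rewrite addr0 Eb0.
  rewrite [(v - z0) i 0]mxE [X in _ = _ + (_ + X)]mxE /z0 mul_outmx (negbTE iI) [(mu + b0) i 0]mxE.
  ring.
have cross : bform M u b0 = 0.
  by rewrite /bform -mulmxA Mb0 /u trmx_mul tr_outmx -mulmxA (mulmxA F) FUT mul0mx mulmx0 mxE.
have hE : bform hessmx (v - z0) (v - z0) = bform hessmx v v.
  have z i : i \in I -> (v - z0) i 0 = v i 0.
    by move=> iI; rewrite [LHS]mxE [X in _ + X]mxE /z0 mul_outmx iI subr0.
  rewrite !hess_form z//; congr (_ + _ * _).
  by rewrite /wvar; congr (_ - _ ^+ 2); apply: eq_bigr => i iI; rewrite /spart z.
rewrite uE bform_addmx bform_FMF -/u hE !bformDl !bformDr (bform_sym b0 u Ms) cross; ring.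
Qed.

(** The one-sided exponential in [v p] has integral [1 / a_p], as has the normalised Gaussian [f'];
    after the exchange a single Gaussian integral with matrix [lapmx] remains. *)
Lemma JR_local_lim : JR (local_lim p I a M mu) =
  Num.sqrt ((2 * pi) ^+ n * \det B) * (Num.sqrt (2 * pi * \det (minor I B)))^-1 *
  (Num.sqrt (S * \prod_(i in I) `|a i 0|))^-1 *
  expR (- (1/2) * \sum_i \sum_l invmx (minor I B) i l * cbar i * cbar l).
Proof.
have pi0 : 0 < pi :> R := pi_gt0 R.
have tp : 0 < 2 * pi :> R by rewrite mulr_gt0.
have s2 : 0 < Num.sqrt (2 * pi) :> R by rewrite sqrtr_gt0.
pose G v := expR (- expo_lim p I a v) * gweight M mu (atstar I a v).
pose f' (t : R) := (Num.sqrt (2 * pi))^-1 * expR (- (1/2) * (a p 0 ^+ 2 * t ^+ 2)).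
have G0 v : 0 <= G v by rewrite mulr_ge0 ?expR_ge0 ?gweight_ge0.
have GE v : f' (v p 0) * G v = ((Num.sqrt (2 * pi))^-1 * expR (- (1/2) * bform M b0 b0)) *
    expR (- (1/2) * bform lapmx (v - z0) (v - z0)).
  rewrite /f' /G /gweight -!mulrA -!expRD; congr (_ * expR _).
  have := local_exponent v; rewrite hess_form /expo_lim; lra.
have spE v t : spart p (upd v p t) = spart p v.
  by apply/funext => i; rewrite /spart updE; case: (i == p).
have JE : J (fun v => (local_lim p I a M mu v)%:E) = J (fun v => (f' (v p 0) * G v)%:E).
  rewrite (@eq_J _ _ (fun v => (local_lim p I a M mu v)%:E) (fun v =>
     ((if 0 <= v p 0 then expR (- a p 0 * v p 0) else 0) * G v)%:E)); last first.
    move=> v; rewrite /local_lim; case: ifP => _; last by rewrite mul0r.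
    by rewrite /scaled_lim /G mulrA mulNr.
  apply: (@J_swap_coord _ _ p (fun t => if 0 <= t then expR (- a p 0 * t) else 0) f' G) => //.
  - exact: measurable_exp_ray.
  - apply: measurable_funM => //; apply: measurableT_comp => //; apply: measurable_funM => //.
    by apply: measurable_funM => //; exact: measurable_funX.
  - by move=> t; case: ifP => // _; exact: expR_ge0.
  - by move=> t; rewrite mulr_ge0 ?expR_ge0// invr_ge0 sqrtr_ge0.
  - rewrite integral_exp_ray// /f'; under eq_integral do rewrite EFinM.
    rewrite ge0_integralZl//; last first.
      apply/measurable_EFinP; apply: measurableT_comp => //; apply: measurable_funM => //.
      by apply: measurable_funM => //; exact: measurable_funX.
    rewrite integral_gauss_scaled ?exprn_gt0// -EFinM; congr EFin.
    rewrite (sqrtrM (a p 0 ^+ 2)^-1 (ltW tp)) mulrA mulVf ?gt_eqF// mul1r sqrtrV ?exprn_ge0 ?(ltW ap0)//.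
    by rewrite sqrtr_sqr gtr0_norm.
  - have ms i : mcV ((fun v => spart p v i) : _ -> measurableTypeR R).
      rewrite /mcV /spart; case: (i == p); first exact: measurable_cst.
      exact: measurable_coord.
    have mt (f : 'I_n -> 'cV[R]_n -> R) : (forall i, mcV (f i : _ -> measurableTypeR R)) ->
        mcV ((fun v => \sum_(i in I) f i v) : _ -> measurableTypeR R).
      by move=> mf; exact: mcV_sum.
    apply: measurable_funM; last first.
      apply: (mcV_comp (mcV_gweight M mu)) => i; rewrite /mcV; under eq_fun do rewrite mxE.
      case: (i \in I); [exact: measurable_cst|exact: measurable_coord].
    apply: measurableT_comp => //; apply: measurableT_comp => //; apply: measurable_funM => //.
    apply: measurable_funM => //; apply: measurable_funB.
      apply: (mt (fun i v => softw p a i * spart p v i ^+ 2)) => i.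
      apply: measurable_funM => //; apply: measurable_funX; exact: ms.
    apply: measurable_funX; apply: (mt (fun i v => softw p a i * spart p v i)) => i.
    apply: measurable_funM => //; exact: ms.
  - move=> v t; rewrite /G /expo_lim.
    have -> : atstar I a (upd v p t) = atstar I a v.
      apply/colP => i; rewrite [LHS]mxE [RHS]mxE; case: (boolP (i \in I)) => // iI.
      by rewrite updE; case: eqVneq => // ip; rewrite ip pI in iI.
    by rewrite spE.
have d0 : 0 < \det (minor I B).
  by have [] := gaussian_integral_posdef (minor_sym I Bs) (@minor_posdef _ _ I _ Bs Bp).
have P0 : 0 < \prod_(i in I) `|a i 0|.
  apply: prodr_gt0 => i iI; rewrite normr_gt0.
  by have [->|ip] := eqVneq i p; [rewrite gt_eqF|rewrite lt_eqF// aneg].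
have [_ JL] := gaussian_integral_posdef lapmx_sym lapmx_posdef.
have k0 : 0 <= (Num.sqrt (2 * pi))^-1 * expR (- (1/2) * bform M b0 b0).
  by rewrite mulr_ge0 ?expR_ge0// invr_ge0 sqrtr_ge0.
have mL c : mcV (fun v => (expR (- (1/2) * bform lapmx (v - c) (v - c)))%:E).
  by apply/measurable_EFinP; exact: mcV_gauss.
rewrite /JR JE; under eq_J do rewrite GE EFinM.
rewrite JZ//.
rewrite (J_shift z0)//.
rewrite (@eq_J _ _ _ (fun v => (expR (- (1/2) * bform lapmx v v))%:E)); last by move=> v; rewrite addrK.
rewrite JL -EFinM /= det_lapmx bform_b0 mulrAC; congr (_ * _).
set D := \det (minor I B); set P := \prod_(i in I) _.
have SP : 0 < S * P by rewrite mulr_gt0.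
have -> : (2 * pi) ^+ n / (S * P * (D / \det B)) = ((2 * pi) ^+ n * \det B) * ((S * P)^-1 * D^-1).
  by field; rewrite !gt_eqF.
have h1 : 0 <= (2 * pi) ^+ n * \det B by rewrite mulr_ge0 ?exprn_ge0 ?(ltW tp) ?(ltW Bd).
have h2 : 0 <= (S * P)^-1 by rewrite invr_ge0 ltW.
rewrite (sqrtrM ((S * P)^-1 * D^-1) h1) (sqrtrM D^-1 h2).
rewrite (sqrtrM D (ltW tp)) !sqrtrV ?(ltW SP) ?(ltW d0)// invfM; ring.
Qed.

End laplace_constant.

(** * First-order conditions *)
Section minimizer.
Variables (R : realType) (n m : nat) (B : 'M[R]_n) (mu : 'cV[R]_n).
Hypotheses (Bs : B^T = B) (Bp : posdef B).

Lemma bform_coord (u v : 'cV[R]_n) : bform B u v = \sum_i u i 0 * (B *m v) i 0.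
Proof. by rewrite /bform -mulmxA mxE; apply: eq_bigr => i _; rewrite mxE. Qed.

Lemma Delta_ge1 (p : 'I_n) (w : 'cV[R]_n) : in_Delta m p w -> (p < m)%N -> 1 <= w p 0.
Proof.
move=> [w0 wp wn ws] pm; rewrite -ws (bigD1 p)//= gerDl.
apply: sumr_le0 => i ip; case: (ltnP i m) => im; first by rewrite w0.
exact: wn.
Qed.

Section fixed.
Variables (p : 'I_n) (w : 'cV[R]_n).
Hypotheses (pm : (p < m)%N) (wmin : is_minimizer m p B w).

Let wD : in_Delta m p w. Proof. by case: wmin. Qed.
Definition minval := bform B w w.
Local Notation V := minval.
Local Notation I := (Ibar w).

Lemma minval_gt0 : 0 < V.
Proof.
apply: Bp; apply/eqP => w0; have := Delta_ge1 wD pm; rewrite w0 mxE.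
by rewrite leNgt ltr01.
Qed.

Lemma min_support : p \in I.
Proof. by rewrite inE gt_eqF// (lt_le_trans ltr01 (Delta_ge1 wD pm)). Qed.

Lemma min_support_ge (i : 'I_n) : i \in I -> i != p -> (m <= i)%N.
Proof.
have [w0 _ _ _] := wD; rewrite inE => wi ip; rewrite leqNgt.
by apply: contra wi => im; rewrite w0.
Qed.

(** [Delta] is convex, so a descent direction towards [w'] would contradict minimality after a short
    step. *)
Lemma min_variation (w' : 'cV[R]_n) : in_Delta m p w' -> 0 <= bform B (w' - w) w.
Proof.
move=> w'D; rewrite leNgt; apply/negP => g0.
set g := bform B _ _ in g0; set q := bform B (w' - w) (w' - w).
have q0 : 0 <= q by exact: posdef_ge0.
(* The step is short enough that [t * q <= - g]: the change [2 t g + t^2 q] of the form is then at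
   most [t g < 0]. *)
pose t := Num.min 1 (- g / (q + 1)).
have t0 : 0 < t by rewrite lt_min ltr01 divr_gt0 ?oppr_gt0// ltr_wpDl.
have t1 : t <= 1 by rewrite ge_min lexx.
have tq : t * q <= - g.
  apply: le_trans (_ : t * (q + 1) <= _); first by rewrite ler_pM2l// lerDl.
  by rewrite -ler_pdivlMr ?ltr_wpDl// ge_min lexx orbT.
have D : in_Delta m p (w + t *: (w' - w)).
  have E i : (w + t *: (w' - w)) i 0 = (1 - t) * w i 0 + t * w' i 0 by rewrite !mxE; ring.
  case: wD => a1 a2 a3 a4; case: w'D => b1 b2 b3 b4; split.
  - by move=> i im ip; rewrite E a1// b1// !mulr0 addr0.
  - by rewrite E addr_ge0// mulr_ge0// ?subr_ge0// ltW.
  - by move=> i im; rewrite E -[leRHS]addr0 lerD// mulr_ge0_le0// ?a3 ?b3// ?subr_ge0// ltW.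
  - by under eq_bigr do rewrite E; rewrite big_split/= -!mulr_sumr a4 b4; ring.
have [_ /(_ _ D)] := wmin.
rewrite bformDl !bformDr bformZl !bformZr bformZl (bform_sym w _ Bs) -/g -/q.
have : t * (t * q) <= t * - g by rewrite ler_pM2l.
have : t * g < 0 by rewrite pmulr_rlt0.
lra.
Qed.

Let tdir i := delta_mx p 0 - delta_mx i 0 : 'cV[R]_n.

Let tdirE i j : tdir i j 0 = (j == p)%:R - (j == i)%:R.
Proof. by rewrite !mxE !andbT. Qed.

Let tdir_sum i : \sum_j tdir i j 0 = 0.
Proof.
have d k : \sum_j (delta_mx k 0 : 'cV[R]_n) j 0 = 1.
  rewrite (bigD1 k)//= big1; first by rewrite mxE !eqxx addr0.
  by move=> j jk; rewrite mxE (negbTE jk).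
under eq_bigr => j _ do rewrite /tdir mxE [X in _ + X]mxE.
by rewrite sumrB !d subrr.
Qed.

Let tdir_form i : bform B (tdir i) w = (B *m w) p 0 - (B *m w) i 0.
Proof.
by rewrite /tdir bformDl bformNl /bform !trmx_delta -!mulmxA -!rowE !mxE.
Qed.

(** Mass moves between [p] and [i]: [s >= 0] makes coordinate [i] more negative, while [s = w i]
    erases it. Only on the support is the second move nontrivial, and there the gradient inequality
    becomes an equality. *)
Let tdir_D i (s : R) : i != p -> (m <= i)%N -> 0 <= s \/ (s = w i 0) ->
  in_Delta m p (w + s *: tdir i).
Proof.
move=> ip im hs; have [a1 a2 a3 a4] := wD.
have wi := a3 _ im.
have E j : (w + s *: tdir i) j 0 = w j 0 + s * ((j == p)%:R - (j == i)%:R).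
  by rewrite mxE [X in _ + X]mxE tdirE.
split.
- move=> j jm jp; rewrite E a1// (negbTE jp).
  have /negbTE -> : j != i by apply: contraTneq jm => ->; rewrite -leqNgt.
  by rewrite subrr mulr0 addr0.
- rewrite E eqxx [p == i]eq_sym (negbTE ip) subr0 mulr1.
  case: hs => [s0|->]; first by rewrite addr_ge0.
  have : 1 - w i 0 <= w p 0; last lra.
  rewrite -a4 (bigD1 p)//= (bigD1 i)//= [w i 0 + _]addrC addrA addrK gerDl.
  apply: sumr_le0 => j /andP[jp _]; case: (ltnP j m) => jm; first by rewrite a1.
  exact: a3.
- move=> j jm; rewrite E.
  have /negbTE -> : j != p by apply: contraTneq jm => ->; rewrite -ltnNge.
  have [->|ji] := eqVneq j i; last by rewrite subrr mulr0 addr0 a3.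
  by rewrite sub0r mulrN1; case: hs => [s0|->]; lra.
- under eq_bigr do rewrite mxE [X in _ + X]mxE.
  by rewrite big_split/= -mulr_sumr tdir_sum mulr0 addr0.
Qed.

Lemma min_grad_le (i : 'I_n) : (m <= i)%N -> (B *m w) i 0 <= (B *m w) p 0.
Proof.
move=> im; have ip : i != p by apply: contraTneq im => ->; rewrite -ltnNge.
have := min_variation (tdir_D ip im (or_introl ler01)).
by rewrite addrAC subrr add0r scale1r tdir_form subr_ge0.
Qed.

Lemma min_grad_support i : i \in I -> (B *m w) i 0 = (B *m w) p 0.
Proof.
move=> iI; have [->//|ip] := eqVneq i p.
have im := min_support_ge iI ip.
apply/eqP; rewrite eq_le min_grad_le//=.
have := min_variation (tdir_D ip im (or_intror erefl)).
rewrite addrAC subrr add0r bformZl tdir_form.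
have wi : w i 0 < 0.
  by have [_ _ a3 _] := wD; rewrite lt_neqAle a3// andbT; move: iI; rewrite inE.
by rewrite nmulr_rge0// subr_le0.
Qed.

Lemma min_gradp : (B *m w) p 0 = V.
Proof.
rewrite /minval bform_coord; have [_ _ _ ws] := wD.
rewrite -[LHS]mul1r -ws mulr_suml; apply: eq_bigr => i _.
have [/min_grad_support ->//|] := boolP (i \in I).
by rewrite inE negbK => /eqP ->; rewrite !mul0r.
Qed.

Lemma min_neg i : i \in I -> i != p -> w i 0 < 0.
Proof.
move=> iI ip; have [_ _ a3 _] := wD.
by rewrite lt_neqAle a3 ?min_support_ge// andbT; move: iI; rewrite inE.
Qed.

Lemma min_gradI i : i \in I -> (B *m w) i 0 = V.
Proof. by move/min_grad_support->; rewrite min_gradp. Qed.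

Lemma min_grad_lt (i : 'I_n) : assumption_A1 m B w -> (m <= i)%N -> i \notin I -> (B *m w) i 0 < V.
Proof.
move=> A1 im iI; rewrite lt_neqAle -{2}min_gradp min_grad_le// andbT -subr_eq0.
suff <- : bform B (delta_mx i 0 - w) w = (B *m w) i 0 - V by exact: A1.
rewrite bformDl bformNl; congr (_ - _).
by rewrite /bform trmx_delta -mulmxA -rowE !mxE.
Qed.

(* Otherwise [w'] would satisfy [<w', w> >= V], whence [|w' - w|^2 <= 0]. *)
Lemma min_grad_other (q : 'I_n) (w' : 'cV[R]_n) : (q < m)%N -> q != p -> is_minimizer m q B w' ->
  bform B w' w' <= V -> (B *m w) q 0 < V.
Proof.
move=> qm qp w'min w'V; rewrite ltNge; apply/negP => Vq.
have [w'D _] := w'min; have [b1 b2 b3 b4] := w'D.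
have h1 : V <= bform B w' w.
  rewrite bform_coord -[V]mul1r -b4 mulr_suml; apply: ler_sum => i _.
  have [iq|iq] := eqVneq i q; first by rewrite iq ler_wpM2l.
  case: (ltnP i m) => im; first by rewrite b1// !mul0r.
  by rewrite ler_wnM2l ?b3// -min_gradp min_grad_le.
have : bform B (w' - w) (w' - w) <= 0.
  rewrite bformDl !bformDr bformNl !bformNr bformNl (bform_sym w w' Bs) -/V.
  move: h1 w'V; rewrite /minval; lra.
have [ww _|/Bp h] := eqVneq (w' - w) 0; last by rewrite leNgt h.
have := Delta_ge1 w'D qm; have [a1 _ _ _] := wD.
by rewrite (subr0_eq ww) a1// leNgt ltr01.
Qed.

(** The vector of the [Abar], extended by zero off the support. *)
Definition mina : 'cV[R]_n := V^-1 *: w.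
Local Notation a := mina.

Lemma minaE i : a i 0 = w i 0 / V. Proof. by rewrite mxE mulrC. Qed.

Lemma mina_p : 0 < a p 0.
Proof. by rewrite minaE divr_gt0 ?minval_gt0// (lt_le_trans ltr01 (Delta_ge1 wD pm)). Qed.

Lemma mina_neg i : i \in I -> i != p -> a i 0 < 0.
Proof. by move=> iI ip; rewrite minaE pmulr_llt0 ?invr_gt0 ?minval_gt0// min_neg. Qed.

Lemma mina_off i : i \notin I -> a i 0 = 0.
Proof. by rewrite inE negbK minaE => /eqP ->; rewrite mul0r. Qed.

Lemma mina_sum : \sum_i a i 0 = V^-1.
Proof.
have [_ _ _ ws] := wD.
by under eq_bigr do rewrite minaE; rewrite -mulr_suml ws mul1r.
Qed.

Lemma mina_sum_gt0 : 0 < \sum_i a i 0.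
Proof. by rewrite mina_sum invr_gt0 minval_gt0. Qed.

(** On the support the gradient is constantly [V], so the principal minor maps the restriction of
    [V^-1 w] to the all-ones vector; inverting it gives the row sums. *)
Lemma AbarE k : Abar B w k = a (enum_val k) 0.
Proof.
have uM : minor I B \in unitmx by exact: minor_unit.
have Ew : inmx R I *m w = w.
  by apply/colP => i; rewrite mul_inmx; case: ifPn => //; rewrite inE negbK => /eqP ->.
pose o : 'cV[R]_#|I| := const_mx 1.
have h : minor I B *m (selmx R I *m a) = o.
  rewrite -(selmx_form I Bs) -!mulmxA (mulmxA (selmx R I)^T) selmxT_mul -scalemxAr Ew.
  rewrite -!scalemxAr; apply/colP => i; rewrite mxE mul_selmx min_gradI ?enum_valP//.
  by rewrite mxE mulVf// gt_eqF// minval_gt0.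
have := mulKmx uM (selmx R I *m a); rewrite h => /(congr1 (fun A : 'cV_#|I| => A k 0)).
rewrite mul_selmx => <-; rewrite mxE; apply: eq_bigr => j _.
by rewrite [X in _ = _ * X]mxE mulr1.
Qed.

Lemma sum_enum (F : 'I_n -> R) : (forall i, i \notin I -> F i = 0) ->
  \sum_(k < #|I|) F (enum_val k) = \sum_i F i.
Proof.
move=> F0; rewrite -(big_enum_val F)/= big_mkcond/=; apply: eq_bigr => i _.
by case: ifPn => // /F0.
Qed.

Lemma SbarE : Sbar B w = V^-1.
Proof.
rewrite /Sbar -mina_sum -sum_enum; last exact: mina_off.
by apply: eq_bigr => k _; exact: AbarE.
Qed.

Lemma delta4pE : delta4p B w = V.
Proof. by rewrite /delta4p SbarE invrK. Qed.

Lemma LbarE k : Lbar mu B w k = - (vstar I a (enum_val k) 0 - mu (enum_val k) 0).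
Proof.
have ak : a (enum_val k) 0 != 0.
  have := enum_valP k; have [->|kp kI] := eqVneq (enum_val k) p.
    by rewrite gt_eqF// mina_p.
  by rewrite lt_eqF// mina_neg.
rewrite /Lbar SbarE AbarE /mubar [vstar _ _ _ _]mxE enum_valP mina_sum opprB addrC; congr (_ + _).
rewrite -lnV; last by rewrite posrE divr_gt0 ?invr_gt0 ?minval_gt0// normr_gt0.
by rewrite invfM invrK mulrC.
Qed.

Lemma delta3pE : delta3p mu B w = - dots a (vstar I a - mu).
Proof.
rewrite /delta3p /dots -sumrN -sum_enum; last by move=> i /mina_off ->; rewrite mul0r oppr0.
by apply: eq_bigr => k _; rewrite AbarE LbarE mulrN; congr (- (_ * _)); rewrite [RHS]mxE [X in _ = _ + X]mxE.
Qed.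

Lemma prod_Abar : \prod_k `|Abar B w k| = \prod_(i in I) `|a i 0|.
Proof. by rewrite [RHS]big_enum_val/=; apply: eq_bigr => k _; rewrite AbarE. Qed.

Lemma prod_mina_gt0 : 0 < \prod_(i in I) `|a i 0|.
Proof.
apply: prodr_gt0 => i iI; rewrite normr_gt0.
by have [->|ip] := eqVneq i p; [rewrite gt_eqF// mina_p|rewrite lt_eqF// mina_neg].
Qed.

(** Identifies the explicit constant with the Laplace limit. The two square roots match through
    [sqrt (S / P) = S / sqrt (S P)], whose factor [S] cancels the division by [Sbar]. *)
Lemma delta1pE : 0 < \det B -> delta1p mu B w =
  (Num.sqrt ((2 * pi) ^+ n * \det B))^-1 * JR (local_lim p I a (invmx B) mu).
Proof.
move=> Bd; rewrite (JR_local_lim min_support mina_p mina_neg mina_off mina_sum_gt0 mu Bs Bp Bd).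
have x0 : 0 < Num.sqrt ((2 * pi) ^+ n * \det B).
  by rewrite sqrtr_gt0 mulr_gt0 ?exprn_gt0// mulr_gt0// pi_gt0.
rewrite /delta1p /Cbar prod_Abar mina_sum SbarE /Bbar -/(minor I B).
have P0 := prod_mina_gt0; set P := \prod_(i in I) _ in P0 *.
have S0 : 0 < V^-1 by rewrite invr_gt0 minval_gt0.
set S := V^-1 in S0 *.
have -> : \sum_i \sum_l abar B w i l * Lbar mu B w i * Lbar mu B w l =
   \sum_i \sum_l invmx (minor I B) i l * @cbar _ _ I a mu i * @cbar _ _ I a mu l.
  by apply: eq_bigr => i _; apply: eq_bigr => l _; rewrite !LbarE /cbar !mulrN mulNr opprK.
have -> : Num.sqrt (S / P) = S * (Num.sqrt (S * P))^-1.
  have -> : S / P = S ^+ 2 / (S * P) by field; rewrite !gt_eqF.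
  by rewrite sqrtrM ?sqr_ge0// sqrtr_sqr gtr0_norm// sqrtrV// mulr_ge0// ltW.
have [dm _] := gaussian_integral_posdef (minor_sym I Bs) (@minor_posdef _ _ I _ Bs Bp).
have q0 : 0 < Num.sqrt (2 * pi * \det (minor I B)).
  by rewrite sqrtr_gt0 mulr_gt0// mulr_gt0// pi_gt0.
have r0 : 0 < Num.sqrt (S * P) by rewrite sqrtr_gt0 mulr_gt0.
by field; rewrite !gt_eqF.
Qed.

Lemma delta1p_gt0 : 0 < delta1p mu B w.
Proof.
have [dm _] := gaussian_integral_posdef (minor_sym I Bs) (@minor_posdef _ _ I _ Bs Bp).
rewrite /delta1p /Cbar prod_Abar SbarE /Bbar -/(minor I B).
have S0 : 0 < V^-1 by rewrite invr_gt0 minval_gt0.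
apply: divr_gt0 => //; apply: mulr_gt0; last exact: expR_gt0.
apply: mulr_gt0; first by rewrite invr_gt0 sqrtr_gt0 mulr_gt0// mulr_gt0// pi_gt0.
by rewrite sqrtr_gt0 divr_gt0// prod_mina_gt0.
Qed.

End fixed.
End minimizer.

Lemma bform_expand (R : realType) n (A : 'M[R]_n) (t : R) (x u : 'cV[R]_n) : A^T = A ->
  bform A (t *: x + u) (t *: x + u) = t ^+ 2 * bform A x x + 2 * t * bform A x u + bform A u u.
Proof.
by move=> As; rewrite bformDl !bformDr !bformZl !bformZr (bform_sym u x As); ring.
Qed.

Lemma dotsB (R : realType) n (c u v : 'cV[R]_n) : dots c (u - v) = dots c u - dots c v.
Proof.
by rewrite /dots -sumrB; apply: eq_bigr => i _; rewrite [(u - v) _ _]mxE [X in _ + X]mxE mulrBr.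
Qed.

(** * The contribution of one peak *)

Section local_asymptotics.
Variables (R : realType) (n m : nat) (B : 'M[R]_n) (mu : 'cV[R]_n).
Hypotheses (Bs : B^T = B) (Bp : posdef B) (Bd : 0 < \det B).
Variables (p : 'I_n) (w : 'cV[R]_n).
Hypotheses (pm : (p < m)%N) (wmin : is_minimizer m p B w).
Local Notation V := (minval B w).
Local Notation I := (Ibar w).
Local Notation a := (mina B w).
Local Notation M := (invmx B).

Definition peak : 'cV[R]_n := V^-1 *: (B *m w).
Definition frontpos (i : 'I_n) := (i < m)%N.

Definition near_peak eps L y := in_cube eps L (y - L *: peak).
Definition above L (y : 'cV[R]_n) := expR L <= exp_diff frontpos y.

Definition tail_term L :=
  delta1p mu B w * L `^ delta2p w * expR (L * delta3p mu B w) * expR (- (L ^+ 2) / (2 * V)).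

Let uB : B \in unitmx. Proof. by rewrite unitmxE unitfE gt_eqF. Qed.
Let V0 : 0 < V. Proof. exact: (minval_gt0 Bp pm wmin). Qed.

Lemma mcV_above L : mcV (above L).
Proof.
apply: measurable_fun_ler => //; have := mcV_exp_diff frontpos (0 : 'cV[R]_n).
by rewrite /mcV; under eq_fun do rewrite add0r.
Qed.

Lemma mcV_near_peak eps L : mcV (near_peak eps L).
Proof.
apply: (@mcV_forall _ _ _ (fun i (v : 'cV[R]_n) => `|(v - L *: peak) i 0| <= eps * L)) => i.
apply: measurable_fun_ler => //; apply: measurableT_comp => //.
under eq_fun do rewrite mxE.
by apply: measurable_funD => //; exact: measurable_coord.
Qed.

Lemma mcV_restrict (Q : 'cV[R]_n -> bool) : mcV Q ->
  mcV ((fun y => if Q y then gauss_density mu B y else 0) : _ -> measurableTypeR R).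
Proof. by move=> mQ; apply: measurable_fun_ifT => //; exact: mcV_gauss_density. Qed.

Lemma bform_peak u : bform M peak u = dots a u.
Proof.
rewrite (bform_sym peak u (posdef_inv Bs Bp uB).1) /bform -mulmxA /peak -scalemxAr mulKmx//.
rewrite mxE; apply: eq_bigr => i _; by rewrite [u^T _ _]mxE mulrC.
Qed.

Lemma dots_peak : dots a peak = V^-1.
Proof.
rewrite /dots; transitivity (V^-1 * V^-1 * bform B w w).
  rewrite bform_coord mulr_sumr; apply: eq_bigr => i _.
  by rewrite [a _ _]mxE [peak _ _]mxE; ring.
by rewrite -mulrA mulVf ?mulr1// gt_eqF.
Qed.

(** Since [M peak = a], the expansion around [L peak] separates the Gaussian exponent, a linear tilt
    [L a] and a weight free of [L]: the integrand of the Laplace expansion. *)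
Lemma density_peak L v : gauss_density mu B (v + L *: peak) =
  (Num.sqrt ((2 * pi) ^+ n * \det B))^-1 * expR (- (L ^+ 2) / (2 * V) + L * dots a mu) *
  (expR (- (L * dots a v)) * gweight M mu v).
Proof.
rewrite /gauss_density /gweight -!mulrA -!expRD; congr (_ * expR _).
have -> : v + L *: peak - mu = L *: peak + (v - mu) by rewrite addrAC addrC.
move eu : (v - mu) => u.
rewrite (bform_expand L peak u (posdef_inv Bs Bp uB).1) !bform_peak dots_peak.
have -> : dots a u = dots a v - dots a mu by rewrite -eu dotsB.
by field; rewrite gt_eqF.
Qed.

Lemma powR_sqrtV (L : R) k : 0 < L -> (Num.sqrt L)^-1 ^+ k = L `^ (- (k%:R / 2)).
Proof.
move=> L0; rewrite powRN mulrC powRrM powR_mulrn ?powR_ge0// exprVn.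
by rewrite -powR12_sqrt// ltW.
Qed.

(** One coordinate at scale [1/L] and [nbar - 1] at scale [1/sqrt L] add up to the power
    [- (1 + nbar) / 2]. *)
Lemma laplace_scale_powR L : 0 < L -> laplace_scale p I a L =
  L `^ delta2p w * expR (- (L * dots a (vstar I a))).
Proof.
move=> L0; rewrite /laplace_scale powR_sqrtV//; congr (_ * _).
have -> : L^-1 = L `^ (-1) by rewrite powR_inv1// ltW.
rewrite -powRD ?(gt_eqF L0) ?implybT//; congr (_ `^ _).
rewrite /delta2p /nbar (cardsD1 p I) (min_support pm wmin) natrD mulr1n; lra.
Qed.

Lemma tail_termE L : 0 < L -> tail_term L =
  (Num.sqrt ((2 * pi) ^+ n * \det B))^-1 * expR (- (L ^+ 2) / (2 * V) + L * dots a mu) *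
  (laplace_scale p I a L * JR (local_lim p I a M mu)).
Proof.
move=> L0; rewrite laplace_scale_powR// /tail_term (delta1pE mu Bs Bp pm wmin Bd).
rewrite (delta3pE mu Bs Bp pm wmin) dotsB.
have -> : L * - (dots a (vstar I a) - dots a mu) = L * dots a mu + - (L * dots a (vstar I a)) by ring.
rewrite !expRD; ring.
Qed.

Hypothesis A1 : assumption_A1 m B w.
Hypothesis other : forall q : 'I_n, (q < m)%N -> q != p -> (B *m w) q 0 < V.

Lemma peakE i : peak i 0 = (B *m w) i 0 / V. Proof. by rewrite mxE mulrC. Qed.

Lemma peakI i : i \in I -> peak i 0 = 1.
Proof. by move=> iI; rewrite peakE (min_gradI Bs Bp pm wmin iI) divff// gt_eqF. Qed.

Lemma peakC i : i \notin I -> peak i 0 < 1.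
Proof.
move=> iI; rewrite peakE ltr_pdivrMr// mul1r.
case: (ltnP i m) => im; last exact: (min_grad_lt Bs Bp pm wmin A1 im iI).
by apply: other => //; apply: contraNneq iI => ->; exact: (min_support pm wmin).
Qed.

Lemma local_asymptotics eps : 0 < eps -> (forall i, i \notin I -> peak i 0 + 2 * eps <= 1) ->
  exists2 C, 0 < C & exists2 L0, 1 <= L0 & forall L, L0 <= L ->
  `|JR (fun y => if near_peak eps L y && above L y then gauss_density mu B y else 0)
    - tail_term L| <= C * (Num.sqrt L)^-1 * tail_term L.
Proof.
move=> eps0 hC.
have [Ms Mp] := posdef_inv Bs Bp uB.
have pI := min_support pm wmin.
have posI i : i \in I -> i != p -> ~~ frontpos i.
  by move=> iI ip; rewrite /frontpos -leqNgt (min_support_ge wmin iI ip).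
have [C C0 [L0 L01 h]] := laplace_main pI (mina_p Bp pm wmin) (mina_neg Bp pm wmin)
  (@mina_off _ _ _ _) (mina_sum_gt0 Bp pm wmin) mu Ms Mp eps0 (pm : frontpos p) posI peakI hC.
set lim := JR (local_lim _ _ _ _ _) in h *.
set k := fun L => (Num.sqrt ((2 * pi) ^+ n * \det B))^-1 * expR (- (L ^+ 2) / (2 * V) + L * dots a mu).
have D0 : 0 < (Num.sqrt ((2 * pi) ^+ n * \det B))^-1.
  by rewrite invr_gt0 sqrtr_gt0 mulr_gt0 ?exprn_gt0// mulr_gt0// pi_gt0.
have k0 L : 0 < k L by rewrite mulr_gt0 ?expR_gt0.
(* Positivity of the limit integral turns the bound of [laplace_main] into one relative to
   [tail_term]. *)
have lim0 : 0 < lim.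
  have := delta1p_gt0 mu Bs Bp pm wmin.
  by rewrite (delta1pE mu Bs Bp pm wmin Bd) pmulr_rgt0.
exists (C / lim); first exact: divr_gt0.
exists L0 => // L LL0; have [hJ hb] := h L LL0.
have Lp : 0 < L by rewrite (lt_le_trans _ LL0)// (lt_le_trans _ L01).
have mlp : mcV (local_part a M mu peak frontpos eps L : _ -> measurableTypeR R).
  exact: mcV_local.
have lp0 v : 0 <= local_part a M mu peak frontpos eps L v.
  by rewrite /local_part; case: ifP => // _; rewrite mulr_ge0 ?expR_ge0 ?gweight_ge0.
have mQ : mcV (fun y => near_peak eps L y && above L y).
  by apply: measurable_and; [exact: mcV_near_peak|exact: mcV_above].
have mF := mcV_restrict mQ.
have -> : JR (fun y => if near_peak eps L y && above L y then gauss_density mu B y else 0) =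
    k L * JR (local_part a M mu peak frontpos eps L).
  rewrite -JRZ// /JR; congr fine.
  rewrite (J_shift (L *: peak)); [|apply/measurable_EFinP; exact: mF|
    by move=> v; case: ifP => // _; rewrite lee_fin gauss_density_ge0].
  apply: eq_J => v; congr EFin; rewrite /near_peak addrK density_peak /local_part /exceeds /above.
  by rewrite [L *: peak + v]addrC; case: ifP => _; rewrite ?mulr0.
rewrite tail_termE// -/(k L) -/lim -mulrBr normrM gtr0_norm//.
apply: le_trans (ler_wpM2l (ltW (k0 L)) hb) _.
rewrite le_eqVlt; apply/orP; left; apply/eqP; field; by rewrite !gt_eqF ?sqrtr_gt0.
Qed.

End local_asymptotics.

(** * Tail bounds and summation over the peaks *)
Section gauss_prob.
Variables (R : realType) (n : nat) (B : 'M[R]_n) (mu : 'cV[R]_n).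
Hypotheses (Bs : B^T = B) (Bp : posdef B) (Bd : 0 < \det B).

Definition gauss_prob (Q : 'cV[R]_n -> bool) :=
  JR (fun y => if Q y then gauss_density mu B y else 0).

Lemma Jint_density (nu : 'cV[R]_n) : Jint (gauss_density nu B).
Proof.
apply: Jint_lty; [exact: mcV_gauss_density|exact: gauss_density_ge0|].
by rewrite J_gauss_density// ltry.
Qed.

Lemma Jint_restrict (Q : 'cV[R]_n -> bool) : mcV Q ->
  Jint (fun y => if Q y then gauss_density mu B y else 0).
Proof.
move=> mQ; apply: (Jint_le (mcV_restrict _ _ mQ)); last exact: (Jint_density mu).
by move=> y; case: ifP => _; rewrite ?normr0 ?ger0_norm ?gauss_density_ge0.
Qed.

(** Exponential tilting of a Gaussian is a translation of its mean by [B c]. *)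
Lemma gauss_density_tilt (c y : 'cV[R]_n) :
  expR (dots c y) * gauss_density mu B y =
  expR (dots c mu + (1/2) * bform B c c) * gauss_density (mu + B *m c) B y.
Proof.
have uB : B \in unitmx by rewrite unitmxE unitfE gt_eqF.
have Ms := (posdef_inv Bs Bp uB).1.
rewrite /gauss_density !mulrA ![_ * (Num.sqrt _)^-1]mulrC -!mulrA -!expRD; congr (_ * expR _).
have -> : y - (mu + B *m c) = (-1) *: (B *m c) + (y - mu).
  by rewrite scaleN1r opprD addrA addrC.
rewrite (bform_expand (-1) _ _ Ms).
have h v : bform (invmx B) (B *m c) v = dots c v.
  rewrite (bform_sym _ v Ms) /bform -mulmxA mulKmx// mxE; apply: eq_bigr => i _.
  by rewrite [v^T _ _]mxE mulrC.
rewrite !h dotsB.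
have -> : dots c (B *m c) = bform B c c by rewrite bform_coord.
by field.
Qed.

Lemma gauss_prob_ge0 Q : 0 <= gauss_prob Q.
Proof. by apply: JR_ge0 => y; case: ifP => // _; exact: gauss_density_ge0. Qed.

(** A union bound over finitely many half-spaces, each estimated by tilting along its own normal. *)
Lemma gauss_prob_chernoff (K : finType) (D : pred K) (c : K -> 'cV[R]_n) (r : K -> R)
    (Q : 'cV[R]_n -> bool) : mcV Q ->
  (forall y, Q y -> exists2 k, D k & r k <= dots (c k) y) ->
  gauss_prob Q <= \sum_(k | D k) expR (dots (c k) mu + (1/2) * bform B (c k) (c k) - r k).
Proof.
move=> mQ hQ.
pose F k (y : 'cV[R]_n) := expR (dots (c k) mu + (1/2) * bform B (c k) (c k) - r k) *
   gauss_density (mu + B *m c k) B y.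
have iF k : Jint (F k) by apply: JintZ; exact: Jint_density.
have JF k : JR (F k) = expR (dots (c k) mu + (1/2) * bform B (c k) (c k) - r k).
  rewrite /F JRZ; last exact: Jint_density.
  by rewrite /JR J_gauss_density//= mulr1.
have -> : \sum_(k | D k) expR (dots (c k) mu + (1/2) * bform B (c k) (c k) - r k) =
    JR (fun y => \sum_(k | D k) F k y).
  by rewrite JR_sum//; apply: eq_bigr => k _; rewrite JF.
apply: JR_le; [exact: Jint_restrict|by apply: Jint_sum => k _; exact: iF|].
have F0 k y : 0 <= F k y by rewrite mulr_ge0 ?expR_ge0 ?gauss_density_ge0.
move=> y; case: ifP => [/hQ[k Dk rk]|_]; last exact: sumr_ge0.
rewrite (bigD1 k)//=; apply: (@le_trans _ _ (F k y)); last by rewrite lerDl sumr_ge0.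
rewrite /F expRD mulrAC -gauss_density_tilt mulrAC -expRD -[leLHS]mul1r.
by rewrite ler_wpM2r ?gauss_density_ge0// -expR0 ler_expR subr_ge0.
Qed.

End gauss_prob.

Section dominated.
Variable R : realType.
Implicit Types (f g U : R -> R).

(** Landau's [f = O(U)] at infinity, with an explicit threshold at least 1. *)
Definition dominated U f :=
  exists2 C, 0 <= C & exists2 L0, 1 <= L0 & forall L, L0 <= L -> `|f L| <= C * U L.

Lemma dominatedD U f g : dominated U f -> dominated U g -> dominated U (fun L => f L + g L).
Proof.
move=> [C C0 [L0 L01 h]] [C' C'0 [L0' L01' h']]; exists (C + C'); first exact: addr_ge0.
exists (Num.max L0 L0'); first by rewrite le_max L01.
move=> L; rewrite ge_max => /andP[LL LL']; rewrite mulrDl.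
by apply: le_trans (ler_normD _ _) _; rewrite lerD ?h ?h'.
Qed.

Lemma dominated0 U : dominated U (fun=> 0).
Proof. by exists 0 => //; exists 1 => // L _; rewrite normr0 mul0r. Qed.

Lemma dominated_sum U (K : finType) (D : pred K) (f : K -> R -> R) :
  (forall k, D k -> dominated U (f k)) -> dominated U (fun L => \sum_(k | D k) f k L).
Proof.
move=> h; elim: (index_enum K) => [|k s IH].
  have -> : (fun L => \sum_(i <- [::] | D i) f i L) = (fun=> 0).
    by apply/funext => L; rewrite big_nil.
  exact: dominated0.
have -> : (fun L => \sum_(i <- k :: s | D i) f i L) =
    (fun L => (if D k then f k L else 0) + \sum_(i <- s | D i) f i L).
  by apply/funext => L; rewrite big_cons; case: ifP => // _; rewrite add0r.
apply: dominatedD => //; case: (boolP (D k)) => [/h//|_]; exact: dominated0.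
Qed.

Lemma dominated_le U f g : (exists2 L0, 1 <= L0 & forall L, L0 <= L -> `|f L| <= g L) ->
  dominated U g -> dominated U f.
Proof.
move=> [L0 L01 fg] [C C0 [L0' L01' h]]; exists C => //.
exists (Num.max L0 L0'); first by rewrite le_max L01.
move=> L; rewrite ge_max => /andP[LL LL'].
by apply: le_trans (fg _ LL) _; apply: le_trans (h _ LL'); exact: ler_norm.
Qed.

Lemma dominatedM h U f : (forall L, 1 <= L -> 0 <= h L) -> dominated U f ->
  dominated (fun L => h L * U L) (fun L => h L * f L).
Proof.
move=> h0 [C C0 [L0 L01 fU]]; exists C => //; exists L0 => // L LL.
have hL := h0 _ (le_trans L01 LL).
by rewrite normrM ger0_norm// mulrCA ler_wpM2l// fU.
Qed.

Lemma dominated_trans U U' f : dominated U' U -> dominated U f -> dominated U' f.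
Proof.
move=> [C C0 [L0 L01 h]] [C' C'0 [L0' L01' h']]; exists (C' * C); first exact: mulr_ge0.
exists (Num.max L0 L0'); first by rewrite le_max L01.
move=> L; rewrite ge_max => /andP[LL LL'].
apply: le_trans (h' _ LL') _; rewrite -mulrA ler_wpM2l//.
by apply: le_trans (h _ LL); exact: ler_norm.
Qed.

Lemma dominatedZ U f c : dominated U f -> dominated U (fun L => c * f L).
Proof.
move=> [C C0 [L0 L01 h]]; exists (`|c| * C); first exact: mulr_ge0.
by exists L0 => // L LL; rewrite normrM -mulrA ler_wpM2l// h.
Qed.

Lemma powR_le_exp s c : 0 < c -> dominated (fun L => expR (c * L)) (fun L => L `^ s).
Proof.
move=> c0; pose k := Num.bound `|s|.
have [C C0 h] := poly_exp_le k c0.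
exists C; first exact: ltW.
exists 1 => // L L1; have L0 : 0 <= L by exact: le_trans L1.
rewrite ger0_norm ?powR_ge0//; apply: le_trans (_ : L ^+ k <= _).
  rewrite -powR_mulrn//; apply: ler_powR => //.
  by apply: le_trans (ler_norm _) _; apply: ltW; exact: archi_boundP.
apply: le_trans (_ : (1 + L) ^+ k <= _); first by apply: lerXn2r; rewrite ?nnegrE ?addr_ge0// lerDr.
apply: le_trans (_ : (1 + L) ^+ k * expR (- c * L) * expR (c * L) <= _).
  by rewrite -mulrA -expRD mulNr addNr expR0 mulr1.
rewrite ler_wpM2r ?expR_ge0//; apply: le_trans (h L L0) _.
by rewrite ger_pMr// -expR0 ler_expR mulNr oppr_le0 mulr_ge0// ltW// divr_gt0.
Qed.

Lemma exp_absorb s c : c < 0 -> dominated (fun L => L `^ s) (fun L => expR (c * L)).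
Proof.
move=> c0; have nc0 : 0 < - c by rewrite oppr_gt0.
have [C C0 [L0 L01 h]] := powR_le_exp (- s) nc0.
exists C => //; exists L0 => // L LL.
have Lp : 0 < L by rewrite (lt_le_trans _ LL)// (lt_le_trans _ L01).
rewrite ger0_norm ?expR_ge0//; have := h L LL; rewrite ger0_norm ?powR_ge0//.
rewrite powRN mulNr expRN ler_pdivlMr ?expR_gt0// => {}h.
by rewrite -ler_pdivrMr ?powR_gt0// mulrC.
Qed.

Lemma maxover_max (K : finType) (A : {set K}) (f : K -> R) k : k \in A -> f k <= maxover A f.
Proof. by move=> kA; rewrite /maxover; apply: (le_bigmax_cond _ (fun i => f i) kA). Qed.

Lemma maxover_attained (K : finType) (A : {set K}) (f : K -> R) k : k \in A ->
  exists2 j, j \in A & f j = maxover A f.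
Proof.
move=> kA; rewrite /maxover; elim/big_ind: _ => [|x y [i iA <-] [j jA <-]|i iA].
- case: pickP => [i iA|/(_ k)]; first by exists i.
  by rewrite kA.
- by case: (leP (f i) (f j)) => _; [exists j|exists i].
- by exists i.
Qed.

End dominated.

(** * Chernoff bounds away from the peaks *)

Section far_bound.
Variables (R : realType) (n m : nat) (B : 'M[R]_n) (mu : 'cV[R]_n).
Hypotheses (Bs : B^T = B) (Bp : posdef B) (Bd : 0 < \det B).
Variable wbar : 'I_n -> 'cV[R]_n.
Hypothesis wmin : forall p : 'I_n, (p < m)%N -> is_minimizer m p B (wbar p).

(** The index [p] is that of the largest coordinate of positive sign: the positive sum is at most
    [n * exp (y p)], and it exceeds both [exp L] and every negative term. *)
Lemma above_front L (y : 'cV[R]_n) : (0 < n)%N -> above m L y ->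
  exists2 p : 'I_n, (p < m)%N & L - ln n%:R <= y p 0 /\
    forall i : 'I_n, (m <= i)%N -> y i 0 <= y p 0 + ln n%:R.
Proof.
move=> n0; rewrite /above /exp_diff => h.
set P := \sum_(i | frontpos m i) _ in h; set N := \sum_(i | ~~ frontpos m i) _ in h.
have N0 : 0 <= N by apply: sumr_ge0 => i _; exact: expR_ge0.
have [p0 p0m] : exists p0 : 'I_n, (p0 < m)%N.
  apply/existsP; apply: contraLR (lt_le_trans (expR_gt0 L) h) => /existsPn no.
  by rewrite -leNgt /P big1 ?sub0r ?oppr_le0// => i; rewrite /frontpos (negbTE (no i)).
case: (@Order.TotalTheory.arg_maxP _ _ 'I_n p0 (frontpos m) (fun i => y i 0) p0m) => p pm pmax.
exists p => //.
have n1 : (0 : R) < n%:R by rewrite ltr0n.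
have Pp : P <= n%:R * expR (y p 0).
  apply: le_trans (_ : \sum_(i | frontpos m i) expR (y p 0) <= _).
    by apply: ler_sum => i im; rewrite ler_expR; exact: (pmax i im).
  rewrite sumr_const -[leLHS]mulr_natl ler_wpM2r ?expR_ge0// ler_nat.
  by rewrite -[X in (_ <= X)%N](card_ord n) max_card.
have le_p t : expR t <= P -> t - ln n%:R <= y p 0.
  move=> tP; rewrite lerBlDr -ler_expR expRD lnK ?posrE// mulrC.
  exact: le_trans tP Pp.
split; first by apply: le_p; apply: le_trans h _; rewrite gerBl.
move=> i im; rewrite -lerBlDr; apply: le_p.
apply: le_trans (_ : N <= _).
  rewrite /N (bigD1 i)/=; last by rewrite /frontpos -leqNgt.
  by rewrite lerDl sumr_ge0// => j _; exact: expR_ge0.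
by rewrite -subr_ge0; apply: le_trans h; exact: expR_ge0.
Qed.

(** The negative weights reverse the upper bounds on [y i]; the weights sum to 1, so only multiples
    of the constant [c] are lost. *)
Lemma Delta_dots (p : 'I_n) (w y : 'cV[R]_n) L c : (p < m)%N -> in_Delta m p w ->
  L - c <= y p 0 -> (forall i : 'I_n, (m <= i)%N -> y i 0 <= y p 0 + c) ->
  L - w p 0 * c <= dots w y.
Proof.
move=> pm [w0 wp wn ws] yp yi.
have : \sum_i w i 0 * (y p 0 + (if i == p then 0 else c)) <= dots w y.
  apply: ler_sum => i _; case: eqVneq => [->|ip]; first by rewrite addr0.
  case: (ltnP i m) => im; first by rewrite w0// !mul0r.
  by rewrite ler_wnM2l ?wn ?yi.
have -> : \sum_i w i 0 * (y p 0 + (if i == p then 0 else c)) = y p 0 + c * (1 - w p 0).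
  under eq_bigr do rewrite mulrDr; rewrite big_split/= -mulr_suml ws mul1r; congr (_ + _).
  rewrite -ws (bigD1 p)//= eqxx mulr0 add0r [in RHS](bigD1 p)//= addrC addrK mulr_sumr.
  by apply: eq_bigr => i /negbTE ->; rewrite mulrC.
lra.
Qed.

Local Notation V p := (minval B (wbar p)).
Local Notation a p := (mina B (wbar p)).
Local Notation ys p := (peak B (wbar p)).
Variables (A : pred 'I_n) (D4 eps kappa : R).
Hypotheses (D40 : 0 < D4) (eps0 : 0 < eps).
Hypothesis VA : forall p : 'I_n, (p < m)%N -> A p -> V p = D4.
Hypothesis VnA : forall p : 'I_n, (p < m)%N -> ~~ A p -> V p < D4.

(* Chernoff directions: [L a] is the tilt that is optimal for [{X >= e^L}], and a
   constant extra tilt along a coordinate gains [e^(-s eps L)] away from the peak. *)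
Let W p := wbar p p 0 * ln n%:R / V p + dots (a p) mu.
Let s p := if A p then Num.max 0 ((W p + kappa) / eps) else 0.
Let sgn (b : bool) : R := if b then 1 else -1.
Let c L (k : 'I_n * 'I_n * bool) : 'cV[R]_n :=
  L *: a k.1.1 + (s k.1.1 * sgn k.2) *: delta_mx k.1.2 0.
Let r L (k : 'I_n * 'I_n * bool) :=
  L * (L - wbar k.1.1 k.1.1 0 * ln n%:R) / V k.1.1 +
  s k.1.1 * (sgn k.2 * (L * ys k.1.1 k.1.2 0) + eps * L).
Let D (k : 'I_n * 'I_n * bool) := (k.1.1 < m)%N.

Definition far L (y : 'cV[R]_n) :=
  above m L y && ~~ [exists p : 'I_n, [&& (p < m)%N, A p & near_peak B (wbar p) eps L y]].

Let s0 p : 0 <= s p.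
Proof. by rewrite /s; case: ifP => // _; rewrite le_max lexx. Qed.

Let dotsDl (u v y : 'cV[R]_n) t z : dots (t *: u + z *: v) y = t * dots u y + z * dots v y.
Proof. by rewrite /dots !mulr_sumr -big_split/=; apply: eq_bigr => i _; rewrite !mxE; ring. Qed.

Let dots_delta i (y : 'cV[R]_n) : dots (delta_mx i 0) y = y i 0.
Proof.
rewrite /dots (bigD1 i)//= big1; first by rewrite mxE !eqxx mul1r addr0.
by move=> j /negbTE ji; rewrite mxE ji mul0r.
Qed.

Lemma far_covered L y : 0 < L -> far L y -> exists2 k, D k & r L k <= dots (c L k) y.
Proof.
move=> L0 /andP[aL nfar].
have n0 : (0 < n)%N.
  have [n0|//] := posnP n; move: aL; rewrite /above /exp_diff.
  have no (i : 'I_n) : False by have := ltn_ord i; rewrite [X in (_ < X)%N]n0 ltn0.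
  by rewrite !big1 ?subr0 ?leNgt ?expR_gt0// => i; case: (no i).
have [p pm [yp yi]] := above_front n0 aL.
have V0 := minval_gt0 Bp pm (wmin pm).
have base : L * (L - wbar p p 0 * ln n%:R) / V p <= L * dots (a p) y.
  rewrite -mulrA ler_wpM2l ?(ltW L0)//.
  have -> : dots (a p) y = dots (wbar p) y / V p.
    by rewrite /dots mulr_suml; apply: eq_bigr => i _; rewrite minaE; ring.
  by rewrite ler_wpM2r ?invr_ge0 ?(ltW V0)//; apply: Delta_dots => //; case: (wmin pm).
have [Ap|nAp] := boolP (A p); last first.
  exists (p, p, true) => //; rewrite /r /c /= dotsDl /s (negbTE nAp) !mul0r !addr0.
  exact: base.
have : ~~ near_peak B (wbar p) eps L y.
  by apply: contra nfar => h; apply/existsP; exists p; rewrite pm Ap.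
rewrite /near_peak /in_cube negb_forall => /existsP[i]; rewrite -ltNge.
have -> : (y - L *: ys p) i 0 = y i 0 - L * ys p i 0.
  by rewrite mxE [X in _ + X]mxE [X in _ - X]mxE.
rewrite lter_normr => /orP[] h; [exists (p, i, true) => //|exists (p, i, false) => //];
  by rewrite /r /c/= dotsDl dots_delta lerD// -mulrA ler_wpM2l// /sgn; move: h; lra.
Qed.

(** The cross term [L * s * sgn * peak] of the quadratic form cancels against the threshold [r],
    leaving the extra tilt a net gain linear in [L]. *)
Lemma far_exponent L k : D k ->
  dots (c L k) mu + (1/2) * bform B (c L k) (c L k) - r L k =
  - (L ^+ 2) / (2 * V k.1.1) + L * (W k.1.1 - s k.1.1 * eps) +
  (s k.1.1 * sgn k.2 * mu k.1.2 0 + s k.1.1 ^+ 2 * B k.1.2 k.1.2 / 2).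
Proof.
case: k => [[p i] b] /= pm; rewrite /c /r/=.
have V0 := minval_gt0 Bp pm (wmin pm).
have aa : bform B (a p) (a p) = (V p)^-1.
  rewrite /mina bformZl bformZr; change (bform B (wbar p) (wbar p)) with (V p).
  by field; rewrite gt_eqF.
have ad : bform B (a p) (delta_mx i 0) = ys p i 0.
  rewrite (bform_sym _ _ Bs) bform_coord /peak -scalemxAr.
  exact: dots_delta.
rewrite dotsDl dots_delta (bform_expand L _ _ Bs) aa [bform B (a p) _]bformZr ad.
rewrite bformZl bformZr bform_delta /W.
have sg : sgn b ^+ 2 = 1 by rewrite /sgn; case: (b); rewrite ?sqrrN expr1n.
have -> : s p * sgn b * (s p * sgn b * B i i) = s p ^+ 2 * B i i * sgn b ^+ 2 by ring.
by rewrite sg; field; rewrite gt_eqF.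
Qed.

Lemma mcV_far L : mcV (far L).
Proof.
have mnear : mcV (fun v =>
    [forall p : 'I_n, ~~ [&& (p < m)%N, A p & near_peak B (wbar p) eps L v]]).
  apply: (@mcV_forall _ _ _ (fun (p : 'I_n) v =>
    ~~ [&& (p < m)%N, A p & near_peak B (wbar p) eps L v])) => p.
  apply: measurable_neg; rewrite /mcV; case: ((p < m)%N) => /=; last exact: measurable_cst.
  case: (A p) => /=; [exact: mcV_near_peak|exact: measurable_cst].
have -> : far L = (fun v => above m L v &&
    [forall p : 'I_n, ~~ [&& (p < m)%N, A p & near_peak B (wbar p) eps L v]]).
  by apply/funext => v; rewrite /far negb_exists.
by apply: measurable_and; [exact: mcV_above|exact: mnear].
Qed.

Lemma far_bound : dominated (fun L => expR (- (L ^+ 2) / (2 * D4) - kappa * L))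
  (fun L => gauss_prob B mu (far L)).
Proof.
apply: (@dominated_le _ _ _ (fun L => \sum_(k | D k)
    expR (dots (c L k) mu + (1/2) * bform B (c L k) (c L k) - r L k))).
  exists 1 => // L L1; rewrite ger0_norm ?gauss_prob_ge0//.
  apply: (@gauss_prob_chernoff _ _ B mu Bs Bp Bd _ D (c L) (r L) (far L) (mcV_far L)) => y.
  by apply: far_covered; exact: lt_le_trans L1.
apply: dominated_sum => k Dk.
have V0 := minval_gt0 Bp Dk (wmin Dk).
exists (expR (s k.1.1 * sgn k.2 * mu k.1.2 0 + s k.1.1 ^+ 2 * B k.1.2 k.1.2 / 2)).
  exact: expR_ge0.
have [Ak|nAk] := boolP (A k.1.1).
  exists 1 => // L L1; rewrite ger0_norm ?expR_ge0// far_exponent// -expRD ler_expR addrC lerD2l.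
  rewrite VA// lerD2l.
  have L0 : 0 <= L by exact: le_trans L1.
  have : W k.1.1 + kappa <= s k.1.1 * eps.
    by rewrite /s Ak -ler_pdivrMr// le_max lexx orbT.
  nra.
have VD := VnA Dk nAk.
(* A strictly smaller [V] worsens the quadratic rate by [g], which beats any linear term once [L] is
   large; hence no extra tilt is used for these indices. *)
pose g := (2 * V k.1.1)^-1 - (2 * D4)^-1.
have g0 : 0 < g by rewrite subr_gt0 ltf_pV2 ?posrE ?mulr_gt0// ltr_pM2l.
exists (Num.max 1 ((W k.1.1 + kappa) / g)); first by rewrite le_max lexx.
move=> L; rewrite ge_max => /andP[L1]; rewrite ler_pdivrMr// => Lg.
rewrite ger0_norm ?expR_ge0// far_exponent// -expRD ler_expR addrC lerD2l.
rewrite {1}/s (negbTE nAk) mul0r subr0.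
have -> : - L ^+ 2 / (2 * V k.1.1) = - L ^+ 2 / (2 * D4) - L * (L * g).
  by rewrite /g; ring.
have : L * (W k.1.1 + kappa) <= L * (L * g) by rewrite ler_wpM2l// (le_trans _ L1).
lra.
Qed.

End far_bound.

Lemma finite_pos_lower (R : realType) (K : finType) (D : pred K) (f : K -> R) :
  (forall k, D k -> 0 < f k) -> exists2 e, 0 < e & forall k, D k -> e <= f k.
Proof.
move=> f0; exists (\big[Num.min/1]_(k | D k) f k); last first.
  by move=> k Dk; apply: (bigmin_le_cond _ (fun k => f k) Dk).
by elim/big_ind: _ => // x y x0 y0; rewrite lt_min x0.
Qed.

(** * Summation over the peaks *)

Section assembly.
Variables (R : realType) (n m : nat) (B : 'M[R]_n) (mu : 'cV[R]_n) (wbar : 'I_n -> 'cV[R]_n).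
Hypotheses (m0 : (0 < m)%N) (mn : (m <= n)%N).
Hypotheses (Bs : B^T = B) (Bp : posdef B) (Bd : 0 < \det B).
Hypothesis wmin : forall p : 'I_n, (p < m)%N -> is_minimizer m p B (wbar p).
Hypothesis A1 : forall p : 'I_n, (p < m)%N -> assumption_A1 m B (wbar p).

Local Notation D4 := (delta4 m B wbar).
Local Notation D3 := (delta3 m mu B wbar).
Local Notation D2 := (delta2 m mu B wbar).
Local Notation D1 := (delta1 m mu B wbar).
Local Notation Q4 := (P4 m B wbar).
Local Notation Q3 := (P3 m mu B wbar).
Local Notation Q2 := (P2 m mu B wbar).
Local Notation V p := (minval B (wbar p)).

Let p0 : 'I_n := Ordinal (leq_trans m0 mn).

Let Pm0 : p0 \in Pm m. Proof. by rewrite inE. Qed.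

Let in4 p : p \in Q4 -> (p < m)%N /\ V p = D4.
Proof.
by rewrite !inE => /andP[pm /eqP <-]; rewrite (delta4pE Bs Bp pm (wmin pm)).
Qed.

Let V_le (p : 'I_n) : (p < m)%N -> V p <= D4.
Proof.
move=> pm; rewrite -(delta4pE Bs Bp pm (wmin pm)).
by apply: (maxover_max (fun p => delta4p B (wbar p))); rewrite inE.
Qed.

Let V_lt (p : 'I_n) : (p < m)%N -> p \notin Q4 -> V p < D4.
Proof.
move=> pm; rewrite !inE pm/= (delta4pE Bs Bp pm (wmin pm)) lt_neqAle V_le// => ->.
by [].
Qed.

Let p0m : (p0 < m)%N. Proof. exact: m0. Qed.

Let D40 : 0 < D4. Proof. exact: lt_le_trans (minval_gt0 Bp p0m (wmin p0m)) (V_le p0m). Qed.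

(** Each maximum is attained, so [P4], [P3] and [P2] are nonempty in turn; positivity makes an error
    bound relative to [rate] one relative to the main term. *)
Lemma delta1_gt0 : 0 < D1.
Proof.
have [p4 p4m e4] := maxover_attained (fun p => delta4p B (wbar p)) Pm0.
have h4 : p4 \in Q4 by rewrite inE p4m e4 eqxx.
have [p3 p3m e3] := maxover_attained (fun p => delta3p mu B (wbar p)) h4.
have h3 : p3 \in Q3 by rewrite inE p3m e3 eqxx.
have [p2 p2m e2] := maxover_attained (fun p => delta2p (wbar p)) h3.
have h2 : p2 \in Q2 by rewrite inE p2m e2 eqxx.
have pos p : p \in Q2 -> 0 < delta1p mu B (wbar p).
  rewrite inE => /andP[]; rewrite inE => /andP[/in4[pm _] _ _].
  exact: (delta1p_gt0 mu Bs Bp pm (wmin pm)).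
rewrite /delta1 (bigD1 p2)//= ltr_wpDr ?pos// sumr_ge0// => p /andP[/pos/ltW].
by [].
Qed.

Definition rate L := L `^ D2 * expR (L * D3) * expR (- (L ^+ 2) / (2 * D4)).
Definition error L := (Num.sqrt L)^-1 * rate L.

Lemma rate_ge0 L : 0 <= rate L.
Proof. by rewrite /rate !mulr_ge0 ?powR_ge0 ?expR_ge0. Qed.

Lemma errorE L : 1 <= L -> error L = L `^ (D2 - 1/2) * (expR (L * D3) * expR (- (L ^+ 2) / (2 * D4))).
Proof.
move=> L1; have L0 : 0 < L by exact: lt_le_trans L1.
have -> : error L = (Num.sqrt L)^-1 ^+ 1 * rate L by [].
rewrite powR_sqrtV// /rate !mulrA; congr (_ * _ * _).
by rewrite -powRD ?(gt_eqF L0) ?implybT//; congr (_ `^ _); ring.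
Qed.

(** A strict loss in the exponent linear in [L] outweighs any power of [L]. *)
Lemma exp_dominated_error s c : c < 0 -> dominated error
  (fun L => L `^ s * expR (c * L) * (expR (L * D3) * expR (- (L ^+ 2) / (2 * D4)))).
Proof.
move=> c0; have [C C0 [L0 L01 h]] := exp_absorb (D2 - 1/2 - s) c0.
exists C => //; exists L0 => // L LL.
have L1 : 1 <= L by exact: le_trans LL.
have Lp : 0 < L by exact: lt_le_trans L1.
rewrite errorE// ger0_norm ?mulr_ge0 ?powR_ge0 ?expR_ge0// [C * (_ * _)]mulrA.
rewrite ler_wpM2r ?mulr_ge0 ?expR_ge0//.
have := h L LL; rewrite ger0_norm ?expR_ge0// => {}h.
apply: le_trans (ler_wpM2l (powR_ge0 L s) h) _.
rewrite mulrCA -powRD ?(gt_eqF Lp) ?implybT//.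
by rewrite [s + _]addrC subrK.
Qed.

Let coef p := if p \in Q2 then delta1p mu B (wbar p) else 0.

(** Outside [P3] the loss is exponential in [L]; in [P3] but outside [P2] it is a power of [L]; in
    [P2] the two expressions coincide. *)
Lemma tail_term_rate p : p \in Q4 ->
  dominated error (fun L => tail_term B mu (wbar p) L - coef p * rate L).
Proof.
move=> p4; have [pm VE] := in4 p4.
have tE L : tail_term B mu (wbar p) L = delta1p mu B (wbar p) *
    (L `^ delta2p (wbar p) * expR (L * delta3p mu B (wbar p)) * expR (- (L ^+ 2) / (2 * D4))).
  by rewrite /tail_term VE; ring.
have [p3|n3] := boolP (p \in Q3); last first.
  have e : coef p = 0 by rewrite /coef inE (negbTE n3).
  have lt3 : delta3p mu B (wbar p) - D3 < 0.
    rewrite subr_lt0 lt_neqAle (maxover_max (fun p => delta3p mu B (wbar p)) p4) andbT.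
    by move: n3; rewrite inE p4.
  have := dominatedZ (delta1p mu B (wbar p)) (exp_dominated_error (delta2p (wbar p)) lt3).
  congr (dominated _ _); apply/funext => L; rewrite tE e mul0r subr0; congr (_ * _).
  by rewrite !mulrA; congr (_ * _); rewrite -mulrA -expRD; congr (_ * expR _); ring.
have e3 : delta3p mu B (wbar p) = D3 by move: p3; rewrite inE => /andP[_ /eqP].
have [p2|n2] := boolP (p \in Q2).
  have e2 : delta2p (wbar p) = D2 by move: p2; rewrite inE => /andP[_ /eqP].
  have -> : (fun L => tail_term B mu (wbar p) L - coef p * rate L) = (fun=> 0).
    by apply/funext => L; rewrite tE /coef p2 e2 e3 subrr.
  exact: dominated0.
have e : coef p = 0 by rewrite /coef (negbTE n2).
(* Support sizes are integers, so two different values of [delta2p] are at least 1/2 apart, exactly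
   the exponent of the error. *)
have d2 : delta2p (wbar p) <= D2 - 1/2.
  have [q q3 qE] := maxover_attained (fun p => delta2p (wbar p)) p3.
  have le2 := maxover_max (fun p => delta2p (wbar p)) p3.
  have ne : delta2p (wbar p) != D2 by move: n2; rewrite inE p3.
  have : delta2p (wbar p) < delta2p (wbar q) by rewrite qE lt_neqAle ne le2.
  change (delta2p (wbar q) = D2) in qE; rewrite -qE /delta2p.
  rewrite ltrN2 ltr_pM2r ?invr_gt0// ltrD2l ltr_nat -ltnS => hq.
  have : (nbar (wbar q)).+1%:R <= (nbar (wbar p))%:R :> R by rewrite ler_nat.
  rewrite -natr1; lra.
have := dominatedZ (delta1p mu B (wbar p)) (_ : dominated error
   (fun L => L `^ delta2p (wbar p) * (expR (L * D3) * expR (- (L ^+ 2) / (2 * D4))))).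
have -> : (fun L => tail_term B mu (wbar p) L - coef p * rate L) =
   (fun L => delta1p mu B (wbar p) *
   (L `^ delta2p (wbar p) * (expR (L * D3) * expR (- (L ^+ 2) / (2 * D4))))).
  by apply/funext => L; rewrite tE e mul0r subr0 e3 !mulrA.
apply; exists 1 => //; exists 1 => // L L1.
rewrite errorE// mul1r ger0_norm ?mulr_ge0 ?powR_ge0 ?expR_ge0//.
by rewrite ler_wpM2r ?mulr_ge0 ?expR_ge0// ler_powR.
Qed.

Lemma error_rate : dominated rate error.
Proof.
exists 1 => //; exists 1 => // L L1; rewrite /error normrM mul1r.
rewrite (ger0_norm (rate_ge0 L)) -[leRHS]mul1r ler_wpM2r ?rate_ge0//.
by have /andP[s0 s1] := sqrtV_le1 L1; rewrite ger0_norm// ltW.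
Qed.

Lemma tail_term_dominated p : p \in Q4 -> dominated rate (tail_term B mu (wbar p)).
Proof.
move=> p4; have h := dominated_trans error_rate (tail_term_rate p4).
have r : dominated rate rate.
  by exists 1 => //; exists 1 => // L _; rewrite mul1r ger0_norm ?rate_ge0.
have := dominatedD h (dominatedZ (coef p) r).
by congr (dominated _ _); apply/funext => L; rewrite subrK.
Qed.

(** The event splits into disjoint neighbourhoods of the peaks indexed by [P4] and the far set. *)
Lemma gauss_prob_asymptotics :
  dominated error (fun L => gauss_prob B mu (above m L) - D1 * rate L).
Proof.
have other p : p \in Q4 -> forall q : 'I_n, (q < m)%N -> q != p -> (B *m wbar p) q 0 < V p.
  move=> /in4[pm VE] q qm qp; apply: (min_grad_other Bs Bp pm (wmin pm) qm qp (wmin qm)).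
  by rewrite VE; exact: V_le.
have [e e0 he] := @finite_pos_lower R _
  (fun k : 'I_n * 'I_n => (k.1 \in Q4) && (k.2 \notin Ibar (wbar k.1)))
  (fun k => 1 - peak B (wbar k.1) k.2 0) (fun k h =>
   ltac:(move/andP: h => [h4 hI]; rewrite subr_gt0;
     exact: (peakC Bs Bp (in4 h4).1 (wmin (in4 h4).1) (A1 (in4 h4).1) (other _ h4) hI))).
(* The local expansion needs a margin of [2 * eps]; the third [eps] makes the neighbourhoods of
   different peaks disjoint. *)
pose eps := e / 3.
have eps0 : 0 < eps by rewrite divr_gt0.
have hC p i : p \in Q4 -> i \notin Ibar (wbar p) -> peak B (wbar p) i 0 + 3 * eps <= 1.
  by move=> p4 iI; have := he (p, i); rewrite p4 iI => /(_ isT) /=; rewrite /eps; lra.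
pose Qn p L y := near_peak B (wbar p) eps L y && above m L y.
have mQn p L : mcV (Qn p L) by apply: measurable_and; [exact: mcV_near_peak|exact: mcV_above].
have loc p : p \in Q4 -> dominated error (fun L => gauss_prob B mu (Qn p L) - coef p * rate L).
  move=> p4; have [pm VE] := in4 p4.
  have hC2 i : i \notin Ibar (wbar p) -> peak B (wbar p) i 0 + 2 * eps <= 1.
    by move=> iI; have := hC p i p4 iI; lra.
  have [C C0 [L0 L01 h]] := local_asymptotics mu Bs Bp Bd pm (wmin pm) eps0 hC2.
  have h1 : dominated (fun L => (Num.sqrt L)^-1 * tail_term B mu (wbar p) L)
      (fun L => gauss_prob B mu (Qn p L) - tail_term B mu (wbar p) L).
    by exists C; [exact: ltW|exists L0 => // L LL; rewrite mulrA; exact: h].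
  have h2 := @dominatedM R (fun L => (Num.sqrt L)^-1) _ _
    (fun L _ => ltac:(by rewrite invr_ge0 sqrtr_ge0)) (tail_term_dominated p4).
  have := dominatedD (dominated_trans h2 h1) (tail_term_rate p4).
  by congr (dominated _ _); apply/funext => L; rewrite addrA subrK.
have farD : dominated error (fun L => gauss_prob B mu (far m B wbar (mem Q4) eps L)).
  (* With [kappa = 1 - D3] the far set has a factor [exp (- L)] to spare against [exp (L * D3)]. *)
  have := far_bound mu Bs Bp Bd wmin (A := mem Q4) (1 - D3) D40 eps0 _ _.
  move=> fb; apply: (dominated_trans _ (fb _ _)).
  - have n1 : -1 < 0 :> R by [].
    have := exp_dominated_error 0 n1; congr (dominated _ _); apply/funext => L.
    rewrite powRr0 mul1r -!expRD; congr expR; ring.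
  - by move=> p pm /in4[].
  - by move=> p pm; exact: V_lt.
apply: (@dominated_le _ _ _ (fun L => `|(\sum_(p in Q4) (gauss_prob B mu (Qn p L) - coef p * rate L)) +
   gauss_prob B mu (far m B wbar (mem Q4) eps L)|)); last first.
  have [C C0 [L0 L01 h]] := dominatedD (dominated_sum loc) farD.
  by exists C => //; exists L0 => // L LL; rewrite normr_id; exact: h.
exists 1 => // L L1; have Lp : 0 < L by exact: lt_le_trans L1.
have -> : D1 * rate L = \sum_(p in Q4) coef p * rate L.
  rewrite -mulr_suml; congr (_ * _); rewrite /delta1 big_mkcond/= [RHS]big_mkcond/=.
  apply: eq_bigr => p _; rewrite /coef; case: ifPn => p2; last by rewrite if_same.
  by move: (p2); rewrite inE => /andP[]; rewrite inE => /andP[-> _ _].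
suff -> : gauss_prob B mu (above m L) = \sum_(p in Q4) gauss_prob B mu (Qn p L) +
    gauss_prob B mu (far m B wbar (mem Q4) eps L) by rewrite sumrB addrAC lexx.
have mfar : mcV (far m B wbar (mem Q4) eps L) by exact: mcV_far.
rewrite /gauss_prob -JR_sum; last by move=> p _; exact: Jint_restrict.
rewrite -JRD; [|by apply: Jint_sum => p _; exact: Jint_restrict|exact: Jint_restrict].
apply: eq_JR => y; rewrite /Qn /far.
have [aL|/negbTE aL] := boolP (above m L y); last first.
  by rewrite /= big1 ?addr0// => p _; rewrite andbF.
rewrite /=; case: existsP => [[p /and3P[pm p4 np]]|no]/=; last first.
  rewrite big1 ?add0r// => p p4; rewrite andbT; case: ifP => // np.
  by case: no; exists p; rewrite np (in4 p4).1 !andbT.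
rewrite addr0 (bigD1 p)//= np big1 ?addr0// => q /andP[q4 qp]; rewrite andbT.
case: ifP => // nq; exfalso.
have [qm _] := in4 q4.
(* Disjointness is read off coordinate [p]: the peak of [p] has value 1 there and that of [q] at
   most [1 - 3 * eps], so cubes of radius [eps * L] cannot meet. *)
have qI : p \notin Ibar (wbar q).
  have [[w0 _ _ _] _] := wmin qm.
  by rewrite inE negbK w0// eq_sym.
have h1 := hC q p q4 qI.
have pk : peak B (wbar p) p 0 = 1.
  exact: (peakI Bs Bp pm (wmin pm) (min_support pm (wmin pm))).
have /forallP/(_ p) := np; have /forallP/(_ p) := nq.
have sub (u : 'cV[R]_n) : (y - L *: u) p 0 = y p 0 - L * u p 0.
  by rewrite mxE [X in _ + X]mxE [X in _ - X]mxE.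
rewrite !sub pk !ler_norml => /andP[k1 k2] /andP[k3 k4]; nra.
Qed.

End assembly.

Theorem theorem3 (R : realType) (d : measure_display) (T : measurableType d)
  (P : probability T R) (n m : nat) (mu : 'cV[R]_n) (B : 'M[R]_n)
  (Y : 'I_n -> T -> R) (wbar : 'I_n -> 'cV[R]_n) :
  (0 < m)%N -> (m <= n)%N ->
  B^T = B -> (forall v : 'cV[R]_n, 0 <= bform B v v) -> 0 < \det B ->
  (forall i, measurable_fun setT (Y i)) ->
  gaussian_vector P Y mu B ->
  (forall p : 'I_n, (p < m)%N -> is_minimizer m p B (wbar p)) ->
  (forall p : 'I_n, (p < m)%N -> assumption_A1 m B (wbar p)) ->
  exists K x0 : R, forall x : R, x0 <= x ->
    `| fine (P [set t | x <= Xm m Y t]%classic) - main_term m mu B wbar x |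
      <= K * `| main_term m mu B wbar x | * (ln x) `^ (- (1/2)).
Proof.
move=> m0 mn Bs B0 Bd mY GY wmin A1.
have Bp := psd_posdef Bs B0 Bd.
have D10 := delta1_gt0 mu m0 mn Bs Bp wmin.
have [C C0 [L0 L01 h]] := gauss_prob_asymptotics mu m0 mn Bs Bp Bd wmin A1.
set D1 := delta1 m mu B wbar in D10 h.
(* With [L = ln x], the threshold [L0] becomes [expR L0]; dividing by [D1] makes the bound relative
   to the main term [D1 * rate]. *)
exists (C / D1), (expR L0) => x Lx.
have x0 : 0 < x by exact: lt_le_trans (expR_gt0 L0) Lx.
have LL : L0 <= ln x by rewrite -ler_expR lnK.
have Lp : 0 < ln x by rewrite (lt_le_trans _ LL)// (lt_le_trans _ L01).
have XE t : Xm m Y t = exp_diff (frontpos m) (\col_i Y i t).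
  rewrite /Xm /exp_diff; congr (_ - _); last first.
    by apply: eq_big => [i|i _]; rewrite ?mxE// /frontpos -leqNgt.
  by apply: eq_bigr => i _; rewrite mxE.
have -> : fine (P [set t | x <= Xm m Y t]%classic) = gauss_prob B mu (above m (ln x)).
  rewrite /gauss_prob /JR -(gaussian_vector_law Bs Bp Bd mY GY (mcV_above m (ln x))).
  congr (fine (P _)); apply/seteqP; split=> t /=; rewrite /above XE lnK//.
have -> : main_term m mu B wbar x = D1 * @rate R n m B mu wbar (ln x).
  rewrite /main_term /rate -/D1 !mulrA; congr (_ * _ * _).
  by rewrite /powR gt_eqF// mulrC.
apply: le_trans (h _ LL) _.
rewrite /error normrM (gtr0_norm D10) ger0_norm ?rate_ge0//.
have -> : (ln x) `^ (- (1/2)) = (Num.sqrt (ln x))^-1.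
  by rewrite -[RHS]expr1 powR_sqrtV.
rewrite le_eqVlt; apply/orP; left; apply/eqP.
by field; rewrite !gt_eqF ?sqrtr_gt0.
Qed.
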